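(* Define, for polynomials $p$ on $\mathbb{R}^m$ and $z\in\mathbb{R}^m$, $$\mathcal W(p)(z):=c_\kappa^{-1}\int_{\mathbb{R}^m}L(iy,z)\,\mathcal F_\kappa\big(p(\cdot)e^{-|\cdot|^2/2}\big)(y)\,\omega_\kappa(y)\,dy,$$ with $L(iy,z)=c_\kappa^{-1}\int_{\mathbb{R}^m}E_\kappa(-ix,y)e^{-\langle x,z\rangle}e^{-|x|^2/2}e^{|y|^2/2}\omega_\kappa(x)dx$. Then $\mathcal W(T_jp)=\partial_j\mathcal W(p)$ for every polynomial $p$ and every $j=1,\dots,m$ (with $\partial_j$ acting in $z$).
   Context: Let $G\subset O(m)$ be a finite reflection group with root system $R$, fixed positive subsystem $R_+$, and let $\kappa:R\to[0,\infty)$ be a $G$-invariant multiplicity function. For $\alpha\in R$, $\sigma_\alpha x=x-2\langle x,\alpha\rangle\alpha/\|\alpha\|^2$. The Dunkl operators are $T_jf(x)=\partial_jf(x)+\sum_{\alpha\in R_+}\kappa(\alpha)\alpha_j\frac{f(x)-f(\sigma_\alpha x)}{\langle \alpha,x\rangle}$. The Dunkl kernel $E_\kappa(x,y)$ (holomorphic on $\mathbb{C}^m\times\mathbb{C}^m$) satisfies $T_j^{(x)}E_\kappa(x,y)=y_jE_\kappa(x,y)$, $E_\kappa(0,y)=1$. The weight is $\omega_\kappa(x)=\prod_{\alpha\in R_+}|\langle\alpha,x\rangle|^{2\kappa(\alpha)}$, $c_\kappa=\int_{\mathbb{R}^m}e^{-|x|^2/2}\omega_\kappa(x)dx$, and the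 Dunkl transform is $\mathcal F_\kappa f(y)=c_\kappa^{-1}\int_{\mathbb{R}^m}E_\kappa(-ix,y)f(x)\omega_\kappa(x)\,dx$. *)

(* Defs.v *)
From HB Require Import structures.
From mathcomp Require Import all_boot all_order all_algebra.
From mathcomp Require Import all_classical all_reals all_analysis.
From mathcomp Require Import complex.
Import Order.TTheory GRing.Theory Num.Theory.
Import numFieldNormedType.Exports.

Set Implicit Arguments.
Unset Strict Implicit.
Unset Printing Implicit Defensive.

Local Open Scope ring_scope.
Local Open Scope complex_scope.

Section ComplexNormed.
Variable R : rcfType.
HB.instance Definition _ := NormedModule.copy R[i] (R[i])^o.
End ComplexNormed.

(* bilinear (not hermitian) pairing <u,v> = sum_i u_i v_i *)
Definition dotv (K : ringType) (m : nat) (u v : 'rV[K]_m) : K :=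
  \sum_(i < m) u 0 i * v 0 i.

Definition evec (K : ringType) (m : nat) (j : 'I_m) : 'rV[K]_m := delta_mx 0 j.

Definition refl (K : fieldType) (m : nat) (a x : 'rV[K]_m) : 'rV[K]_m :=
  x - (2 * dotv x a / dotv a a) *: a.

Definition root_system (R : realType) (m : nat) (Rt : seq 'rV[R]_m) : Prop :=
  [/\ uniq Rt,
      (forall a, a \in Rt -> a != 0),
      (forall a b, a \in Rt -> b \in Rt -> refl a b \in Rt) &
      (forall a (c : R), a \in Rt -> c *: a \in Rt -> c = 1 \/ c = -1)].

Definition positive_subsystem (R : realType) (m : nat) (Rt Rp : seq 'rV[R]_m) : Prop :=
  exists b : 'rV[R]_m,
    (forall a, a \in Rt -> dotv a b != 0) /\
    perm_eq Rp [seq a <- Rt | 0 < dotv a b].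

Inductive refl_group (R : realType) (m : nat) (Rt : seq 'rV[R]_m)
  : ('rV[R]_m -> 'rV[R]_m) -> Prop :=
| refl_group_id : refl_group Rt id
| refl_group_step : forall a g, a \in Rt -> refl_group Rt g ->
    refl_group Rt (refl a \o g).

Definition multiplicity (R : realType) (m : nat) (Rt : seq 'rV[R]_m)
  (kap : 'rV[R]_m -> R) : Prop :=
  (forall a, a \in Rt -> 0 <= kap a) /\
  (forall g a, refl_group Rt g -> a \in Rt -> kap (g a) = kap a).

(* Dunkl operators, over R (emb = id) or over C (emb = real embedding) *)
(* T_j f(x) = d_j f(x) + sum_{a in R+} kap(a) a_j (f x - f(sigma_a x))/<a,x>,
   where on the hyperplane <a,x> = 0 the difference quotient is replaced by
   its continuous extension, the directional derivative of f in the
   direction 2a/<a,a>.                                                   *)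
Definition dunkl (R : realType) (K : numFieldType) (emb : R -> K) (m : nat)
  (Rp : seq 'rV[R]_m) (kap : 'rV[R]_m -> R) (j : 'I_m)
  (f : 'rV[K]_m -> K) (x : 'rV[K]_m) : K :=
  'D_(evec K j) f x +
  \sum_(a <- Rp)
     emb (kap a) * emb (a 0 j) *
     (let aK := map_mx emb a in
      if dotv aK x != 0 then (f x - f (refl aK x)) / dotv aK x
      else 'D_((2 / dotv aK aK) *: aK) f x).

Definition cplx (R : rcfType) (r : R) : R[i] := r%:C.

(* Holomorphy on C^n (Osgood): continuous and complex-differentiable in
   each variable separately. *)
Definition holomorphic (R : realType) (n : nat) (g : 'rV[R[i]]_n -> R[i]) : Prop :=
  continuous g /\ forall (w : 'rV[R[i]]_n) (k : 'I_n), derivable g w (evec _ k).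

Definition dunkl_kernel (R : realType) (m : nat) (Rp : seq 'rV[R]_m)
  (kap : 'rV[R]_m -> R) (E : 'rV[R[i]]_m -> 'rV[R[i]]_m -> R[i]) : Prop :=
  [/\ holomorphic (fun w : 'rV[R[i]]_(m + m) => E (lsubmx w) (rsubmx w)),
      (forall (y x : 'rV[R[i]]_m) (j : 'I_m),
          dunkl (@cplx R) Rp kap j (fun x' => E x' y) x = y 0 j * E x y) &
      (forall y, E 0 y = 1)].

(* Lebesgue integration on R^m (as iterated Lebesgue integrals over R, *)
(* which by Tonelli equals the integral w.r.t. the m-fold product of   *)
(* Lebesgue measure for nonnegative measurable functions).             *)
Fixpoint iint (R : realType) (n : nat) : ('rV[R]_n -> \bar R) -> \bar R :=
  match n with
  | 0 => fun f => f 0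
  | n'.+1 => fun f =>
      (\int[@lebesgue_measure R]_(t in setT)
          iint (fun v : 'rV[R]_n' => f (row_mx (const_mx t : 'rV[R]_1) v)))%E
  end.

Definition integrableRm (R : realType) (m : nat) (f : 'rV[R]_m -> R) : bool :=
  (iint (fun x => (`|f x|)%:E) < +oo)%E.

(* integral over R^m of a real function (0 if not absolutely integrable) *)
Definition intRm (R : realType) (m : nat) (f : 'rV[R]_m -> R) : R :=
  if integrableRm f then
    fine (iint (fun x => (Num.max (f x) 0)%:E)) -
    fine (iint (fun x => (Num.max (- f x) 0)%:E))
  else 0.

Definition cintRm (R : realType) (m : nat) (g : 'rV[R]_m -> R[i]) : R[i] :=
  (intRm (fun x => complex.Re (g x)))%:C + 'i * (intRm (fun x => complex.Im (g x)))%:C.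

Definition sqnorm (R : realType) (m : nat) (x : 'rV[R]_m) : R := dotv x x.

Definition gauss (R : realType) (m : nat) (x : 'rV[R]_m) : R :=
  expR (- (sqnorm x / 2)).

Definition weight (R : realType) (m : nat) (Rp : seq 'rV[R]_m)
  (kap : 'rV[R]_m -> R) (x : 'rV[R]_m) : R :=
  \prod_(a <- Rp) (`|dotv a x| `^ (2 * kap a)).

Definition c_kappa (R : realType) (m : nat) (Rp : seq 'rV[R]_m)
  (kap : 'rV[R]_m -> R) : R :=
  intRm (fun x => gauss x * weight Rp kap x).

Definition cvec (R : realType) (m : nat) (x : 'rV[R]_m) : 'rV[R[i]]_m :=
  map_mx (@cplx R) x.
Definition minus_i (R : realType) (m : nat) (x : 'rV[R]_m) : 'rV[R[i]]_m :=
  map_mx (fun r => - 'i * r%:C) x.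

Definition dunkl_transform (R : realType) (m : nat) (Rp : seq 'rV[R]_m)
  (kap : 'rV[R]_m -> R) (E : 'rV[R[i]]_m -> 'rV[R[i]]_m -> R[i])
  (f : 'rV[R]_m -> R) (y : 'rV[R]_m) : R[i] :=
  (c_kappa Rp kap)^-1%:C *
  cintRm (fun x => E (minus_i x) (cvec y) * (f x * weight Rp kap x)%:C).

Definition Lker (R : realType) (m : nat) (Rp : seq 'rV[R]_m)
  (kap : 'rV[R]_m -> R) (E : 'rV[R[i]]_m -> 'rV[R[i]]_m -> R[i])
  (y z : 'rV[R]_m) : R[i] :=
  (c_kappa Rp kap)^-1%:C *
  cintRm (fun x => E (minus_i x) (cvec y) *
     (expR (- dotv x z) * gauss x * expR (sqnorm y / 2) * weight Rp kap x)%:C).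

Definition Wop (R : realType) (m : nat) (Rp : seq 'rV[R]_m)
  (kap : 'rV[R]_m -> R) (E : 'rV[R[i]]_m -> 'rV[R[i]]_m -> R[i])
  (p : 'rV[R]_m -> R) (z : 'rV[R]_m) : R[i] :=
  (c_kappa Rp kap)^-1%:C *
  cintRm (fun y => Lker Rp kap E y z *
     dunkl_transform Rp kap E (fun x => p x * gauss x) y *
     (weight Rp kap y)%:C).

Definition is_polynomial (R : realType) (m : nat) (p : 'rV[R]_m -> R) : Prop :=
  exists s : seq (R * m.-tuple nat),
    forall x, p x = \sum_(c <- s) c.1 * \prod_(i < m) x 0 i ^+ tnth c.2 i.

(* Main.v *)
(** Write T_v for the Dunkl operator in direction v, and Lam f for the integral
    of f against the Gaussian times the weight.  On the real space
    E(-ix, y) = sum_n (-i)^n E_n(x, y), where E_n is determined by the radial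
    part (n + K) E_n = <x, y> E_(n-1) of the Dunkl equations; the difference of
    both sides vanishes by an energy estimate along rays.  Integrating by parts
    against a regularized weight gives
      Lam (T_v f g) + Lam (f T_v g) = Lam (<v, .> f g)
    on polynomials, so that the Dunkl transform of p gauss is h gauss for the
    polynomial h obtained from p by replacing multiplication by <v, .> with
    -i (<v, .> - T_v), and T_v p corresponds to i T_v h because the T_v commute.
    Expanding exp(-<x, z>) turns L(iy, z) into a series of such polynomials
    attached to <., z>^n, and the adjunction formula evaluates the pairing of
    its n-th term with h: W(p)(z) = sum_n (T_z^n p)(0) / n!, a finite sum whose
    derivative along e_j is the same sum for T_j p. *)
Require Import Defs.
From HB Require Import structures.
From mathcomp Require Import all_boot all_order all_algebra.
From mathcomp Require Import all_classical all_reals all_analysis.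
From mathcomp Require Import measurable_realfun.
From mathcomp Require Import complex.
From mathcomp Require Import ring lra.
Import Order.TTheory GRing.Theory Num.Theory.
Import numFieldNormedType.Exports.
Set Implicit Arguments.
Unset Strict Implicit.
Unset Printing Implicit Defensive.
Local Open Scope ring_scope.
Local Open Scope complex_scope.
Local Open Scope classical_set_scope.

(** The kernel is known only through its defining properties: they contain neither a growth bound
    nor a series nor uniqueness. The bound (|x| |y|)^n / n! on E_n comes from the finiteness of the
    group: on an orbit n + K is a finite matrix, and a maximum principle shows that inverting it
    costs at most a factor 1/n. The quotients by <a, x> rule out a direct uniqueness argument for E.
    On the slice -ix, however, y couples real and imaginary part like a rotation, and the singular
    terms only dissipate energy once all rays through one orbit are taken together; Gronwall's
    inequality then applies. The second obstacle is the exchange of sum and integral in W. The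
    factor exp(|y|^2/2) of L(iy, z) uses up the Gaussian of its terms, so only the Gaussian of the
    transform of p is left for domination. This forces a bound 2^-n A exp(B |y|) on the n-th term,
    obtained from a majorant recursion of Hermite type. Integrals over R^m are iterated
    one-dimensional ones; their invariance under reflections is derived from translations and a sign
    change in one variable. *)

Lemma cvg_mx (K : numFieldType) (T : Type) (F : set_system T) (FF : Filter F)
    m n (g : T -> 'M[K]_(m, n)) (l : 'M[K]_(m, n)) :
  (forall i j, (fun x => g x i j) @ F --> l i j) -> g @ F --> l.
Proof.
move=> H; apply/cvg_ballP => e e0.
suff : \forall x \near F, forall ij : 'I_m * 'I_n, ball (l ij.1 ij.2) e (g x ij.1 ij.2).
  by apply: filterS => x Hx; split => // i j; exact: (Hx (i, j)).
by apply: filter_forall => -[i j] /=; move/cvg_ballP : (H i j); apply.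
Qed.

Lemma continuous_mx (K : numFieldType) (T : topologicalType) m n (g : T -> 'M[K]_(m, n)) :
  (forall i j, continuous (fun x => g x i j)) -> continuous g.
Proof. by move=> H x; apply: cvg_mx => i j; exact: H. Qed.

(** * Limits and continuity of finite sums and products *)

Section BigopLimits.
Variables (K : numFieldType) (T : Type) (F : set_system T).
Context {FF : Filter F}.

Lemma cvg_sumr (I : eqType) (r : seq I) (f : I -> T -> K) (l : I -> K) :
  (forall i, i \in r -> f i @ F --> l i) ->
  (fun x => \sum_(i <- r) f i x) @ F --> \sum_(i <- r) l i.
Proof.
elim: r => [_|i r IH H].
  rewrite big_nil (_ : (fun _ => _) = (fun=> 0)); first exact: cvg_cst.
  by apply/funext => x; rewrite big_nil.
rewrite big_cons (_ : (fun _ => _) = (fun x => f i x + \sum_(i <- r) f i x)); last first.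
  by apply/funext => x; rewrite big_cons.
apply: cvgD; first by apply: H; rewrite mem_head.
by apply: IH => j jr; apply: H; rewrite inE jr orbT.
Qed.

Lemma cvg_prodr (I : eqType) (r : seq I) (f : I -> T -> K) (l : I -> K) :
  (forall i, i \in r -> f i @ F --> l i) ->
  (fun x => \prod_(i <- r) f i x) @ F --> \prod_(i <- r) l i.
Proof.
elim: r => [_|i r IH H].
  rewrite big_nil (_ : (fun _ => _) = (fun=> 1)); first exact: cvg_cst.
  by apply/funext => x; rewrite big_nil.
rewrite big_cons (_ : (fun _ => _) = (fun x => f i x * \prod_(i <- r) f i x)); last first.
  by apply/funext => x; rewrite big_cons.
apply: cvgM; first by apply: H; rewrite mem_head.
by apply: IH => j jr; apply: H; rewrite inE jr orbT.
Qed.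

End BigopLimits.

Section ContinuousOperations.
Variables (K : numFieldType) (T : topologicalType).
Implicit Types f g : T -> K.

Lemma continuous_funD f g : continuous f -> continuous g ->
  continuous (fun x => f x + g x).
Proof. by move=> cf cg x; apply: (@cvgD _ _ _ (nbhs x)); [exact: cf|exact: cg]. Qed.

Lemma continuous_funM f g : continuous f -> continuous g ->
  continuous (fun x => f x * g x).
Proof. by move=> cf cg x; apply: (@cvgM _ _ (nbhs x)); [exact: cf|exact: cg]. Qed.

Lemma continuous_funN f : continuous f -> continuous (fun x => - f x).
Proof. by move=> cf x; apply: (@cvgN _ _ _ (nbhs x)); exact: cf. Qed.

Lemma continuous_funB f g : continuous f -> continuous g ->
  continuous (fun x => f x - g x).
Proof. by move=> cf cg; apply: continuous_funD => //; exact: continuous_funN. Qed.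

Lemma continuous_cst (a : K) : continuous (fun _ : T => a).
Proof. exact: cst_continuous. Qed.

Lemma continuous_funZ (a : K) f : continuous f -> continuous (fun x => a * f x).
Proof. by move=> cf; apply: continuous_funM => //; exact: continuous_cst. Qed.

Lemma continuous_sumr (I : eqType) (r : seq I) (f : I -> T -> K) :
  (forall i, i \in r -> continuous (f i)) -> continuous (fun x => \sum_(i <- r) f i x).
Proof. by move=> cf x; apply: (@cvg_sumr K _ (nbhs x) _) => i ir; exact: cf. Qed.

Lemma continuous_prodr (I : eqType) (r : seq I) (f : I -> T -> K) :
  (forall i, i \in r -> continuous (f i)) -> continuous (fun x => \prod_(i <- r) f i x).
Proof. by move=> cf x; apply: (@cvg_prodr K _ (nbhs x) _) => i ir; exact: cf. Qed.

End ContinuousOperations.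

Lemma continuous_funcomp (S T U : topologicalType) (f : S -> T) (g : T -> U) :
  continuous f -> continuous g -> continuous (fun x => g (f x)).
Proof. by move=> cf cg x; apply: continuous_comp; [exact: cf|exact: cg]. Qed.

(** * The bilinear pairing and reflections *)

Section DotProduct.
Variables (K : comRingType) (m : nat).
Implicit Types (x y z : 'rV[K]_m) (c : K).

Lemma dotvC x y : dotv x y = dotv y x.
Proof. by apply: eq_bigr => i _; rewrite mulrC. Qed.

Lemma dotvDl x y z : dotv (x + y) z = dotv x z + dotv y z.
Proof. by rewrite /dotv -big_split; apply: eq_bigr => i _; rewrite mxE mulrDl. Qed.

Lemma dotvZl c x y : dotv (c *: x) y = c * dotv x y.
Proof. by rewrite /dotv mulr_sumr; apply: eq_bigr => i _; rewrite mxE mulrA. Qed.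

Lemma dotvDr x y z : dotv x (y + z) = dotv x y + dotv x z.
Proof. by rewrite !(dotvC x) dotvDl. Qed.

Lemma dotvZr c x y : dotv x (c *: y) = c * dotv x y.
Proof. by rewrite !(dotvC x) dotvZl. Qed.

Lemma dotvNl x y : dotv (- x) y = - dotv x y.
Proof. by rewrite -scaleN1r dotvZl mulN1r. Qed.

Lemma dotvNr x y : dotv x (- y) = - dotv x y.
Proof. by rewrite dotvC dotvNl dotvC. Qed.

Lemma dotvBl x y z : dotv (x - y) z = dotv x z - dotv y z.
Proof. by rewrite dotvDl dotvNl. Qed.

Lemma dotvBr x y z : dotv x (y - z) = dotv x y - dotv x z.
Proof. by rewrite dotvDr dotvNr. Qed.

Lemma dotv0l x : dotv 0 x = 0.
Proof. by rewrite -(scale0r 0) dotvZl mul0r. Qed.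

Lemma dotv0r x : dotv x 0 = 0.
Proof. by rewrite dotvC dotv0l. Qed.

Lemma dotv_evec x j : dotv x (evec K j) = x 0 j.
Proof.
rewrite /dotv (bigD1 j)//= mxE !eqxx mulr1 big1 ?addr0// => i ij.
by rewrite mxE (negbTE ij) andbF mulr0.
Qed.

Lemma sum_evec x : \sum_j x 0 j *: evec K j = x.
Proof. by rewrite [RHS]row_sum_delta. Qed.

End DotProduct.

Section EuclideanSpace.
Variables (R : realType) (m : nat).
Implicit Types x y a : 'rV[R]_m.

Lemma sqnorm_ge0 x : 0 <= sqnorm x.
Proof. by apply: sumr_ge0 => i _; rewrite -expr2 sqr_ge0. Qed.

Lemma sqnorm_eq0 x : sqnorm x = 0 -> x = 0.
Proof.
move=> x0; apply/rowP => i; rewrite mxE; apply/eqP; rewrite -sqrf_eq0 expr2.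
move/eqP: x0; rewrite psumr_eq0; last by move=> j _; rewrite -expr2 sqr_ge0.
by move=> /allP/(_ i); rewrite mem_index_enum => /(_ isT).
Qed.

Lemma dotv_gt0 a : a != 0 -> 0 < dotv a a.
Proof.
move=> a0; rewrite lt0r -/(sqnorm a) sqnorm_ge0 andbT.
by apply: contra_neq a0; exact: sqnorm_eq0.
Qed.

Lemma dotv_CS x y : dotv x y ^+ 2 <= sqnorm x * sqnorm y.
Proof.
have [->|y0] := eqVneq y 0; first by rewrite dotv0r expr0n /sqnorm dotv0r mulr0.
have yy := dotv_gt0 y0.
have := sqnorm_ge0 (dotv y y *: x - dotv x y *: y).
rewrite /sqnorm !(dotvBl, dotvBr, dotvZl, dotvZr) (dotvC y x).
rewrite [X in 0 <= X](_ : _ = dotv y y * (dotv x x * dotv y y - dotv x y ^+ 2)); last ring.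
by rewrite pmulr_rge0// subr_ge0.
Qed.

Lemma sqnormD_le x y : sqnorm (x + y) <= 2 * sqnorm x + 2 * sqnorm y.
Proof.
have := sqnorm_ge0 (x - y); rewrite /sqnorm !(dotvBl, dotvBr, dotvDl, dotvDr) (dotvC y x).
by set u := dotv x x; set v := dotv y y; set w := dotv x y => ?; lra.
Qed.

Lemma dotv_refl a x y : dotv (refl a x) (refl a y) = dotv x y.
Proof.
have [->|a0] := eqVneq a 0; first by rewrite /refl !scaler0 !subr0.
have /lt0r_neq0 aa := dotv_gt0 a0.
rewrite /refl !(dotvBl, dotvBr, dotvZl, dotvZr) (dotvC a y).
by field.
Qed.

Lemma sqnorm_refl a x : sqnorm (refl a x) = sqnorm x.
Proof. exact: dotv_refl. Qed.

Lemma reflK a : involutive (refl a).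
Proof.
move=> x; have [->|a0] := eqVneq a 0; first by rewrite /refl !scaler0 !subr0.
have /lt0r_neq0 aa := dotv_gt0 a0.
rewrite {1}/refl; set s := 2 * dotv x a / dotv a a.
rewrite {1}/refl -/s dotvBl dotvZl -addrA -opprD -scalerDl.
rewrite [X in x - X *: a](_ : _ = 0) ?scale0r ?subr0// /s.
by field.
Qed.

Lemma dotv_refll a x y : dotv (refl a x) y = dotv x (refl a y).
Proof. by rewrite -[y in LHS](reflK a) dotv_refl. Qed.

Lemma dotv_refl_root a x : dotv a (refl a x) = - dotv a x.
Proof.
have [->|a0] := eqVneq a 0; first by rewrite !dotv0l oppr0.
have /lt0r_neq0 aa := dotv_gt0 a0.
rewrite /refl dotvBr dotvZr (dotvC x a).
by field.
Qed.

Lemma reflZ a c : c != 0 -> refl (c *: a) =1 refl a.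
Proof.
move=> c0 x; have [->|a0] := eqVneq a 0; first by rewrite scaler0.
have /lt0r_neq0 aa := dotv_gt0 a0.
rewrite /refl !(dotvZl, dotvZr) scalerA; congr (_ - _ *: _).
by field; rewrite aa c0.
Qed.

Lemma refl_fix a x : dotv a x = 0 -> refl a x = x.
Proof. by move=> ax; rewrite /refl dotvC ax mulr0 mul0r scale0r subr0. Qed.

Lemma refl_root a : a != 0 -> refl a a = - a.
Proof.
move=> /dotv_gt0/lt0r_neq0 aa; rewrite /refl mulfK// -mulr_natl.
by rewrite mulr1 [2]mulr2n scalerDl scale1r opprD addrA subrr sub0r.
Qed.

Lemma reflZr a c x : refl a (c *: x) = c *: refl a x.
Proof. by rewrite /refl dotvZl scalerBr scalerA; congr (_ - _ *: _); rewrite mulrCA !mulrA. Qed.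

Lemma reflD a x y : refl a (x + y) = refl a x + refl a y.
Proof. by rewrite /refl dotvDl mulrDr mulrDl scalerDl opprD addrACA. Qed.

Lemma reflN a x : refl a (- x) = - refl a x.
Proof. by rewrite -scaleN1r reflZr scaleN1r. Qed.

Lemma continuous_dotvl y : continuous (fun x => dotv x y).
Proof.
apply: continuous_sumr => i _; apply: continuous_funM; last exact: continuous_cst.
exact: coord_continuous.
Qed.

Lemma continuous_dotvr y : continuous (dotv y).
Proof.
have -> : dotv y = (fun x => dotv x y) by apply/funext => x; rewrite dotvC.
exact: continuous_dotvl.
Qed.

Lemma continuous_sqnorm : continuous (@sqnorm R m).
Proof.
by apply: continuous_sumr => i _; apply: continuous_funM; exact: coord_continuous.
Qed.

Lemma continuous_refl a : continuous (refl a).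
Proof.
apply: continuous_mx => i j; rewrite ord1.
have -> : (fun z => refl a z 0 j) = (fun z => z 0 j - 2 * dotv z a / dotv a a * a 0 j).
  by apply/funext => z; rewrite !mxE.
apply: continuous_funB; first exact: coord_continuous.
do 2 (apply: continuous_funM; last exact: continuous_cst).
by apply: continuous_funZ; exact: continuous_dotvl.
Qed.

End EuclideanSpace.

(** * Integrals over the line under Gaussian domination *)

Section GaussianIntegral.
Variable R : realType.
Notation mu := (@lebesgue_measure R).

Lemma integrable_gauss (c : R) : 0 < c ->
  mu.-integrable setT (fun t : R => (expR (- (c * t ^+ 2)))%:E).
Proof.
move=> c0; pose s : R := Num.sqrt (c *+ 2)^-1.
have c2 : 0 < c *+ 2 by rewrite pmulrn_lgt0.
have s0 : s != 0 by rewrite gt_eqF// sqrtr_gt0 invr_gt0.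
have sE : s ^+ 2 *+ 2 = c^-1.
  rewrite sqr_sqrtr; last by rewrite invr_ge0 ltW.
  by rewrite -mulr_natr -[c *+ 2]mulr_natr invfM -mulrA mulVf ?mulr1// pnatr_eq0.
have := @integrableZl _ _ _ mu setT measurableT (normal_peak s)^-1 _ (integrable_normal_pdf 0 s).
apply: eq_integrable => // t _; rewrite /normal_pdf (negbTE s0) -EFinM mulrA mulVf ?mul1r.
  by rewrite /normal_fun subr0 sE invrK mulrC mulrN.
by rewrite gt_eqF// invr_gt0 sqrtr_gt0 pmulrn_lgt0// mulr_gt0 ?pi_gt0// exprn_even_gt0.
Qed.

Lemma integrable_gaussZ (a c : R) : 0 < c ->
  mu.-integrable setT (EFin \o (fun t : R => a * expR (- (c * t ^+ 2)))).
Proof.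
move=> /integrable_gauss; move=> /(@integrableZl _ _ _ mu setT measurableT a).
by apply: eq_integrable.
Qed.

Lemma dominated_cvg_Rintegral (F_ : nat -> R -> R) (F g : R -> R) :
  (forall k, measurable_fun setT (F_ k)) ->
  (forall t, F_ ^~ t @ \oo --> F t) ->
  mu.-integrable setT (EFin \o g) ->
  (forall k t, `|F_ k t| <= g t) ->
  mu.-integrable setT (EFin \o F) /\
  (\int[mu]_t F_ k t)%R @[k --> \oo] --> (\int[mu]_t F t)%R.
Proof.
move=> mF cF ig Fg.
have mF' : measurable_fun setT F by apply: (measurable_fun_cvg mF) => t _; exact: cF.
have [] := @dominated_convergence _ _ _ mu setT measurableT
    (fun k => EFin \o F_ k) (EFin \o F) (EFin \o g).
- by move=> k; apply: measurableT_comp; [exact: EFin_measurable|exact: mF].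
- by apply: measurableT_comp; [exact: EFin_measurable|exact: mF'].
- by apply: aeW => t _ /=; apply: cvg_EFin; [exact: nearW|exact: cF].
- by [].
- by apply: aeW => t k _ /=; rewrite lee_fin.
move=> iF _ cI; split => //.
have fF : (\int[mu]_t (F t)%:E)%E \is a fin_num by apply: integrable_fin_num.
rewrite /Rintegral.
by apply: fine_cvg; rewrite fineK.
Qed.

Lemma le_integrable_Rintegral (F g : R -> R) :
  measurable_fun setT F -> mu.-integrable setT (EFin \o g) ->
  (forall t, `|F t| <= g t) ->
  mu.-integrable setT (EFin \o F) /\ `| \int[mu]_t F t | <= \int[mu]_t g t.
Proof.
move=> mF ig Fg.
have iF : mu.-integrable setT (EFin \o F).
  apply: (le_integrable measurableT _ _ ig).
    by apply: measurableT_comp; [exact: EFin_measurable|exact: mF].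
  by move=> t _ /=; rewrite lee_fin (le_trans (Fg t))// ler_norm.
split=> //; apply: le_trans (le_normr_Rintegral _ _) _ => //.
apply: le_Rintegral => //.
exact: (integrable_norm iF).
Qed.

(** Lets dominated convergence, which is about sequences, yield continuity in a parameter. *)
Lemma continuous_seqP (F : R -> R) :
  (forall (u : nat -> R) t, u @ \oo --> t -> (F \o u) @ \oo --> F t) -> continuous F.
Proof.
move=> H t; apply/continuous_withinNx; apply/cvgr_dnbhsP => u [_ ut].
exact: H.
Qed.

End GaussianIntegral.

(** * Iterated integrals and dominated convergence in n variables *)

Section IteratedIntegral.
Variable R : realType.
Notation mu := (@lebesgue_measure R).

(** Spelled as in the recursion of [iint], so that unfolding the latter produces slices by
    [consv]. *)
Definition consv n (t : R) (v : 'rV[R]_n) : 'rV[R]_n.+1 :=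
  row_mx (const_mx t : 'rV[R]_1) v.

Lemma consv0 n t (v : 'rV[R]_n) : consv t v 0 ord0 = t.
Proof.
have -> : (ord0 : 'I_n.+1) = lshift n (ord0 : 'I_1) by exact: val_inj.
by rewrite (row_mxEl (const_mx t : 'rV_1) v) mxE.
Qed.

Lemma consvS n t (v : 'rV[R]_n) i : consv t v 0 (lift ord0 i) = v 0 i.
Proof.
have -> : lift ord0 i = rshift 1 i by exact: val_inj.
by rewrite (row_mxEr (const_mx t : 'rV_1) v).
Qed.

Lemma consv_eta n (x : 'rV[R]_n.+1) : x = consv (x 0 ord0) (\row_i x 0 (lift ord0 i)).
Proof.
apply/rowP => i; case: (unliftP ord0 i) => [j ->|->]; first by rewrite consvS mxE.
by rewrite consv0.
Qed.

Lemma dotv_consv n t (v : 'rV[R]_n) s w :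
  dotv (consv t v) (consv s w) = t * s + dotv v w.
Proof.
rewrite /dotv big_ord_recl !consv0; congr (_ + _).
by apply: eq_bigr => i _; rewrite !consvS.
Qed.

Lemma sqnorm_consv n t (v : 'rV[R]_n) : sqnorm (consv t v) = t ^+ 2 + sqnorm v.
Proof. by rewrite /sqnorm dotv_consv expr2. Qed.

Lemma continuous_consvr n t : continuous (@consv n t).
Proof.
apply: continuous_mx => i j; rewrite ord1 => v.
case: (unliftP ord0 j) => [k ->|->].
  have -> : (fun w : 'rV[R]_n => consv t w 0 (lift ord0 k)) = (fun w => w 0 k).
    by apply/funext => w; rewrite consvS.
  exact: coord_continuous.
have -> : (fun w : 'rV[R]_n => consv t w 0 ord0) = (fun=> t).
  by apply/funext => w; rewrite consv0.
exact: cst_continuous.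
Qed.

Lemma continuous_consvl n (v : 'rV[R]_n) : continuous (fun t => consv t v).
Proof.
apply: continuous_mx => i j; rewrite ord1 => t.
case: (unliftP ord0 j) => [k ->|->].
  have -> : (fun s => consv s v 0 (lift ord0 k)) = (fun=> v 0 k).
    by apply/funext => w; rewrite consvS.
  exact: cst_continuous.
have -> : (fun s => consv s v 0 ord0) = id.
  by apply/funext => w; rewrite consv0.
by move=> A; exact.
Qed.

Definition gauss_bounded n (C c : R) (f : 'rV[R]_n -> R) :=
  forall x, `|f x| <= C * expR (- (c * sqnorm x)).

(* Dominated pointwise limits of continuous functions: a class large enough for
   every integrand below, and stable under slicing and iterated integration. *)
Definition gauss_lim n (C c : R) (f_ : nat -> 'rV[R]_n -> R) (f : 'rV[R]_n -> R) :=
  [/\ forall k, continuous (f_ k), forall k, gauss_bounded C c (f_ k) &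
      forall x, f_ ^~ x @ \oo --> f x].

Lemma gauss_lim_cst n C c (f : 'rV[R]_n -> R) : continuous f -> gauss_bounded C c f ->
  gauss_lim C c (fun=> f) f.
Proof. by move=> cf bf; split => // x; exact: cvg_cst. Qed.

Lemma gauss_bounded_ge0 n C c (f : 'rV[R]_n -> R) : gauss_bounded C c f -> 0 <= C.
Proof.
move=> /(_ 0); move/(le_trans (normr_ge0 _)).
by rewrite pmulr_lge0 ?expR_gt0.
Qed.

Lemma gauss_lim_ge0 n C c f_ (f : 'rV[R]_n -> R) : gauss_lim C c f_ f -> 0 <= C.
Proof. by case=> _ /(_ 0%N)/gauss_bounded_ge0. Qed.

Lemma gauss_lim_consv n C c f_ (f : 'rV[R]_n.+1 -> R) t : gauss_lim C c f_ f ->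
  gauss_lim (C * expR (- (c * t ^+ 2))) c (fun k => f_ k \o consv t) (f \o consv t).
Proof.
case=> cf bf ff; split => [k v|k v|v]; last exact: ff.
  by apply: continuous_comp; [exact: continuous_consvr|exact: cf].
by rewrite -mulrA -expRD -opprD -mulrDr -sqnorm_consv; exact: bf.
Qed.

(** Real-valued counterpart of [iint]. Each stage takes a finite part, so agreement with [iint] is
    established only under Gaussian domination ([iint_rint]). *)
Fixpoint rint n : ('rV[R]_n -> R) -> R :=
  match n with
  | 0 => fun f => f 0
  | n'.+1 => fun f => \int[mu]_t rint (fun v : 'rV[R]_n' => f (consv t v))
  end.

Definition gmass (c : R) : R := \int[mu]_t expR (- (c * t ^+ 2)).

(** Continuity in t is dominated convergence along sequences tending to t. That statement in
    dimension n is a hypothesis here because this lemma serves inside the induction proving it. *)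
Let rint_slice_meas n c :
  (forall C (f_ : nat -> 'rV[R]_n -> R) f, gauss_lim C c f_ f ->
      rint (f_ k) @[k --> \oo] --> rint f /\ `|rint f| <= C * gmass c ^+ n) ->
  0 < c -> forall C (f_ : nat -> 'rV[R]_n.+1 -> R) f, gauss_lim C c f_ f ->
  forall k, continuous (fun t => rint (f_ k \o consv t)).
Proof.
move=> IH c0 C f_ f H k; apply: continuous_seqP => u t ut.
apply: (IH C (fun j => f_ k \o consv (u j)) _ _).1; case: (H) => cf bf ff; split.
- by move=> j v; apply: continuous_comp; [exact: continuous_consvr|exact: cf].
- move=> j v; apply: le_trans (bf k (consv (u j) v)) _.
  rewrite ler_wpM2l ?(gauss_lim_ge0 H)// ler_expR lerN2 ler_wpM2l ?(ltW c0)//.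
  by rewrite sqnorm_consv lerDr sqr_ge0.
- move=> v.
  apply: (@continuous_cvg _ _ _ _ _ u (fun s => f_ k (consv s v))); last exact: ut.
  by apply: continuous_comp; [exact: continuous_consvl|exact: cf].
Qed.

(** Convergence and bound go through one induction: the bound in dimension n dominates the slices in
    dimension n + 1. *)
Lemma rint_dct n (c C : R) (f_ : nat -> 'rV[R]_n -> R) f : 0 < c -> gauss_lim C c f_ f ->
  rint (f_ k) @[k --> \oo] --> rint f /\ `|rint f| <= C * gmass c ^+ n.
Proof.
move=> c0; elim: n => [|n IH] in C f_ f *.
  move=> H; case: (H) => cf bf ff; split; first exact: ff.
  rewrite expr0 mulr1.
  apply: (@cvgr_to_le _ \oo _ _ (fun k => `|f_ k 0|)).
    by apply: cvg_norm; exact: ff.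
  apply: nearW => k; apply: le_trans (bf k 0) _.
  rewrite -[leRHS]mulr1 ler_wpM2l ?(gauss_lim_ge0 H)//.
  by rewrite /sqnorm /dotv big_ord0 mulr0 oppr0 expR0.
move=> H; case: (H) => cf bf ff.
have C0 := gauss_lim_ge0 H.
have ig := integrable_gauss c0.
pose g t := (C * gmass c ^+ n) * expR (- (c * t ^+ 2)).
have ig' := integrable_gaussZ (C * gmass c ^+ n) c0.
have bF h_ (h : 'rV[R]_n.+1 -> R) t : gauss_lim C c h_ h -> `|rint (h \o consv t)| <= g t.
  move=> /(gauss_lim_consv t) /IH[_ /le_trans]; apply.
  by rewrite /g mulrAC.
have mF k : measurable_fun setT (fun t => rint (f_ k \o consv t)).
  by apply: continuous_measurable_fun; exact: (rint_slice_meas IH c0 H).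
have [iF cF] := @dominated_cvg_Rintegral R (fun k t => rint (f_ k \o consv t))
  (fun t => rint (f \o consv t)) g mF (fun t => (IH _ _ _ (gauss_lim_consv t H)).1)
  ig' (fun k t => bF (fun=> f_ k) (f_ k) t (gauss_lim_cst (cf k) (bf k))).
split; first exact: cF.
have mF0 : measurable_fun setT (fun t => rint (f \o consv t)).
  by apply: (measurable_fun_cvg mF) => t _; exact: (IH _ _ _ (gauss_lim_consv t H)).1.
have [_] := le_integrable_Rintegral mF0 ig' (fun t => bF _ _ t H).
move=> /le_trans; apply.
by rewrite /g RintegralZl// -/(gmass c) exprSr mulrA.
Qed.

Lemma continuous_rint_slice n (c C : R) (f : 'rV[R]_n.+1 -> R) : 0 < c ->
  continuous f -> gauss_bounded C c f -> continuous (fun t => rint (f \o consv t)).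
Proof.
move=> c0 cf bf.
have H := gauss_lim_cst cf bf.
exact: (@rint_slice_meas _ _ (fun C' f_' f' => @rint_dct n c C' f_' f' c0) c0 _ _ _ H 0%N).
Qed.

Lemma rint_slice n (c C : R) (f_ : nat -> 'rV[R]_n.+1 -> R) f : 0 < c ->
  gauss_lim C c f_ f ->
  mu.-integrable setT (EFin \o (fun t => rint (f \o consv t))) /\
  forall t, `|rint (f \o consv t)| <= C * gmass c ^+ n * expR (- (c * t ^+ 2)).
Proof.
move=> c0 H.
have bF t : `|rint (f \o consv t)| <= C * gmass c ^+ n * expR (- (c * t ^+ 2)).
  by have [_ /le_trans] := rint_dct c0 (gauss_lim_consv t H); apply; rewrite mulrAC.
split=> //.
apply: (@le_integrable_Rintegral R _ (fun t => C * gmass c ^+ n * expR (- (c * t ^+ 2))) _ _ bF).1.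
  apply: (@measurable_fun_cvg _ _ _ _ (fun k t => rint (f_ k \o consv t))).
    move=> k; apply: continuous_measurable_fun; apply: (continuous_rint_slice c0).
      by case: H.
    by case: H => _ + _; apply.
  by move=> t _; exact: (rint_dct c0 (gauss_lim_consv t H)).1.
exact: integrable_gaussZ.
Qed.

Lemma rintD n (c c' C C' : R) f_ f g_ (g : 'rV[R]_n -> R) : 0 < c -> 0 < c' ->
  gauss_lim C c f_ f -> gauss_lim C' c' g_ g ->
  rint (fun x => f x + g x) = rint f + rint g.
Proof.
move=> c0 c0'; elim: n => [//|n IH] in C C' f_ f g_ g *; move=> Hf Hg.
rewrite /= -RintegralD//; last 2 first.
- exact: (rint_slice c0 Hf).1.
- exact: (rint_slice c0' Hg).1.
apply: eq_Rintegral => t _.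
exact: IH (gauss_lim_consv t Hf) (gauss_lim_consv t Hg).
Qed.

Lemma rintZ n (c C a : R) f_ (f : 'rV[R]_n -> R) : 0 < c -> gauss_lim C c f_ f ->
  rint (fun x => a * f x) = a * rint f.
Proof.
move=> c0; elim: n => [//|n IH] in C f_ f *; move=> Hf.
rewrite /= -RintegralZl//; last exact: (rint_slice c0 Hf).1.
by apply: eq_Rintegral => t _; exact: IH (gauss_lim_consv t Hf).
Qed.

Lemma iint_rint n (c C : R) f_ (f : 'rV[R]_n -> R) : 0 < c -> gauss_lim C c f_ f ->
  iint (fun x => (f x)%:E) = (rint f)%:E.
Proof.
move=> c0; elim: n => [//|n IH] in C f_ f *; move=> Hf /=.
under eq_integral do rewrite (IH _ _ _ (gauss_lim_consv _ Hf)).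
by rewrite /Rintegral fineK//; apply: integrable_fin_num => //; exact: (rint_slice c0 Hf).1.
Qed.

Lemma gauss_lim_norm n C c f_ (f : 'rV[R]_n -> R) : gauss_lim C c f_ f ->
  gauss_lim C c (fun k x => `|f_ k x|) (fun x => `|f x|).
Proof.
case=> cf bf ff; split => [k x|k x|x]; last by apply: cvg_norm; exact: ff.
- by apply: continuous_comp; [exact: cf|exact: norm_continuous].
- by rewrite normr_id; exact: bf.
Qed.

Lemma gauss_limZ n C c a f_ (f : 'rV[R]_n -> R) : gauss_lim C c f_ f ->
  gauss_lim (`|a| * C) c (fun k x => a * f_ k x) (fun x => a * f x).
Proof.
case=> cf bf ff; split => [k x|k x|x]; last by apply: cvgM; [exact: cvg_cst|exact: ff].
- by apply: continuousM; [exact: cst_continuous|exact: cf].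
- by rewrite normrM -mulrA ler_wpM2l//; exact: bf.
Qed.

Lemma gauss_limD n C C' c f_ (f : 'rV[R]_n -> R) g_ g : gauss_lim C c f_ f ->
  gauss_lim C' c g_ g ->
  gauss_lim (C + C') c (fun k x => f_ k x + g_ k x) (fun x => f x + g x).
Proof.
case=> cf bf ff [cg bg gg]; split => [k x|k x|x].
- by apply: continuousD; [exact: cf|exact: cg].
- by rewrite (le_trans (ler_normD _ _))// mulrDl lerD//; [exact: bf|exact: bg].
- by apply: cvgD; [exact: ff|exact: gg].
Qed.

(** The positive and negative parts are (|f| + f)/2 and (|f| - f)/2, again dominated limits, so
    linearity of [rint] recombines them. *)
Lemma intRm_rint n (c C : R) f_ (f : 'rV[R]_n -> R) : 0 < c -> gauss_lim C c f_ f ->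
  intRm f = rint f.
Proof.
move=> c0 Hf.
have maxE (x : R) : Num.max x 0 = 2^-1 * (x + `|x|).
  by rewrite maxr_absE subr0 addr0 mulrC.
have Hp := gauss_limZ 2^-1 (gauss_limD Hf (gauss_lim_norm Hf)).
have Hm := gauss_limZ 2^-1 (gauss_limD (gauss_limZ (-1) Hf) (gauss_lim_norm (gauss_limZ (-1) Hf))).
rewrite /intRm /integrableRm (iint_rint c0 (gauss_lim_norm Hf)) ltry.
under eq_fun do rewrite maxE.
under [X in _ - fine (iint X)]eq_fun do rewrite maxE -mulN1r.
rewrite (iint_rint c0 Hp) (iint_rint c0 Hm)/= -[X in _ + X]mulN1r.
rewrite -(rintZ _ c0 Hm) -(rintD c0 c0 Hp (gauss_limZ (-1) Hm)).
by congr rint; apply/funext => x; rewrite normrM normrN1 mul1r; field.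
Qed.

End IteratedIntegral.

(** * Fubini, translation and sign change in one variable *)

Section Fubini2.
Variable R : realType.
Notation mu := (@lebesgue_measure R).

Let approx (k : nat) (z : int) : R := z%:~R / k.+1%:R.

Let approx_cvg (t : R) :
  (fun k => approx k (Num.floor (k.+1%:R * t))) @ \oo --> t.
Proof.
apply/cvgrPdist_le => e e0.
near=> k.
have k0 : (0 : R) < k.+1%:R by [].
have H1 := floor_le (k.+1%:R * t).
have H2 := floorD1_gt (k.+1%:R * t).
have -> : t - approx k (Num.floor (k.+1%:R * t)) =
    (k.+1%:R * t - (Num.floor (k.+1%:R * t))%:~R) / k.+1%:R.
  by rewrite /approx mulrBl [k.+1%:R * t]mulrC mulfK ?gt_eqF.
rewrite ger0_norm; last by rewrite divr_ge0// subr_ge0.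
rewrite ler_pdivrMr//.
apply: (@le_trans _ _ 1).
  by rewrite lerBlDr addrC -(intrD _ _ 1) ltW.
have : k.+1%:R^-1 < e by near: k; exact: (near_infty_natSinv_lt (PosNum e0)).
by move=> /ltW; rewrite -ler_pdivrMr// div1r.
Unshelve. all: by end_near. Qed.

(* A Caratheodory function is jointly measurable: discretize its first argument. *)
Lemma measurable_fun_caratheodory (g : R -> R -> R) :
  (forall s, continuous (g ^~ s)) -> (forall t, measurable_fun setT (g t)) ->
  measurable_fun setT (fun p : R * R => g p.1 p.2).
Proof.
move=> cg mg.
apply: (@measurable_fun_cvg _ _ _ _
  (fun k (p : R * R) => g (approx k (Num.floor (k.+1%:R * p.1))) p.2)); last first.
  move=> [t s] _ /=.
  by apply: (@continuous_cvg _ _ _ _ _ _ (g ^~ s)); [exact: cg|exact: approx_cvg].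
move=> k _ B mB; rewrite setTI.
have -> : (fun p : R * R => g (approx k (Num.floor (k.+1%:R * p.1))) p.2) @^-1` B =
    \bigcup_(z : int) ([set t | z%:~R <= k.+1%:R * t < (z + 1)%:~R] `*` (g (approx k z) @^-1` B)).
  apply/seteqP; split => [[t s] /= Bts|[t s] [z _] [/= tz Bs]].
    exists (Num.floor (k.+1%:R * t)) => //; split => //=.
    by rewrite floor_le floorD1_gt.
  by rewrite (floor_def tz).
apply: countable_bigcupT_measurable => // z; apply: measurableX; last first.
  by rewrite -[X in measurable X]setTI; exact: mg.
have -> : [set t : R | z%:~R <= k.+1%:R * t < (z + 1)%:~R] =
    (fun t => k.+1%:R * t) @^-1` `[z%:~R, (z + 1)%:~R[.
  by apply/seteqP; split => t /=; rewrite in_itv.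
rewrite -[X in measurable X]setTI.
have mk : measurable_fun setT (fun t : R => k.+1%:R * t) by exact: measurable_funM.
exact: mk.
Qed.

(** Separate continuity gives joint measurability, and the product of two Gaussians gives
    integrability on the plane. *)
Lemma Rintegral_swap (g : R -> R -> R) (C c : R) : 0 < c ->
  (forall s, continuous (g ^~ s)) -> (forall t, continuous (g t)) ->
  (forall t s, `|g t s| <= C * expR (- (c * t ^+ 2)) * expR (- (c * s ^+ 2))) ->
  \int[mu]_t \int[mu]_s g t s = \int[mu]_s \int[mu]_t g t s.
Proof.
move=> c0 cg1 cg2 bg.
have mg2 t : measurable_fun setT (g t) by exact: continuous_measurable_fun.
have mg1 s : measurable_fun setT (g ^~ s) by exact: continuous_measurable_fun.
have mg := measurable_fun_caratheodory cg1 mg2.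
pose f (p : R * R) : \bar R := (g p.1 p.2)%:E.
have mf : measurable_fun setT f by apply/measurable_EFinP.
have i2 t : mu.-integrable setT (EFin \o g t).
  exact: (le_integrable_Rintegral (mg2 t) (integrable_gaussZ _ c0) (bg t)).1.
have i1 s : mu.-integrable setT (EFin \o (g ^~ s)).
  apply: (le_integrable_Rintegral (mg1 s) (integrable_gaussZ (C * expR (- (c * s ^+ 2))) c0) _).1.
  by move=> t; rewrite mulrAC.
have ifm : (mu \x mu)%E.-integrable setT f.
  apply: (integrable12ltyP mu mu mf).2.
  apply: (@le_lt_trans _ _ (\int[mu]_t ((C * gmass c) * expR (- (c * t ^+ 2)))%:E)%E).
    apply: ge0_le_integral => //.
    - by move=> t _; apply: integral_ge0.
    - have mfa : measurable_fun setT (fun p => `|f p|%E) by exact: measurableT_comp.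
      exact: (@measurable_fun_fubini_tonelli_F _ _ _ _ R mu (fun p => `|f p|%E) mfa
        (fun p => abse_ge0 (f p))).
    - by have := integrable_gaussZ (C * gmass c) c0; move/measurable_int.
    - move=> t _.
      apply: (@le_trans _ _ (\int[mu]_s (C * expR (- (c * t ^+ 2)) * expR (- (c * s ^+ 2)))%:E)%E).
        apply: ge0_le_integral => //.
        + have /measurable_int mgt := i2 t.
          by apply: measurableT_comp; last exact: mgt.
        + by have := integrable_gaussZ (C * expR (- (c * t ^+ 2))) c0; move/measurable_int.
        + by move=> s _ /=; rewrite lee_fin.
      have := integrable_gaussZ (C * expR (- (c * t ^+ 2))) c0.
      move=> /(integrable_fin_num measurableT) /fineK <-.
      rewrite lee_fin -[fine _]/(\int[mu]_s (C * expR (- (c * t ^+ 2)) * expR (- (c * s ^+ 2)))).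
      by rewrite RintegralZl ?(integrable_gauss c0)// mulrAC.
  rewrite ltey_eq; apply/orP; left.
  exact: (integrable_fin_num measurableT (integrable_gaussZ _ c0)).
have := Fubini ifm; rewrite /f/=.
under eq_integral => t _ do rewrite -(fineK (integrable_fin_num measurableT (i2 t))).
under [in RHS]eq_integral => s _ do rewrite -(fineK (integrable_fin_num measurableT (i1 s))).
by rewrite /Rintegral => ->.
Qed.

(** Uniqueness of Lebesgue measure: the pushforward has the same value on half-open intervals. *)
Lemma lebesgue_measure_shift (h : R) (A : set R) : measurable A ->
  pushforward mu ((fun t => t + h) : _ -> measurableTypeR R) A = mu A.
Proof.
move=> mA; apply/esym/lebesgue_measure_unique => //=.
  by apply: measurable_funD.
move=> _ _ [[a b]] _ <-; rewrite /pushforward.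
have -> : (fun t : R => t + h) @^-1` `]a, b] = `]a - h, b - h]%classic.
  by apply/seteqP; split => t /=; rewrite !in_itv/= ltrBlDr lerBrDr.
rewrite !lebesgue_measure_itv/= !lte_fin ltrD2r.
by case: ifPn => // _; rewrite -!EFinD; congr EFin; ring.
Qed.

Lemma Rintegral_shift (F : R -> R) (C c h : R) : 0 < c -> continuous F ->
  (forall t, `|F t| <= C * expR (- (c * t ^+ 2))) ->
  \int[mu]_t F (t + h) = \int[mu]_t F t.
Proof.
move=> c0 cF bF; rewrite /Rintegral; congr fine.
pose sh : measurableTypeR R -> measurableTypeR R := fun t => t + h.
have msh : measurable_fun setT sh.
  by apply: measurable_funD.
have mF : measurable_fun setT F by exact: continuous_measurable_fun.
transitivity (\int[pushforward mu sh]_t (F t)%:E)%E; last first.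
  by apply: eq_measure_integral => A mA _; exact: lebesgue_measure_shift.
rewrite (integral_pushforward msh)//.
  by apply: measurableT_comp; [exact: EFin_measurable|exact: mF].
(* Half of the rate pays for the cross term of (t + h)^2; what remains is the square c/2 (t +
   2h)^2. *)
have c2 : 0 < c / 2 by rewrite divr_gt0.
apply: (@le_integrable_Rintegral R (fun t => F (t + h))
  (fun t => C * expR (c * h ^+ 2) * expR (- (c / 2 * t ^+ 2))) _ _ _).1.
- by apply: (measurableT_comp mF).
- exact: integrable_gaussZ.
- move=> t; apply: le_trans (bF _) _.
  rewrite -mulrA -expRD ler_wpM2l//.
    by have := le_trans (normr_ge0 _) (bF 0); rewrite pmulr_lge0 ?expR_gt0.
  rewrite ler_expR -subr_ge0.
  rewrite [X in 0 <= X](_ : _ = c / 2 * (t + 2 * h) ^+ 2); last by field.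
  by rewrite mulr_ge0 ?sqr_ge0// ltW.
Qed.

Lemma Rintegral_opp (F : R -> R) (C c : R) : 0 < c -> continuous F ->
  (forall t, `|F t| <= C * expR (- (c * t ^+ 2))) ->
  \int[mu]_t F (- t) = \int[mu]_t F t.
Proof.
move=> c0 cF bF; rewrite /Rintegral; congr fine.
have msh : measurable_fun setT (-%R : measurableTypeR R -> measurableTypeR R).
  exact: oppr_measurable.
have mF : measurable_fun setT F by exact: continuous_measurable_fun.
transitivity (\int[pushforward mu (-%R : measurableTypeR R -> measurableTypeR R)]_t (F t)%:E)%E; last first.
  by apply: eq_measure_integral => A mA _; exact: lebesgue_measureN.
rewrite (integral_pushforward msh)//.
  by apply: measurableT_comp; [exact: EFin_measurable|exact: mF].
apply: (@le_integrable_Rintegral R (fun t => F (- t))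
  (fun t => C * expR (- (c * t ^+ 2))) _ _ _).1.
- by apply: (measurableT_comp mF).
- exact: integrable_gaussZ.
- by move=> t; have := bF (- t); rewrite sqrrN.
Qed.

End Fubini2.

(** * Invariance of the iterated integral under translations, shears and reflections *)

Section IntegralInvariance.
Variable R : realType.
Notation mu := (@lebesgue_measure R).

Definition tailv n (x : 'rV[R]_n.+1) : 'rV[R]_n := \row_i x 0 (lift ord0 i).

Lemma tailv_consv n t (v : 'rV[R]_n) : tailv (consv t v) = v.
Proof. by apply/rowP => i; rewrite mxE consvS. Qed.

Lemma consvD n s t (v w : 'rV[R]_n) : consv s v + consv t w = consv (s + t) (v + w).
Proof.
apply/rowP => i; case: (unliftP ord0 i) => [j ->|->]; first by rewrite mxE !consvS mxE.
by rewrite mxE !consv0.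
Qed.

Lemma consvZ n s t (v : 'rV[R]_n) : s *: consv t v = consv (s * t) (s *: v).
Proof.
apply/rowP => i; case: (unliftP ord0 i) => [j ->|->]; first by rewrite mxE !consvS mxE.
by rewrite mxE !consv0.
Qed.

Lemma consvB n s t (v w : 'rV[R]_n) : consv s v - consv t w = consv (s - t) (v - w).
Proof. by rewrite -scaleN1r consvZ consvD mulN1r scaleN1r. Qed.

Lemma continuous_consv_comp n (T : topologicalType) (u : T -> R) (w : T -> 'rV[R]_n) :
  continuous u -> continuous w -> continuous (fun x => consv (u x) (w x)).
Proof.
move=> cu cw; apply: continuous_mx => i j; rewrite ord1.
case: (unliftP ord0 j) => [k ->|->].
  rewrite (_ : (fun x => _) = (fun x => w x 0 k)).
    exact: (continuous_funcomp cw (@coord_continuous _ _ _ 0 k)).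
  by apply/funext => x; rewrite consvS.
rewrite (_ : (fun x => _) = u)//.
by apply/funext => x; rewrite consv0.
Qed.

Lemma continuous_tailv n : continuous (@tailv n).
Proof.
apply: continuous_mx => i j.
rewrite (_ : (fun x => _) = (fun x : 'rV[R]_n.+1 => x 0 (lift ord0 j))).
  exact: coord_continuous.
by apply/funext => x; rewrite mxE.
Qed.

Lemma sqnorm_headtail n (x : 'rV[R]_n.+1) : sqnorm x = x 0 ord0 ^+ 2 + sqnorm (tailv x).
Proof. by rewrite {1}[x]consv_eta sqnorm_consv. Qed.

Lemma gauss_bounded_consv n C c (f : 'rV[R]_n.+1 -> R) t : gauss_bounded C c f ->
  gauss_bounded (C * expR (- (c * t ^+ 2))) c (f \o consv t).
Proof.
move=> bf v; rewrite -mulrA -expRD -opprD -mulrDr -sqnorm_consv; exact: bf.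
Qed.

Lemma gauss_bounded_le n C c c' (f : 'rV[R]_n -> R) : gauss_bounded C c f ->
  c' <= c -> gauss_bounded C c' f.
Proof.
move=> bf cc x; apply: le_trans (bf x) _.
rewrite ler_wpM2l ?(gauss_bounded_ge0 bf)// ler_expR lerN2 ler_wpM2r//.
exact: sqnorm_ge0.
Qed.

Lemma gauss_bounded_shift n C c (f : 'rV[R]_n -> R) w : 0 < c -> gauss_bounded C c f ->
  gauss_bounded (C * expR (c * sqnorm w)) (c / 2) (fun x => f (x + w)).
Proof.
move=> c0 bf x; apply: le_trans (bf _) _.
rewrite -mulrA -expRD ler_wpM2l ?(gauss_bounded_ge0 bf)// ler_expR -subr_ge0.
have := sqnormD_le (x + w) (- w); rewrite addrK.
have -> : sqnorm (- w) = sqnorm w by rewrite /sqnorm dotvNl dotvNr opprK.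
move=> H; rewrite [X in 0 <= X](_ : _ = c * (sqnorm w + sqnorm (x + w) - sqnorm x / 2)); last by field.
by rewrite mulr_ge0 ?(ltW c0)//; lra.
Qed.

(** Carries the outermost integration past the inner ones by successive transpositions, so that the
    first variable can be substituted while the others are fixed. *)
Lemma rint_swap n (f : 'rV[R]_n.+1 -> R) C c : 0 < c -> continuous f ->
  gauss_bounded C c f ->
  rint f = rint (fun v => \int[mu]_t f (consv t v)).
Proof.
move=> c0; elim: n => [//|n IH] in f C * => cf bf.
rewrite [LHS]/= [RHS]/=.
pose g t s := rint (fun w : 'rV[R]_n => f (consv t (consv s w))).
have cft t : continuous (f \o consv t).
  by move=> v; apply: continuous_comp; [exact: continuous_consvr|exact: cf].
pose fs s (x : 'rV[R]_n.+1) := f (consv (x 0 ord0) (consv s (tailv x))).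
have cfs s : continuous (fs s).
  apply: continuous_funcomp cf; apply: continuous_consv_comp; first exact: coord_continuous.
  apply: continuous_consv_comp; first exact: continuous_cst.
  exact: continuous_tailv.
have bfs s : gauss_bounded (C * expR (- (c * s ^+ 2))) c (fs s).
  move=> x; apply: le_trans (bf _) _.
  rewrite !sqnorm_consv (sqnorm_headtail x) -mulrA -expRD.
  by rewrite addrCA [c * (_ + _)]mulrDr opprD.
have fsE s t : fs s \o consv t = fun w => f (consv t (consv s w)).
  by apply/funext => w; rewrite /fs /= consv0 tailv_consv.
rewrite [X in X = _](_ : _ = \int[mu]_t \int[mu]_s g t s)//.
rewrite (@Rintegral_swap _ g (C * gmass c ^+ n) c c0).
- apply: eq_Rintegral => s _.
  have := IH (fs s) _ (cfs s) (bfs s).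
  rewrite [LHS]/= => H.
  transitivity (\int[mu]_t rint (fs s \o consv t)).
    by apply: eq_Rintegral => t _; rewrite fsE.
  rewrite [LHS]H; congr rint; apply/funext => w.
  by apply: eq_Rintegral => t _; rewrite -/((fs s \o consv t) w) fsE.
- move=> s.
  rewrite (_ : g ^~ s = fun t => rint (fs s \o consv t)).
    exact: (continuous_rint_slice c0 (cfs s) (bfs s)).
  by apply/funext => t; rewrite fsE.
- move=> t.
  exact: (continuous_rint_slice c0 (cft t) (gauss_bounded_consv t bf)).
- move=> t s.
  have Hc : continuous (fs s \o consv t).
    by move=> v; apply: continuous_comp; [exact: continuous_consvr|exact: cfs].
  have [_] := rint_dct c0 (gauss_lim_cst Hc (gauss_bounded_consv t (bfs s))).
  rewrite fsE => /le_trans; apply.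
  by rewrite le_eqVlt; apply/orP; left; apply/eqP; ring.
Qed.

Lemma rint_shift n (f : 'rV[R]_n -> R) C c w : 0 < c -> continuous f ->
  gauss_bounded C c f -> rint (fun x => f (x + w)) = rint f.
Proof.
move=> c0; elim: n => [|n IH] in f C w * => cf bf.
  by rewrite /=; congr f; apply/rowP; case.
rewrite [LHS]/= [RHS]/=.
have cft t : continuous (f \o consv t).
  by move=> v; apply: continuous_comp; [exact: continuous_consvr|exact: cf].
rewrite -(@Rintegral_shift _ (fun t => rint (f \o consv t)) (C * gmass c ^+ n) c (w 0 ord0) c0).
- apply: eq_Rintegral => t _.
  rewrite -[RHS](IH _ _ (tailv w) (cft _) (gauss_bounded_consv _ bf)).
  congr rint; apply/funext => v; rewrite /=; congr f.
  by rewrite [in LHS](consv_eta w) consvD.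
- exact: (continuous_rint_slice c0 cf bf).
- by have [] := rint_slice c0 (gauss_lim_cst cf bf).
Qed.

(** A substitution of determinant one: after it the first variable stands for the pairing of the
    original point with [consv 1 b]. *)
Definition shear n (b : 'rV[R]_n) (f : 'rV[R]_n.+1 -> R) (x : 'rV[R]_n.+1) : R :=
  f (consv (x 0 ord0 - dotv (tailv x) b) (tailv x)).

Lemma continuous_shear n (b : 'rV[R]_n) f : continuous f -> continuous (shear b f).
Proof.
move=> cf; apply: continuous_funcomp cf; apply: continuous_consv_comp.
  apply: continuous_funB; first exact: coord_continuous.
  apply: (@continuous_funcomp _ _ _ (@tailv n) (fun v => dotv v b)).
    exact: continuous_tailv.
  exact: continuous_dotvl.
exact: continuous_tailv.
Qed.

(** With d = <v, b>, the estimates u^2 <= 2 (u - d)^2 + 2 d^2 and d^2 <= |v|^2 |b|^2 bound the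
    squared norm by 2 + 2 |b|^2 times that of the sheared point. *)
Lemma gauss_bounded_shear n (b : 'rV[R]_n) f C c : 0 < c -> gauss_bounded C c f ->
  gauss_bounded C (c / (2 + 2 * sqnorm b)) (shear b f).
Proof.
move=> c0 bf x; apply: le_trans (bf _) _.
rewrite ler_wpM2l ?(gauss_bounded_ge0 bf)// ler_expR lerN2 -mulrA ler_wpM2l ?(ltW c0)//.
have b0 := sqnorm_ge0 b.
rewrite mulrC ler_pdivrMr; last by rewrite ltr_wpDr// mulr_ge0.
rewrite sqnorm_consv sqnorm_headtail.
have := dotv_CS (tailv x) b.
have := sqnorm_ge0 (tailv x).
set V := sqnorm (tailv x); set B := sqnorm b in b0 *; set d := dotv _ _; set u := x 0 ord0.
move=> V0 H.
have := sqr_ge0 (u - 2 * d); have := sqr_ge0 (u - d).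
have BV : 0 <= B * (u - d) ^+ 2 by rewrite mulr_ge0// sqr_ge0.
nra.
Qed.

(** Once [rint_swap] has made the first variable innermost, shearing is a translation of it. *)
Lemma rint_shear n (b : 'rV[R]_n) (f : 'rV[R]_n.+1 -> R) C c : 0 < c -> continuous f ->
  gauss_bounded C c f -> rint f = rint (shear b f).
Proof.
move=> c0 cf bf.
have c0' : 0 < c / (2 + 2 * sqnorm b).
  by rewrite divr_gt0// ltr_wpDr// mulr_ge0// sqnorm_ge0.
rewrite (rint_swap c0 cf bf) (rint_swap c0' (@continuous_shear _ b _ cf) (gauss_bounded_shear b c0 bf)).
congr rint; apply/funext => v.
rewrite -(@Rintegral_shift _ (fun t => f (consv t v)) C c (- dotv v b) c0).
- by apply: eq_Rintegral => t _; rewrite /shear consv0 tailv_consv.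
- exact: (continuous_funcomp (@continuous_consvl _ _ v) cf).
- move=> t; apply: le_trans (bf _) _.
  rewrite ler_wpM2l ?(gauss_bounded_ge0 bf)// ler_expR lerN2 ler_wpM2l ?(ltW c0)//.
  by rewrite sqnorm_consv lerDl sqnorm_ge0.
Qed.

(* If the leading coordinate of the root vanishes the reflection acts on the
   inner variables only; otherwise normalize it to 1 and take <a, x> as a new
   first variable, which the reflection negates while it translates the others. *)
Lemma rint_refl n (a : 'rV[R]_n) (f : 'rV[R]_n -> R) C c : 0 < c -> continuous f ->
  gauss_bounded C c f -> rint (fun x => f (refl a x)) = rint f.
Proof.
move=> c0; elim: n => [|n IH] in a f C * => cf bf.
  by rewrite /=; congr f; apply/rowP; case.
have cft t : continuous (f \o consv t).
  by move=> v; apply: continuous_comp; [exact: continuous_consvr|exact: cf].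
have [a0|a0] := eqVneq (a 0 ord0) 0.
  rewrite [LHS]/= [RHS]/=; apply: eq_Rintegral => t _.
  rewrite -[RHS](IH (tailv a) _ _ (cft t) (gauss_bounded_consv t bf)).
  congr rint; apply/funext => v; rewrite /=; congr f.
  rewrite [X in refl X (consv _ _)](consv_eta a) a0 -/(tailv a) /refl !dotv_consv mulr0 add0r.
  by rewrite mul0r add0r consvZ consvB mulr0 subr0.
pose b := (a 0 ord0)^-1 *: a.
have reflE : refl a = refl b by apply/funext => x; rewrite reflZ ?invr_eq0.
pose b' := tailv b.
have bE : b = consv 1 b' by rewrite {1}(consv_eta b) mxE mulVf.
have q0 : dotv b b != 0.
  by rewrite bE dotv_consv mulr1 gt_eqF// ltr_wpDr// sqnorm_ge0.
have bb : dotv b b = 1 + dotv b' b' by rewrite bE dotv_consv mulr1.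
rewrite bb in q0.
have cfs : continuous (fun x => f (refl a x)).
  by apply: continuous_funcomp cf; exact: continuous_refl.
have bfs : gauss_bounded C c (fun x => f (refl a x)).
  by move=> x; rewrite -(sqnorm_refl a x); exact: bf.
have c0' : 0 < c / (2 + 2 * sqnorm b').
  by rewrite divr_gt0// ltr_wpDr// mulr_ge0// sqnorm_ge0.
have cG := @continuous_shear _ b' _ cf.
have bG := gauss_bounded_shear b' c0 bf.
rewrite (rint_shear b' c0 cfs bfs) (rint_shear b' c0 cf bf).
rewrite [LHS]/= [RHS]/=.
have cGt t : continuous (shear b' f \o consv t).
  by move=> v; apply: continuous_comp; [exact: continuous_consvr|exact: cG].
rewrite -(@Rintegral_opp _ (fun t => rint (shear b' f \o consv t))
  (C * gmass (c / (2 + 2 * sqnorm b')) ^+ n) _ c0'); first last.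
- by have [_ ] := rint_slice c0' (gauss_lim_cst cG bG); exact.
- exact: (continuous_rint_slice c0' cG bG).
apply: eq_Rintegral => t _.
rewrite -(rint_shift (- ((2 * t / dotv b b) *: b')) c0' (cGt _) (gauss_bounded_consv _ bG)).
congr rint; apply/funext => v; rewrite /shear /= !consv0 !tailv_consv reflE.
congr f.
rewrite /refl {1 3}bE dotv_consv mulr1 subrK.
rewrite [in LHS]bE consvZ consvB -bE mulr1; congr consv.
rewrite bb dotvDl dotvNl (dotvZl _ b').
by field.
Qed.

(* The integral of a difference quotient vanishes by translation invariance. *)
Lemma rint_derive n (f df : 'rV[R]_n -> R) (v : 'rV[R]_n) C c : 0 < c ->
  continuous f -> gauss_bounded C c f -> continuous df -> gauss_bounded C c df ->
  (forall x : 'rV[R]_n, is_derive (0 : R) 1 (fun h : R => f (x + h *: v)) (df x)) ->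
  rint df = 0.
Proof.
move=> c0 cf bf cdf bdf fdf.
have C0 := gauss_bounded_ge0 bf.
pose h k : R := k.+1%:R^-1.
have h0 k : 0 < h k by rewrite invr_gt0.
have h1 k : h k <= 1 by rewrite invf_le1// ler1n.
pose fk k (x : 'rV[R]_n) := (h k)^-1 * (f (x + h k *: v) - f x).
have c2 : 0 < c / 2 by rewrite divr_gt0.
have cfk k : continuous (fk k).
  apply: continuous_funZ; apply: continuous_funB => //.
  apply: continuous_funcomp cf => x.
  by apply: (@cvgD _ _ _ (nbhs x)); [move=> A|exact: cvg_cst].
have is_d (x : 'rV[R]_n) (s : R) : is_derive s 1 (fun h : R => f (x + h *: v)) (df (x + s *: v)).
  have E : (fun h : R => h^-1 *: (((fun u => f (x + u *: v)) \o shift s) (h *: 1) - f (x + s *: v))) =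
      (fun h : R => h^-1 *: (((fun u => f (x + s *: v + u *: v)) \o shift 0) (h *: 1) -
        f (x + s *: v + 0 *: v))).
    apply/funext => u; rewrite /= /shift/= addr0 scale0r addr0 scalerDl addrA.
    by rewrite [x + _ + _]addrAC.
  case: (fdf (x + s *: v)) => d1 d2; apply: DeriveDef.
    by rewrite /derivable E; exact: d1.
  by rewrite /derive E; exact: d2.
(* By the mean value theorem the quotient is a value of [df] at a shifted point; steps of size at
   most 1 make the cost of the shift independent of k. *)
have bfk k : gauss_bounded (C * expR (c * sqnorm v)) (c / 2) (fk k).
  move=> x.
  have cx : {within `[0, h k], continuous (fun u : R => f (x + u *: v))}.
    apply: continuous_subspaceT => s.
    apply: differentiable_continuous; apply/derivable1_diffP.
    by case: (is_d x s).
  have [s] := MVT_segment (ltW (h0 k)) (fun s _ => is_d x s) cx.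
  rewrite in_itv/= => /andP[s0 sh]; rewrite scale0r addr0 subr0 => E.
  rewrite /fk E mulrCA mulVf ?mulr1 ?gt_eqF//.
  apply: le_trans (gauss_bounded_shift (s *: v) c0 bdf x) _.
  rewrite ler_wpM2r ?expR_ge0// ler_wpM2l// ler_expR ler_wpM2l ?(ltW c0)//.
  rewrite (_ : sqnorm (s *: v) = s ^+ 2 * sqnorm v); last by rewrite /sqnorm dotvZl dotvZr; ring.
  by rewrite ler_piMl ?sqnorm_ge0// expr_le1// (le_trans sh).
have fk_df x : fk ^~ x @ \oo --> df x.
  case: (fdf x) => d1 d2.
  have : (fun u : R => u^-1 * (f (x + u *: v) - f x)) @ (0 : R)^' --> df x.
    have : (fun u : R => u^-1 *: (((fun u : R => f (x + u *: v)) \o shift 0) (u *: 1) - f (x + 0 *: v)))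
       @ (0 : R)^' --> df x by rewrite -d2; exact: d1.
    apply: cvg_trans; apply: near_eq_cvg; near=> u.
    by rewrite /= addr0 scale0r addr0 /GRing.scale/= mulr1.
  move/cvgr_dnbhsP => /(_ h); apply; split; first by move=> k; rewrite gt_eqF.
  exact: cvg_harmonic.
have [+ _] := rint_dct c2 (And3 cfk bfk fk_df).
have -> : (fun k => rint (fk k)) = (fun=> 0).
  apply/funext => k.
  have Hf : gauss_lim C (c / 2) (fun=> f) f.
    by apply: gauss_lim_cst => //; apply: (gauss_bounded_le bf); rewrite ler_pdivrMr// ler_peMr ?ler1n// ltW.
  have cfh : continuous (fun x : 'rV[R]_n => f (x + h k *: v)).
    apply: continuous_funcomp cf => x.
    by apply: (@cvgD _ _ _ (nbhs x)); [move=> A|exact: cvg_cst].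
  have Hh := gauss_lim_cst cfh (gauss_bounded_shift (h k *: v) c0 bf).
  have HN := gauss_limZ (-1) Hf.
  have -> : fk k = fun x => (h k)^-1 * (f (x + h k *: v) + -1 * f x).
    by apply/funext => x; rewrite mulN1r.
  rewrite (rintZ _ c2 (gauss_limD Hh HN)) (rintD c2 c2 Hh HN) (rintZ _ c2 Hf).
  by rewrite (rint_shift _ c0 cf bf) mulN1r subrr mulr0.
by move=> H; apply: esym; apply: (@cvg_unique _ _ _ _ _ _ (cvg_cst 0) H).
Unshelve. all: by end_near. Qed.

End IntegralInvariance.

(** * Roots, multiplicities and sums over positive roots *)

Section RootSystem.
Variables (R : realType) (m : nat) (Rt Rp : seq 'rV[R]_m) (kap : 'rV[R]_m -> R).
Hypothesis rsRt : root_system Rt.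
Hypothesis psRp : positive_subsystem Rt Rp.
Hypothesis mkap : multiplicity Rt kap.
Implicit Types a b x : 'rV[R]_m.

Lemma root_neq0 a : a \in Rt -> a != 0.
Proof. by case: rsRt => _ H _ _; exact: H. Qed.

Lemma root_refl a b : a \in Rt -> b \in Rt -> refl a b \in Rt.
Proof. by case: rsRt => _ _ H _; exact: H. Qed.

Lemma root_opp a : a \in Rt -> - a \in Rt.
Proof. by move=> aR; rewrite -refl_root ?root_neq0// root_refl. Qed.

Lemma pos_root a : a \in Rp -> a \in Rt.
Proof.
case: psRp => b [_ /perm_mem ->]; by rewrite mem_filter => /andP[].
Qed.

Lemma pos_root_neq0 a : a \in Rp -> a != 0.
Proof. by move/pos_root/root_neq0. Qed.

Lemma kap_ge0 a : a \in Rp -> 0 <= kap a.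
Proof. by move=> /pos_root; case: mkap => H _; exact: H. Qed.

Lemma kap_refl a b : a \in Rt -> b \in Rt -> kap (refl b a) = kap a.
Proof.
move=> aR bR; case: mkap => _ /(_ (refl b \o id) a); apply => //.
by apply: refl_group_step => //; exact: refl_group_id.
Qed.

Lemma kap_opp a : a \in Rt -> kap (- a) = kap a.
Proof. by move=> aR; rewrite -refl_root ?root_neq0// kap_refl. Qed.

Lemma reflNl a : refl (- a) =1 refl a.
Proof. by move=> x; rewrite -scaleN1r reflZ// oppr_eq0 oner_neq0. Qed.

Lemma refl_conj a b x : refl (refl b a) x = refl b (refl a (refl b x)).
Proof.
rewrite [refl a (refl b x)]/refl -scaleNr reflD reflZr reflK scaleNr {1}/refl.
by rewrite dotv_refl dotv_refll.
Qed.

(** Reflecting a positive root and passing to the positive one of the two opposite roots permutes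
    R_+, and an even [phi] does not see the choice of sign. A general monoid covers both the Dunkl
    sums and the product in the weight. *)
Lemma big_pos_refl (S : Type) (idx : S) (op : Monoid.com_law idx) b (phi : 'rV[R]_m -> S) :
  b \in Rt -> (forall a, a \in Rt -> phi (- a) = phi a) ->
  \big[op/idx]_(a <- Rp) phi (refl b a) = \big[op/idx]_(a <- Rp) phi a.
Proof.
move=> bR even.
have uRt : uniq Rt by case: rsRt.
case: (psRp) => v [v0 pv].
have uRp : uniq Rp by rewrite (perm_uniq pv) filter_uniq.
have memRp a : (a \in Rp) = (0 < dotv a v) && (a \in Rt) by rewrite (perm_mem pv) mem_filter.
pose ab a := if 0 < dotv a v then a else - a.
have abP a : a \in Rt -> ab a \in Rp.
  move=> aR; rewrite memRp /ab; case: ifPn => [->//|]; rewrite -leNgt => av.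
  by rewrite root_opp// dotvNl oppr_gt0 lt_neqAle v0// av.
have abphi a : a \in Rt -> phi (ab a) = phi a.
  by move=> aR; rewrite /ab; case: ifP => // _; exact: even.
have injab : {in Rp &, injective (fun a => ab (refl b a))}.
  have inj : injective (refl b) by exact: inv_inj (reflK b).
  have npos c : c \in Rp -> - c \in Rp -> False.
    rewrite !memRp => /andP[c0 _] /andP[+ _]; rewrite dotvNl oppr_gt0.
    by rewrite ltNge ltW.
  move=> a a' aR aR'; rewrite /ab; case: ifP => _; case: ifP => _.
  - exact: inj.
  - by rewrite -reflN => /inj E; exfalso; apply: (npos a') => //; rewrite -E.
  - by rewrite -reflN => /inj E; exfalso; apply: (npos a) => //; rewrite E.
  - by move/oppr_inj; exact: inj.
have sub : {subset [seq ab (refl b a) | a <- Rp] <= Rp}.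
  by move=> _ /mapP[a /pos_root aR ->]; apply: abP; exact: root_refl.
have us : uniq [seq ab (refl b a) | a <- Rp] by rewrite map_inj_in_uniq.
have pm : perm_eq [seq ab (refl b a) | a <- Rp] Rp.
  apply: uniq_perm => //.
  by have [|_ //] := uniq_min_size us sub; rewrite size_map.
rewrite -[RHS](perm_big _ pm) big_map/=.
by rewrite big_seq [RHS]big_seq; apply: eq_bigr => a /pos_root aR; rewrite abphi// root_refl.
Qed.

End RootSystem.

(** * Homogeneous polynomials with a norm *)

Section Polynomials.
Variables (R : realType) (m : nat).
Implicit Types (u v x y : 'rV[R]_m) (f g : 'rV[R]_m -> R).

Definition enorm x : R := Num.sqrt (sqnorm x).

Lemma enorm_ge0 x : 0 <= enorm x. Proof. exact: sqrtr_ge0. Qed.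

Lemma enorm_sqr x : enorm x ^+ 2 = sqnorm x.
Proof. by rewrite sqr_sqrtr ?sqnorm_ge0. Qed.

Lemma dotv_le x y : `|dotv x y| <= enorm x * enorm y.
Proof.
rewrite -sqrtrM ?sqnorm_ge0// -sqrtr_sqr ler_sqrt ?mulr_ge0 ?sqnorm_ge0//.
exact: dotv_CS.
Qed.

Lemma enorm_refl a x : enorm (refl a x) = enorm x.
Proof. by rewrite /enorm sqnorm_refl. Qed.

(* [hpoly n M f]: f is a homogeneous polynomial function of degree n of
   projective tensor norm at most M. *)
Inductive hpoly : nat -> R -> ('rV[R]_m -> R) -> Prop :=
| hpoly_cst c : hpoly 0 `|c| (fun=> c)
| hpoly_mul n M v f : hpoly n M f -> hpoly n.+1 (enorm v * M) (fun x => dotv v x * f x)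
| hpoly_add n M M' f g : hpoly n M f -> hpoly n M' g -> hpoly n (M + M') (fun x => f x + g x)
| hpoly_le n M M' f : M <= M' -> hpoly n M f -> hpoly n M' f.

Lemma hpoly_ext n M f g : f =1 g -> hpoly n M f -> hpoly n M g.
Proof. by move=> /funext ->. Qed.

Lemma hpoly_ge0 n M f : hpoly n M f -> 0 <= M.
Proof.
elim=> {n M f}[c|n M v f _ IH|n M M' f g _ IH _ IH'|n M M' f MM' _ IH] //.
- by rewrite mulr_ge0// enorm_ge0.
- exact: addr_ge0.
- exact: le_trans MM'.
Qed.

Lemma hpoly0 n M : 0 <= M -> hpoly n M (fun=> 0).
Proof.
move=> M0; apply: (hpoly_le M0); elim: n => [|n IH].
  by have := hpoly_cst 0; rewrite normr0.
have := hpoly_mul 0 IH; rewrite mulr0; apply: hpoly_ext => x.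
by rewrite mulr0.
Qed.

Lemma hpolyZ n M f c : hpoly n M f -> hpoly n (`|c| * M) (fun x => c * f x).
Proof.
elim=> {n M f}[d|n M v f _ IH|n M M' f g _ IH _ IH'|n M M' f MM' _ IH].
- by rewrite -normrM; exact: hpoly_cst.
- rewrite mulrCA; apply: hpoly_ext (hpoly_mul v IH) => x.
  by rewrite mulrCA.
- rewrite mulrDr; apply: hpoly_ext (hpoly_add IH IH') => x.
  by rewrite mulrDr.
- by apply: hpoly_le IH; rewrite ler_wpM2l.
Qed.

Lemma hpolyM n M f k M' g : hpoly n M f -> hpoly k M' g ->
  hpoly (n + k) (M * M') (fun x => f x * g x).
Proof.
move=> + pg; elim=> {n M f}[d|n M v f _ IH|n M M1 f h _ IH _ IH'|n M M1 f MM' _ IH].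
- exact: hpolyZ.
- rewrite -mulrA; apply: hpoly_ext (hpoly_mul v IH) => x; by rewrite mulrA.
- rewrite mulrDl; apply: hpoly_ext (hpoly_add IH IH') => x; by rewrite mulrDl.
- by apply: hpoly_le IH; rewrite ler_wpM2r// (hpoly_ge0 pg).
Qed.

Lemma hpoly_sum n (I : eqType) (r : seq I) (M : I -> R) (f : I -> 'rV[R]_m -> R) :
  (forall i, i \in r -> hpoly n (M i) (f i)) ->
  hpoly n (\sum_(i <- r) M i) (fun x => \sum_(i <- r) f i x).
Proof.
elim: r => [_|i r IH H].
  rewrite big_nil; apply: hpoly_ext (hpoly0 n (lexx 0)) => x.
  by rewrite big_nil.
rewrite big_cons; apply: (@hpoly_ext _ _ (fun x => f i x + \sum_(i <- r) f i x)).
  by move=> x; rewrite big_cons.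
apply: hpoly_add; first by apply: H; rewrite mem_head.
by apply: IH => j jr; apply: H; rewrite inE jr orbT.
Qed.

Lemma hpoly_refl n M f a : hpoly n M f -> hpoly n M (fun x => f (refl a x)).
Proof.
elim=> {n M f}[c|n M v f _ IH|n M M' f g _ IH _ IH'|n M M' f MM' _ IH].
- exact: hpoly_cst.
- rewrite -(enorm_refl a); apply: hpoly_ext (hpoly_mul (refl a v) IH) => x.
  by rewrite dotv_refll.
- exact: hpoly_add.
- exact: hpoly_le IH.
Qed.

Lemma hpoly_bound n M f x : hpoly n M f -> `|f x| <= M * enorm x ^+ n.
Proof.
elim=> {n M f}[c|n M v f _ IH|n M M' f g _ IH _ IH'|n M M' f MM' _ IH].
- by rewrite expr0 mulr1.
- rewrite normrM exprS mulrACA ler_pM//; exact: dotv_le.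
- by rewrite mulrDl (le_trans (ler_normD _ _))// lerD.
- by rewrite (le_trans IH)// ler_wpM2r// exprn_ge0// enorm_ge0.
Qed.

Lemma hpoly_continuous n M f : hpoly n M f -> continuous f.
Proof.
elim=> {n M f}[c|n M v f _ IH|n M M' f g _ IH _ IH'|n M M' f MM' _ IH] //.
- exact: continuous_cst.
- by apply: continuous_funM => //; exact: continuous_dotvr.
- exact: continuous_funD.
Qed.

Lemma is_derive_dotv u v x : is_derive x u (dotv v) (dotv v u).
Proof.
have E : (fun h : R => h^-1 *: ((dotv v \o shift x) (h *: u) - dotv v x)) @ (0 : R)^' --> dotv v u.
  have : (fun=> dotv v u) @ (0 : R)^' --> dotv v u by exact: cvg_cst.
  apply: cvg_trans; apply: near_eq_cvg; near=> h.
  have h0 : h != 0 by near: h; exact: nbhs_dnbhs_neq.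
  by rewrite /= dotvDr dotvZr addrK /GRing.scale/= mulKf.
by apply: DeriveDef; [apply/cvg_ex; exists (dotv v u)|exact: cvg_lim E].
Unshelve. all: by end_near. Qed.

Definition smooth f := forall x u, derivable f x u.

Lemma hpoly_smooth n M f : hpoly n M f -> smooth f.
Proof.
elim=> {n M f}[c|n M v f _ IH|n M M' f g _ IH _ IH'|n M M' f MM' _ IH]; last exact: IH.
- by move=> x u; exact: derivable_cst.
- by move=> x u; apply: derivableM; [case: (is_derive_dotv u v x)|exact: IH].
- by move=> x u; apply: derivableD; [exact: IH|exact: IH'].
Qed.

Lemma derive_mul_dotv v f x u : derivable f x u ->
  'D_u (fun x => dotv v x * f x) x = dotv v x * 'D_u f x + dotv v u * f x.
Proof.
move=> df; rewrite (@deriveM _ _ (dotv v) f)//; last by case: (is_derive_dotv u v x).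
by case: (is_derive_dotv u v x) => _ ->; rewrite /GRing.scale/= [f x * _]mulrC.
Qed.

Lemma derive_add f g x u : derivable f x u -> derivable g x u ->
  'D_u (fun x => f x + g x) x = 'D_u f x + 'D_u g x.
Proof. by move=> df dg; rewrite (@deriveD _ _ _ f g). Qed.

Lemma derive_scale (c : R) f x u : derivable f x u ->
  'D_u (fun x => c * f x) x = c * 'D_u f x.
Proof. by move=> df; rewrite (@deriveZ _ _ _ f c). Qed.

Lemma smoothD f g : smooth f -> smooth g -> smooth (fun x => f x + g x).
Proof. by move=> sf sg x u; exact: derivableD. Qed.

Lemma smoothZ c f : smooth f -> smooth (fun x => c * f x).
Proof. by move=> sf x u; exact: derivableZ. Qed.

Lemma smooth_mul_dotv v f : smooth f -> smooth (fun x => dotv v x * f x).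
Proof. by move=> sf x u; apply: derivableM => //; case: (is_derive_dotv u v x). Qed.

Lemma smooth_sum (I : Type) (r : seq I) (f : I -> 'rV[R]_m -> R) :
  (forall i, smooth (f i)) -> smooth (fun x => \sum_(i <- r) f i x).
Proof.
move=> sf; elim: r => [|i r IH].
  rewrite (_ : (fun x => _) = (fun=> 0)); first by move=> x u; exact: derivable_cst.
  by apply/funext => x; rewrite big_nil.
rewrite (_ : (fun x => _) = (fun x => f i x + \sum_(i <- r) f i x)).
  exact: smoothD.
by apply/funext => x; rewrite big_cons.
Qed.

End Polynomials.

(** * Dunkl operators on homogeneous polynomials *)

Section DunklOperators.
Variables (R : realType) (m : nat) (Rt Rp : seq 'rV[R]_m) (kap : 'rV[R]_m -> R).
Hypothesis rsRt : root_system Rt.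
Hypothesis psRp : positive_subsystem Rt Rp.
Hypothesis mkap : multiplicity Rt kap.
Implicit Types (a b u v w x y : 'rV[R]_m) (f g : 'rV[R]_m -> R).

Let Rp0 a : a \in Rp -> a != 0 := @pos_root_neq0 _ _ _ _ rsRt psRp a.

Definition dquot a f x : R :=
  if dotv a x != 0 then (f x - f (refl a x)) / dotv a x
  else 'D_((2 / dotv a a) *: a) f x.

(** An arbitrary direction instead of a basis vector: equivariance under reflections needs the
    direction to be reflected too, and later T_z is iterated for a general z. *)
Definition dk u f x : R :=
  'D_u f x + \sum_(a <- Rp) kap a * dotv a u * dquot a f x.

Lemma dunkl_dk j f x : dunkl id Rp kap j f x = dk (evec R j) f x.
Proof.
rewrite /dunkl /dk; congr (_ + _); apply: eq_bigr => a _.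
by rewrite map_mx_id// dotv_evec.
Qed.

(** The product rule for a linear factor holds on the hyperplane as well: there x is its own
    reflection and the directional derivative supplies the same coefficient. *)
Lemma dquot_mul a v f x : a != 0 -> smooth f ->
  dquot a (fun x => dotv v x * f x) x =
  dotv v x * dquot a f x + 2 * dotv v a / dotv a a * f (refl a x).
Proof.
move=> a0 sf; have /lt0r_neq0 aa := dotv_gt0 a0.
rewrite /dquot; case: ifPn => [ax|]; last first.
  rewrite negbK => /eqP ax; rewrite derive_mul_dotv// dotvZr refl_fix//.
  by congr (_ + _ * _); field.
have -> : dotv v (refl a x) = dotv v x - 2 * dotv a x / dotv a a * dotv v a.
  by rewrite /refl dotvBr dotvZr (dotvC x a).
by field; rewrite ax aa.
Qed.

Lemma dk_mul u v f x : smooth f ->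
  dk u (fun x => dotv v x * f x) x =
  dotv v x * dk u f x + dotv v u * f x +
  \sum_(a <- Rp) kap a * dotv a u * (2 * dotv v a / dotv a a) * f (refl a x).
Proof.
move=> sf; rewrite /dk derive_mul_dotv// mulrDr -!addrA; congr (_ + _).
rewrite addrCA; congr (_ + _); rewrite mulr_sumr -big_split/=.
rewrite big_seq [RHS]big_seq; apply: eq_bigr => a /Rp0 a0.
by rewrite dquot_mul//; ring.
Qed.

Lemma dquotD a f g x : smooth f -> smooth g ->
  dquot a (fun x => f x + g x) x = dquot a f x + dquot a g x.
Proof.
move=> sf sg; rewrite /dquot; case: ifPn => _; last exact: derive_add.
by rewrite -mulrDl; congr (_ / _); ring.
Qed.

Lemma dquotZ a c f x : smooth f -> dquot a (fun x => c * f x) x = c * dquot a f x.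
Proof.
move=> sf; rewrite /dquot; case: ifPn => _; last exact: derive_scale.
by rewrite -mulrBr mulrA.
Qed.

Lemma dkD u f g x : smooth f -> smooth g ->
  dk u (fun x => f x + g x) x = dk u f x + dk u g x.
Proof.
move=> sf sg; rewrite /dk derive_add// addrACA; congr (_ + _).
rewrite -big_split/=; apply: eq_bigr => a _.
by rewrite dquotD// mulrDr.
Qed.

Lemma dkZ u c f x : smooth f -> dk u (fun x => c * f x) x = c * dk u f x.
Proof.
move=> sf; rewrite /dk derive_scale// mulrDr; congr (_ + _).
by rewrite mulr_sumr; apply: eq_bigr => a _; rewrite dquotZ// mulrCA.
Qed.

Lemma dk_cst u c x : dk u (fun=> c) x = 0.
Proof.
rewrite /dk derive_cst add0r big1// => a _.
by rewrite /dquot derive_cst subrr mul0r if_same mulr0.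
Qed.

Lemma dk_sum u (I : Type) (r : seq I) (f : I -> 'rV[R]_m -> R) x :
  (forall i, smooth (f i)) ->
  dk u (fun x => \sum_(i <- r) f i x) x = \sum_(i <- r) dk u (f i) x.
Proof.
move=> sf; elim: r => [|i r IH].
  rewrite big_nil (_ : (fun x => _) = (fun=> 0)) ?dk_cst//.
  by apply/funext => y; rewrite big_nil.
rewrite big_cons (_ : (fun x => _) = (fun x => f i x + \sum_(i <- r) f i x)).
  by rewrite dkD ?IH//; exact: smooth_sum.
by apply/funext => y; rewrite big_cons.
Qed.

Definition dkC : R := 1 + 2 * \sum_(a <- Rp) kap a.

Lemma dkC_ge0 : 0 <= dkC.
Proof.
rewrite addr_ge0// mulr_ge0// big_seq sumr_ge0// => a.
exact: (kap_ge0 psRp mkap).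
Qed.

Lemma dk_hpoly0 u M f x : hpoly 0 M f -> dk u f x = 0.
Proof.
move: {-2}0%N (erefl 0%N) => n n0 H.
elim: H n0 => {n M f}[c|n M v f _ _|n M M' f g pf IH pg IH'|n M M' f MM' _ IH] n0 //.
- exact: dk_cst.
- by rewrite dkD ?IH ?IH' ?addr0//; apply: hpoly_smooth; [exact: pf|exact: pg].
- exact: IH.
Qed.

(* The constant is exact for this induction: multiplying by <v, .> adds one
   directional derivative and, for every root, one term of size 2 kap(a). *)
Lemma dk_hpoly u n M f : hpoly n.+1 M f -> hpoly n (dkC * n.+1%:R * enorm u * M) (dk u f).
Proof.
move: {-2}n.+1 (erefl n.+1) => k kn H; elim: H n kn => {k M f}
  [//|k M v f pf IH|k M M' f g pf IH pg IH'|k M M' f MM' _ IH] n.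
- case=> kn; have sf := hpoly_smooth pf; have M0 := hpoly_ge0 pf.
  rewrite -kn {n kn}.
  apply: (@hpoly_ext _ _ _ _ (fun x => dotv v x * dk u f x + (dotv v u * f x +
    \sum_(a <- Rp) (kap a * dotv a u * (2 * dotv v a / dotv a a)) * f (refl a x)))).
    by move=> x; rewrite dk_mul// addrA.
  apply: (@hpoly_le _ _ _ (enorm v * (dkC * k%:R * enorm u * M) +
     (enorm u * enorm v * M + \sum_(a <- Rp) (kap a * 2 * enorm u * enorm v) * M))).
    rewrite le_eqVlt; apply/orP; left; apply/eqP.
    rewrite -mulr_suml -!mulr_suml -natr1 /dkC; ring.
  apply: hpoly_add.
    case: k => [|k] in pf IH *; last by apply: hpoly_mul; exact: IH.
    apply: (@hpoly_ext _ _ _ _ (fun=> 0)).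
      by move=> x; rewrite (dk_hpoly0 _ _ pf) mulr0.
    by apply: hpoly0; rewrite mulr0 !mul0r mulr0.
  apply: hpoly_add.
    apply: hpoly_le (hpolyZ _ pf); rewrite ler_wpM2r// [leRHS]mulrC.
    exact: dotv_le.
  apply: hpoly_sum => a aR.
  apply: hpoly_le (hpolyZ _ (hpoly_refl a pf)); rewrite ler_wpM2r//.
  have k0 := kap_ge0 psRp mkap aR.
  have aa := dotv_gt0 (Rp0 aR).
  rewrite 2!normrM (ger0_norm k0) -!mulrA ler_wpM2l//.
  rewrite !normrM normfV (gtr0_norm aa) normr_nat.
  rewrite mulrCA ler_wpM2l// mulrA ler_pdivrMr//.
  apply: (@le_trans _ _ ((enorm a * enorm u) * (enorm v * enorm a))).
    by rewrite ler_pM// ?dotv_le// dotvC dotvC dotv_le.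
  by rewrite -/(sqnorm a) -enorm_sqr le_eqVlt; apply/orP; left; apply/eqP; ring.
- move=> kn; rewrite mulrDr; apply: (@hpoly_ext _ _ _ _ (fun x => dk u f x + dk u g x)).
    by move=> x; rewrite dkD//; apply: hpoly_smooth; [exact: pf|exact: pg].
  by apply: hpoly_add; [exact: IH|exact: IH'].
- move=> kn; apply: hpoly_le (IH _ kn); rewrite ler_wpM2l//.
  by rewrite !mulr_ge0// ?enorm_ge0// dkC_ge0.
Qed.

(** Mere existence of directional derivatives does not make them additive in the direction, hence
    the induction over polynomials. *)
Lemma dk_dirD n M f u v x : hpoly n M f -> dk (u + v) f x = dk u f x + dk v f x.
Proof.
move=> pf; rewrite /dk addrACA; congr (_ + _).
  elim: pf => {n M f}[c|n M w f pf IH|n M M' f g pf IH pg IH'|n M M' f MM' _ IH] //.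
  - by rewrite !derive_cst addr0.
  - have sf := hpoly_smooth pf.
    by rewrite !derive_mul_dotv// IH dotvDr; ring.
  - have sf := hpoly_smooth pf; have sg := hpoly_smooth pg.
    by rewrite !derive_add// IH IH'; ring.
rewrite -big_split/=; apply: eq_bigr => a _.
by rewrite dotvDr; ring.
Qed.

Lemma dk_dirZ n M f c u x : hpoly n M f -> dk (c *: u) f x = c * dk u f x.
Proof.
move=> pf; rewrite /dk mulrDr; congr (_ + _).
  elim: pf => {n M f}[d|n M w f pf IH|n M M' f g pf IH pg IH'|n M M' f MM' _ IH] //.
  - by rewrite !derive_cst mulr0.
  - have sf := hpoly_smooth pf.
    by rewrite !derive_mul_dotv// IH dotvZr; ring.
  - have sf := hpoly_smooth pf; have sg := hpoly_smooth pg.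
    by rewrite !derive_add// IH IH'; ring.
rewrite mulr_sumr; apply: eq_bigr => a _.
by rewrite dotvZr; ring.
Qed.

(** In the product rule the reflection terms are reindexed by the reflection in b; invariance of
    [kap] and evenness in the root make this legitimate. *)
Lemma dk_refl n M f b u x : b \in Rt -> hpoly n M f ->
  dk u (fun x => f (refl b x)) x = dk (refl b u) f (refl b x).
Proof.
move=> bR.
elim=> {n M f}[d|n M w f pf IH|n M M' f g pf IH pg IH'|n M M' f MM' _ IH]; last exact: IH.
- by rewrite !dk_cst.
- have sf := hpoly_smooth pf; have sfr := hpoly_smooth (hpoly_refl b pf).
  rewrite (_ : (fun x => _) = (fun x => dotv (refl b w) x * f (refl b x))); last first.
    by apply/funext => y; rewrite dotv_refll.
  rewrite !dk_mul// IH !dotv_refll; congr (_ + _).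
  rewrite -[RHS](big_pos_refl rsRt psRp _ bR); last first.
    move=> a aR; rewrite (kap_opp rsRt mkap)// reflNl !(dotvNl, dotvNr) opprK.
    by rewrite !(mulrN, mulNr, opprK).
  rewrite big_seq [RHS]big_seq; apply: eq_bigr => a /(pos_root psRp) aR.
  rewrite (kap_refl mkap)// !dotv_refl refl_conj reflK; congr (_ * _).
  by rewrite -(dotv_refll b w a).
- have sf := hpoly_smooth pf; have sg := hpoly_smooth pg.
  have sfr := hpoly_smooth (hpoly_refl b pf); have sgr := hpoly_smooth (hpoly_refl b pg).
  by rewrite (dkD _ _ sfr sgr) (dkD _ _ sf sg) IH IH'.
Qed.

End DunklOperators.

(** * Finiteness of the reflection group *)

Section ReflectionGroup.
Variables (R : realType) (m : nat) (Rt : seq 'rV[R]_m).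
Hypothesis rsRt : root_system Rt.
Implicit Types (a b x y : 'rV[R]_m) (g h : 'M[R]_m).

(** Acts on row vectors from the right, so in [g *m refl_mx a] the reflection is applied last. *)
Definition refl_mx a : 'M[R]_m := 1%:M - (2 / dotv a a) *: (a^T *m a).

Lemma mulmx_refl a x : x *m refl_mx a = refl a x.
Proof.
rewrite /refl_mx mulmxBr mulmx1 -scalemxAr mulmxA.
have -> : x *m a^T = (dotv x a)%:M.
  apply/matrixP => i j; rewrite !ord1 !mxE eqxx mulr1n.
  by apply: eq_bigr => k _; rewrite mxE.
by rewrite mul_scalar_mx scalerA /refl; congr (_ - _ *: _); rewrite mulrAC.
Qed.

Lemma mulmx_inj g h : (forall x, x *m g = x *m h) -> g = h.
Proof. by move=> H; apply/row_matrixP => i; rewrite !rowE. Qed.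

Lemma refl_mxK a : refl_mx a *m refl_mx a = 1%:M.
Proof. by apply: mulmx_inj => x; rewrite mulmxA !mulmx_refl reflK mulmx1. Qed.

Inductive gword : 'M[R]_m -> Prop :=
| gword1 : gword 1%:M
| gwordS a g : a \in Rt -> gword g -> gword (refl_mx a *m g).

Lemma gword_r a g : a \in Rt -> gword g -> gword (g *m refl_mx a).
Proof.
move=> aR; elim=> [|b h bR _ IH].
  by rewrite mul1mx -[refl_mx a]mulmx1; apply: gwordS => //; exact: gword1.
by rewrite -mulmxA; exact: gwordS.
Qed.

Lemma gword_dotv g x y : gword g -> dotv (x *m g) (y *m g) = dotv x y.
Proof.
move=> gg; elim: gg x y => [|a h _ _ IH] x y; first by rewrite !mulmx1.
by rewrite !mulmxA !mulmx_refl IH dotv_refl.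
Qed.

Lemma gword_root g b : gword g -> b \in Rt -> b *m g \in Rt.
Proof.
move=> gg; elim: gg b => [|a h aR _ IH] b bR; first by rewrite mulmx1.
by rewrite mulmxA mulmx_refl; apply: IH; exact: (root_refl rsRt).
Qed.

Lemma gword_orth g x z : gword g -> (forall a, a \in Rt -> dotv a z = 0) ->
  dotv (x *m g) z = dotv x z.
Proof.
move=> gg zR; elim: gg x => [|a h aR _ IH] x; first by rewrite mulmx1.
by rewrite mulmxA mulmx_refl IH /refl dotvBl dotvZl (zR a aR) mulr0 subr0.
Qed.

Lemma gword_inj g : gword g -> injective (fun x => x *m g).
Proof.
move=> gg x y xy; apply/eqP; rewrite -subr_eq0; apply/eqP; apply: sqnorm_eq0.
rewrite /sqnorm -(gword_dotv _ _ gg) mulmxBl xy subrr.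
exact: dotv0l.
Qed.

(* The difference d of two images of x is orthogonal to all roots, while
   group elements only move vectors within the span of the roots. *)
Lemma gword_eq g h : gword g -> gword h ->
  (forall a, a \in Rt -> a *m g = a *m h) -> g = h.
Proof.
move=> gg hh gh; apply: mulmx_inj => x.
apply/eqP; rewrite -subr_eq0; apply/eqP; set d := _ - _.
have dR a : a \in Rt -> dotv a d = 0.
  have uRt : uniq Rt by case: rsRt.
  have us : uniq [seq b *m g | b <- Rt] by rewrite map_inj_uniq//; exact: gword_inj.
  have sub : {subset [seq b *m g | b <- Rt] <= Rt}.
    by move=> _ /mapP[b bR ->]; exact: gword_root.
  have [|_ E] := uniq_min_size us sub; first by rewrite size_map.
  rewrite -E => /mapP[b bR ->].
  by rewrite /d dotvBr gword_dotv// gh// gword_dotv// subrr.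
apply: sqnorm_eq0; rewrite /sqnorm {1}/d dotvBl !gword_orth//.
exact: subrr.
Qed.

(** An element is determined by the way it permutes the roots ([gword_eq]), so one representative
    per possible permutation code exhausts the group. *)
Lemma finite_reflection_group :
  exists Gl : seq 'M[R]_m, uniq Gl /\ forall g, g \in Gl <-> gword g.
Proof.
pose N := size Rt.
(* For a matrix that does not preserve the roots [index] may return N, hence N + 1 values. *)
pose code g := [ffun i : 'I_N => inord (index (nth 0 Rt i *m g) Rt) : 'I_N.+1].
(* A code realized by no group element yields the default identity, which belongs to the group
   anyway. *)
pose Gl := undup [seq xget 1%:M [set g | gword g /\ code g = phi] |
  phi <- enum {: {ffun 'I_N -> 'I_N.+1}}].
exists Gl; split; first exact: undup_uniq.
move=> g; rewrite mem_undup; split.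
  move=> /mapP[phi _ ->].
  by case: xgetP => [h _ []//|_]; exact: gword1.
move=> gg; apply/mapP; exists (code g); first by rewrite mem_enum.
case: xgetP => [h _ [hh E]|/(_ g)]; last by case.
apply: gword_eq => // a aR.
have ia : (index a Rt < N)%N by rewrite index_mem.
have := congr1 (fun phi : {ffun 'I_N -> 'I_N.+1} => val (phi (Ordinal ia))) E.
rewrite !ffunE/= !inordK; last 2 first.
- by rewrite ltnS index_size.
- by rewrite ltnS index_size.
rewrite nth_index// => /(congr1 (nth 0 Rt)).
by rewrite !nth_index//; exact: gword_root.
Qed.

End ReflectionGroup.

(** * Maximum principle and inversion of n + K on a finite orbit *)

Section MaximumPrinciple.
Variables (R : realType) (A : eqType) (r : seq A) (kap : A -> R).
Hypothesis kap0 : forall a, a \in r -> 0 <= kap a.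

(** Where |phi| is largest, the subtracted sum is at most the sum of the [kap a] times this maximum,
    so n times the maximum survives on the left. *)
Lemma max_principle (T : eqType) (s : seq T) (act : A -> T -> T) (phi : T -> R) (n B : R) :
  (forall a g, a \in r -> g \in s -> act a g \in s) -> 0 < n ->
  (forall g, g \in s ->
     `|(n + \sum_(a <- r) kap a) * phi g - \sum_(a <- r) kap a * phi (act a g)| <= B) ->
  forall g, g \in s -> n * `|phi g| <= B.
Proof.
move=> acts n0 H g gs.
have [g1 g1s Hmax] : exists2 g1, g1 \in s & forall g, g \in s -> `|phi g| <= `|phi g1|.
  elim: s g gs {H acts} => // h s IH _ _.
  case: s IH => [_|h' s /(_ h' (mem_head _ _)) [k ks Hk]].
    by exists h => [|k]; rewrite ?mem_head// inE => /eqP ->.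
  have [hk|kh] := leP `|phi h| `|phi k|.
    by exists k => [|l]; rewrite inE ?ks ?orbT// => /predU1P[->//|/Hk].
  exists h => [|l]; rewrite ?mem_head// inE => /predU1P[->//|/Hk/le_trans]; apply.
  exact: ltW.
apply: (@le_trans _ _ (n * `|phi g1|)); first by rewrite ler_wpM2l ?Hmax// ltW.
set N := \sum_(a <- r) kap a in H *.
have N0 : 0 <= N by rewrite /N big_seq sumr_ge0.
have S0 : `|\sum_(a <- r) kap a * phi (act a g1)| <= N * `|phi g1|.
  rewrite /N mulr_suml big_seq [in leRHS]big_seq.
  apply: le_trans (ler_norm_sum _ _ _) _; apply: ler_sum => a ar.
  by rewrite normrM (ger0_norm (kap0 ar)) ler_wpM2l ?kap0// Hmax// acts.
have nN : 0 <= n + N by rewrite addr_ge0// ltW.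
suff : (n + N) * `|phi g1| <= B + N * `|phi g1| by rewrite mulrDl lerD2r.
rewrite -{1}(ger0_norm nN) -normrM.
rewrite -[X in `|X|](subrK (\sum_(a <- r) kap a * phi (act a g1))).
by rewrite (le_trans (ler_normD _ _))// lerD// H.
Qed.

(** The maximum principle makes the matrix of n + K injective, hence invertible; the coefficients
    are the row of the inverse at e. As they do not depend on [phi], solutions of the radial
    equation become fixed combinations of values on the orbit. *)
Lemma resolvent_coef (T : eqType) (s : seq T) (act : A -> T -> T) (n : R) (e : T) :
  uniq s -> (forall a g, a \in r -> g \in s -> act a g \in s) -> 0 < n -> e \in s ->
  exists c : T -> R, forall phi : T -> R,
    \sum_(g <- s) c g * ((n + \sum_(a <- r) kap a) * phi g -
      \sum_(a <- r) kap a * phi (act a g)) = phi e.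
Proof.
move=> us acts n0 es; set N := \sum_(a <- r) kap a.
pose d := size s.
pose G (i : 'I_d) := nth e s i.
have Gs i : G i \in s by rewrite mem_nth.
pose M : 'M[R]_d := \matrix_(i, j) ((n + N) * (G i == G j)%:R -
   \sum_(a <- r) kap a * (act a (G i) == G j)%:R).
have sumG g phi : g \in s -> \sum_j (g == G j)%:R * phi (G j) = phi g :> R.
  move=> gs; have ig : (index g s < d)%N by rewrite index_mem.
  have GE : G (Ordinal ig) = g by rewrite /G/= nth_index.
  rewrite (bigD1 (Ordinal ig))//= GE eqxx mul1r big1 ?addr0// => j jg.
  have -> : (g == G j) = false; last by rewrite mul0r.
  apply: contra_neqF jg => /eqP gE; apply: val_inj => /=.
  by rewrite gE index_uniq.
have ME phi i : \sum_j M i j * phi (G j) =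
    (n + N) * phi (G i) - \sum_(a <- r) kap a * phi (act a (G i)).
  rewrite -[phi (G i)](sumG (G i))// mulr_sumr.
  rewrite [X in _ - X](_ : _ = \sum_j \sum_(a <- r) kap a * (act a (G i) == G j)%:R * phi (G j)).
    rewrite -sumrB; apply: eq_bigr => j _.
    by rewrite mxE mulrBl mulrA mulr_suml.
  rewrite exchange_big/= big_seq [RHS]big_seq; apply: eq_bigr => a ar.
  rewrite -[phi (act _ _)](sumG (act a (G i)))//; last exact: acts.
  by rewrite mulr_sumr; apply: eq_bigr => j _; rewrite mulrA.
have uM : M \in unitmx.
  rewrite -unitmx_tr -row_free_unit; apply: inj_row_free => v vM.
  pose phi g := \sum_j (g == G j)%:R * v 0 j.
  have phiG i : phi (G i) = v 0 i.
    rewrite /phi (bigD1 i)//= eqxx mul1r big1 ?addr0// => j ji.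
    have -> : (G i == G j) = false; last by rewrite mul0r.
    by apply: contra_neqF ji; rewrite /G nth_uniq// => /eqP E; exact: val_inj.
  have H : forall g, g \in s -> n * `|phi g| <= 0.
    apply: (max_principle acts n0) => g gs.
    have ig : (index g s < d)%N by rewrite index_mem.
    have <- : G (Ordinal ig) = g by rewrite /G/= nth_index.
    rewrite -ME.
    have := congr1 (fun w : 'rV_d => w 0 (Ordinal ig)) vM; rewrite !mxE => E.
    rewrite (_ : \sum_j _ = 0) ?normr0// -[RHS]E; apply: eq_bigr => j _.
    by rewrite phiG [M^T _ _]mxE mulrC.
  apply/rowP => i; rewrite mxE -phiG; apply/eqP; rewrite -normr_le0.
  by have := H _ (Gs i); rewrite pmulr_rle0.
have ie : (index e s < d)%N by rewrite index_mem.
pose cv := delta_mx 0 (Ordinal ie) *m invmx M : 'rV[R]_d.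
have cM : cv *m M = delta_mx 0 (Ordinal ie) by rewrite mulmxKV.
exists (fun g => \sum_j (g == G j)%:R * cv 0 j) => phi.
rewrite (big_nth e) big_mkord.
transitivity (\sum_(i < d) cv 0 i * \sum_j M i j * phi (G j)).
  apply: eq_bigr => i _; rewrite ME; congr (_ * _).
  rewrite (bigD1 i)//= -/(G i) eqxx mul1r big1 ?addr0// => j ji.
  have -> : (G i == G j) = false; last by rewrite mul0r.
  by apply: contra_neqF ji; rewrite /G nth_uniq// => /eqP E; exact: val_inj.
transitivity (\sum_(j < d) (cv *m M) 0 j * phi (G j)).
  under eq_bigr do rewrite mulr_sumr.
  rewrite exchange_big/=; apply: eq_bigr => j _; rewrite mxE mulr_suml.
  by apply: eq_bigr => i _; rewrite mulrA.
rewrite cM (bigD1 (Ordinal ie))//= mxE !eqxx mul1r big1 ?addr0.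
  by rewrite /G/= nth_index.
by move=> j jE; rewrite mxE (negbTE jE) andbF mul0r.
Qed.

End MaximumPrinciple.

(** * Homogeneous components of the Dunkl kernel *)

Section KernelTerms.
Variables (R : realType) (m : nat) (Rt Rp : seq 'rV[R]_m) (kap : 'rV[R]_m -> R).
Hypothesis rsRt : root_system Rt.
Hypothesis psRp : positive_subsystem Rt Rp.
Hypothesis mkap : multiplicity Rt kap.
Variables (Gl : seq 'M[R]_m) (memGl : forall g, g \in Gl <-> gword Rt g).
Variable cf : nat -> 'M[R]_m -> R.
Notation N := (\sum_(a <- Rp) kap a).
Hypothesis cfE : forall n (phi : 'M[R]_m -> R),
  \sum_(g <- Gl) cf n g * ((n.+1%:R + N) * phi g -
      \sum_(a <- Rp) kap a * phi (refl_mx a *m g)) = phi 1%:M.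
Implicit Types (a b u x y : 'rV[R]_m).

Let kap0 a : a \in Rp -> 0 <= kap a. Proof. exact: (kap_ge0 psRp mkap). Qed.

Let Gl1 : 1%:M \in Gl. Proof. by apply/memGl; exact: gword1. Qed.

Let actr a g : a \in Rp -> g \in Gl -> g *m refl_mx a \in Gl.
Proof. by move=> /(pos_root psRp) aR /memGl gG; apply/memGl; exact: gword_r. Qed.

(* The homogeneous components of the Dunkl kernel:
   (n + K) E_n = <x, y> E_(n-1) with K = sum_a kap(a) (1 - sigma_a). *)
Fixpoint kterm n x y : R :=
  match n with
  | 0 => 1
  | n'.+1 => \sum_(g <- Gl) cf n' g * (dotv (x *m g) y * kterm n' (x *m g) y)
  end.

(** For f homogeneous of degree n this is sum_j x_j T_j f, by Euler's identity. *)
Definition radial (n : R) (f : 'rV[R]_m -> R) x :=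
  (n + N) * f x - \sum_(a <- Rp) kap a * f (refl a x).

(** Reflecting x multiplies every g by the reflection on the left, and this is the action for which
    [cfE] inverts n + K. *)
Lemma radial_kterm n x y : radial n.+1%:R (kterm n.+1 ^~ y) x = dotv x y * kterm n x y.
Proof.
have := cfE n (fun g => dotv (x *m g) y * kterm n (x *m g) y).
rewrite mulmx1 => <-; rewrite /radial /=.
under [in RHS]eq_bigr do rewrite mulrBr.
rewrite sumrB mulr_sumr; congr (_ - _).
  by apply: eq_bigr => g _; rewrite mulrCA.
under eq_bigr do rewrite mulr_sumr.
under [in RHS]eq_bigr do rewrite mulr_sumr.
rewrite exchange_big/=; apply: eq_bigr => g _; apply: eq_bigr => a _.
by rewrite mulmxA mulmx_refl mulrCA.
Qed.

Lemma radial_kterm0 x y : radial 0 (kterm 0 ^~ y) x = 0.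
Proof.
by rewrite /radial/= -mulr_suml add0r subrr.
Qed.

(** The maximum principle on the orbit of x, now for right multiplication: reflecting the point
    [x *m g] appends the reflection to g. *)
Lemma radial_bound (n B : R) f x : 0 < n ->
  (forall g, gword Rt g -> `|radial n f (x *m g)| <= B) -> n * `|f x| <= B.
Proof.
move=> n0 H.
have := @max_principle R _ Rp kap kap0 _ Gl (fun a g => g *m refl_mx a) (fun g => f (x *m g)) n B actr n0.
move=> /(_ _ 1%:M Gl1); rewrite mulmx1; apply => g /memGl gG.
have := H _ gG; rewrite /radial; congr (`|_ - _| <= _).
by apply: eq_bigr => a _; rewrite mulmxA mulmx_refl.
Qed.

Lemma radial_inj (n : R) f : 0 < n -> (forall x, radial n f x = 0) -> forall x, f x = 0.
Proof.
move=> n0 H x; apply/eqP; rewrite -normr_le0 -(pmulr_rle0 _ n0).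
by apply: radial_bound => // g _; rewrite H normr0.
Qed.

Lemma radialB n f g x : radial n (fun x => f x - g x) x = radial n f x - radial n g x.
Proof.
have E : \sum_(a <- Rp) kap a * (f (refl a x) - g (refl a x)) =
    \sum_(a <- Rp) kap a * f (refl a x) - \sum_(a <- Rp) kap a * g (refl a x).
  by rewrite -sumrB; apply: eq_bigr => a _; rewrite mulrBr.
by rewrite /radial E; ring.
Qed.

Lemma radial_refl n f b x : b \in Rt ->
  radial n (fun x => f (refl b x)) x = radial n f (refl b x).
Proof.
move=> bR; rewrite /radial; congr (_ - _).
rewrite -[RHS](big_pos_refl rsRt psRp _ bR); last first.
  by move=> a aR; rewrite (kap_opp rsRt mkap)// reflNl.
rewrite big_seq [RHS]big_seq; apply: eq_bigr => a /(pos_root psRp) aR.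
by rewrite (kap_refl mkap)// refl_conj reflK.
Qed.

(** Both sides have the same image under n + K, which commutes with reflections and is injective for
    n > 0. *)
Lemma kterm_refl n b x y : b \in Rt -> kterm n (refl b x) y = kterm n x (refl b y).
Proof.
move=> bR; elim: n x => [//|n IH] x.
apply/eqP; rewrite -subr_eq0; apply/eqP.
apply: (@radial_inj n.+1%:R (fun x => kterm n.+1 (refl b x) y - kterm n.+1 x (refl b y))) => // z.
rewrite radialB (radial_refl _ (kterm n.+1 ^~ y))// !radial_kterm.
by rewrite IH dotv_refll subrr.
Qed.

(** By [kterm_refl] it makes no difference to which argument n + K is applied, so both sides obey
    the same recursion. *)
Lemma kterm_sym n x y : kterm n x y = kterm n y x.
Proof.
elim: n x y => [//|n IH] x y.
apply/eqP; rewrite -subr_eq0; apply/eqP.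
apply: (@radial_inj n.+1%:R (fun x => kterm n.+1 x y - kterm n.+1 y x)) => // z.
rewrite radialB radial_kterm [X in _ - X](_ : _ = radial n.+1%:R (kterm n.+1 ^~ z) y).
  by rewrite radial_kterm IH dotvC subrr.
rewrite /radial; congr (_ - _); rewrite big_seq [RHS]big_seq.
by apply: eq_bigr => a /(pos_root psRp) aR; rewrite kterm_refl.
Qed.

(** Every degree contributes a factor |x| |y| from the pairing, the same on the whole orbit, and a
    factor 1/n from [radial_bound]. *)
Lemma kterm_bound n x y : `|kterm n x y| <= (enorm x * enorm y) ^+ n / n`!%:R.
Proof.
elim: n x => [|n IH] x; first by rewrite expr0 fact0 divr1 normr1.
have /(_ ((enorm x * enorm y) * ((enorm x * enorm y) ^+ n / n`!%:R))) :=
  @radial_bound n.+1%:R _ (kterm n.+1 ^~ y) x (ltr0Sn _ _).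
rewrite -ler_pdivlMl// => H; apply: le_trans (H _) _.
  move=> g gG; rewrite radial_kterm normrM.
  have E : enorm (x *m g) = enorm x by rewrite /enorm /sqnorm (gword_dotv _ _ gG).
  by rewrite -E ler_pM// dotv_le.
rewrite factS natrM exprS invfM.
by rewrite le_eqVlt; apply/orP; left; apply/eqP; ring.
Qed.

Lemma hpoly_gword n M f g : gword Rt g -> hpoly n M f -> hpoly n M (fun x => f (x *m g)).
Proof.
elim=> [|a h aR _ IH] pf.
  by apply: hpoly_ext pf => x; rewrite mulmx1.
by apply: hpoly_ext (hpoly_refl a (IH pf)) => x; rewrite mulmxA mulmx_refl.
Qed.

Lemma kterm_hpoly n y : exists M, hpoly n M (kterm n ^~ y).
Proof.
elim: n => [|n [M IH]].
  by exists `|1|; exact: hpoly_cst.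
exists (\sum_(g <- Gl) `|cf n g| * (enorm y * M)).
apply: hpoly_sum => g /memGl gG; apply: hpolyZ.
apply: (hpoly_gword (f := fun x => dotv x y * kterm n x y) gG).
by apply: hpoly_ext (hpoly_mul y IH) => x; rewrite dotvC.
Qed.

Lemma kterm_hpolyr n x : exists M, hpoly n M (kterm n x).
Proof.
have [M H] := kterm_hpoly n x; exists M.
by apply: hpoly_ext H => y; exact: kterm_sym.
Qed.

Let smr n x : smooth (kterm n x).
Proof. by have [M H] := kterm_hpolyr n x; exact: hpoly_smooth H. Qed.

(** T_u acts on the second argument and n + K on the first, so they commute. *)
Lemma radial_dk n u y z : radial n.+1%:R (fun x => dk Rp kap u (kterm n.+1 x) y) z =
  dk Rp kap u (fun w => dotv z w * kterm n z w) y.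
Proof.
rewrite (_ : (fun w => _ * _) = (fun w => (n.+1%:R + N) * kterm n.+1 z w +
    \sum_(a <- Rp) - kap a * kterm n.+1 (refl a z) w)); last first.
  apply/funext => w; rewrite -radial_kterm /radial -sumrN; congr (_ + _).
  by apply: eq_bigr => a _; rewrite mulNr.
have sZ c x : smooth (fun w => c * kterm n.+1 x w) by exact: smoothZ.
rewrite dkD//; last by apply: smooth_sum => a; exact: sZ.
rewrite (@dkZ _ _ _ _ _ _ (kterm n.+1 z) _ (@smr _ _)).
rewrite (@dk_sum _ _ _ _ _ _ _ (fun a w => - kap a * kterm n.+1 (refl a z) w)); last first.
  by move=> a; exact: sZ.
rewrite /radial -sumrN; congr (_ + _).
by apply: eq_bigr => a _; rewrite (@dkZ _ _ _ _ _ _ (kterm n.+1 (refl a z)) _ (@smr _ _)) mulNr.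
Qed.

(* Applying n + K in the variable x to both sides yields the same recursion,
   by the commutation relation of T_u with the multiplication by <x, .>. *)
Lemma dk_kterm n u x y : dk Rp kap u (kterm n.+1 x) y = dotv x u * kterm n x y.
Proof.
elim: n x y => [|n IH] x y; apply/eqP; rewrite -subr_eq0; apply/eqP.
all: match goal with |- context [kterm ?k.+1 ?x0] =>
  apply: (@radial_inj k.+1%:R (fun x => dk Rp kap u (kterm k.+1 x) y - dotv x u * kterm k x y)) => // z;
  rewrite radialB radial_dk (@dk_mul _ _ _ _ kap rsRt psRp _ _ (kterm k z) _ (@smr _ _)) end.
all: match goal with |- context [kterm ?k] =>
  have -> : radial k.+1%:R (fun x => dotv x u * kterm k x y) z =
    dotv z u * kterm k z y + dotv z u * radial k%:R (kterm k ^~ y) z +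
    \sum_(a <- Rp) kap a * dotv a u * (2 * dotv z a / dotv a a) * kterm k z (refl a y);
  [ rewrite -natr1 /radial;
    have -> : \sum_(a <- Rp) kap a * (dotv (refl a z) u * kterm k (refl a z) y) =
      dotv z u * (\sum_(a <- Rp) kap a * kterm k (refl a z) y) -
      \sum_(a <- Rp) kap a * dotv a u * (2 * dotv z a / dotv a a) * kterm k z (refl a y);
    [ rewrite mulr_sumr -sumrB big_seq [RHS]big_seq; apply: eq_bigr => a /(pos_root psRp) aR;
      rewrite /refl dotvBl dotvZl -/(refl a z) -/(refl a y) (kterm_refl _ _ _ aR); ring
    | ring ]
  |] end.
  rewrite radial_kterm0 (dk_cst Rp kap u 1); ring.
rewrite radial_kterm IH; ring.
Qed.

End KernelTerms.

(** The interface of the E_n; the group list and the coefficients that built them are forgotten from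
    here on. *)
Record kernel_terms (R : realType) (m : nat) (Rp : seq 'rV[R]_m) (kap : 'rV[R]_m -> R)
    (EE : nat -> 'rV[R]_m -> 'rV[R]_m -> R) : Prop := KernelTerms {
  kt0 : forall x y, EE 0%N x y = 1;
  kt_radial : forall n x y, (n.+1%:R + \sum_(a <- Rp) kap a) * EE n.+1 x y -
    \sum_(a <- Rp) kap a * EE n.+1 (refl a x) y = dotv x y * EE n x y;
  kt_sym : forall n x y, EE n x y = EE n y x;
  kt_bound : forall n x y, `|EE n x y| <= (enorm x * enorm y) ^+ n / n`!%:R;
  kt_hpoly : forall n y, exists M, hpoly n M (EE n ^~ y);
  kt_dk : forall n u x y, dk Rp kap u (EE n.+1 x) y = dotv x u * EE n x y
}.

Lemma kernel_terms_exist (R : realType) (m : nat) (Rt Rp : seq 'rV[R]_m) (kap : 'rV[R]_m -> R) :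
  root_system Rt -> positive_subsystem Rt Rp -> multiplicity Rt kap ->
  exists EE, kernel_terms Rp kap EE.
Proof.
move=> rs ps mk.
have [Gl [uGl memGl]] := finite_reflection_group rs.
have k0 a : a \in Rp -> 0 <= kap a by exact: (kap_ge0 ps mk).
have acts a g : a \in Rp -> g \in Gl -> refl_mx a *m g \in Gl.
  by move=> /(pos_root ps) aR /memGl gG; apply/memGl; exact: gwordS.
have G1 : 1%:M \in Gl by apply/memGl; exact: gword1.
have /choice[cf cfE] n := resolvent_coef k0 uGl acts (ltr0Sn R n) G1.
exists (kterm Gl cf); split => //.
- by move=> n x y; have := radial_kterm cfE n x y.
- exact: (kterm_sym rs ps mk memGl cfE).
- exact: (kterm_bound ps mk memGl cfE).
- exact: (kterm_hpoly memGl).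
- exact: (dk_kterm rs ps mk memGl cfE).
Qed.

(** * From continuous partial derivatives to directional derivatives *)

Section DirectionalDerivative.
Variables (R : realType) (m : nat).
Implicit Types (x p v w : 'rV[R]_m) (f : 'rV[R]_m -> R).

Lemma is_derive_line f p v (s d : R) :
  is_derive (p + s *: v) v f d -> is_derive s 1 (fun t : R => f (p + t *: v)) d.
Proof.
case=> d1 d2.
have E : (fun h : R => h^-1 *: (((fun t : R => f (p + t *: v)) \o shift s) (h *: 1) - f (p + s *: v))) =
    (fun h : R => h^-1 *: ((f \o shift (p + s *: v)) (h *: v) - f (p + s *: v))).
  apply/funext => u; rewrite /= /shift/= scalerDl [u *: 1]/GRing.scale/= mulr1.
  by rewrite addrCA addrA.
apply: DeriveDef; first by rewrite /derivable E; exact: d1.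
by rewrite /derive E; exact: d2.
Qed.

Lemma MVT0 (psi dpsi : R -> R) (b : R) :
  (forall t : R, `|t| <= `|b| -> is_derive t 1 psi (dpsi t)) ->
  exists2 c, `|c| <= `|b| & psi b - psi 0 = dpsi c * b.
Proof.
move=> H.
have cont (u v : R) : (forall t, t \in `[u, v]%R -> `|t| <= `|b|) -> {within `[u, v], continuous psi}.
  move=> uv; apply: continuous_in_subspaceT => t /set_mem/uv/H [d _].
  by apply: differentiable_continuous; exact/derivable1_diffP.
have [b0|b0] := leP 0 b.
  have I t : t \in `[0, b]%R -> `|t| <= `|b|.
    by rewrite in_itv/= => /andP[t0 tb]; rewrite !ger0_norm.
  have I' (t : R) : t \in `]0, b[%R -> is_derive t 1 psi (dpsi t).
    by move=> tb; apply/H/I; exact: subset_itv_oo_cc.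
  have [c cb E] := MVT_segment b0 I' (cont _ _ I).
  by exists c; [exact: I|rewrite E subr0].
have I t : t \in `[b, 0]%R -> `|t| <= `|b|.
  by rewrite in_itv/= => /andP[t0 tb]; rewrite !ler0_norm ?lerN2// ltW.
have I' (t : R) : t \in `]b, 0[%R -> is_derive t 1 psi (dpsi t).
  by move=> tb; apply/H/I; exact: subset_itv_oo_cc.
have [c cb E] := MVT_segment (ltW b0) I' (cont _ _ I).
exists c; first exact: I.
by rewrite -opprB E sub0r mulrN opprK.
Qed.

(** The increment starts at the moving point x + h w. The mean value theorem turns it into a value
    of d near x, and continuity of d at x gives the limit. *)
Lemma partial_increment f (d : 'rV[R]_m -> R) x w (c : R) j :
  (\forall z \near x, is_derive z (evec R j) f (d z)) -> {for x, continuous d} ->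
  (fun h : R => h^-1 * (f (x + h *: w + (h * c) *: evec R j) - f (x + h *: w))) @ (0 : R)^' -->
  c * d x.
Proof.
move=> dn cd; apply/cvgrPdist_lt => e e0.
have e1 : 0 < e / (`|c| + 1) by rewrite divr_gt0// ltr_wpDl.
have /cvgrPdist_lt/(_ _ e1) := cd.
move: dn => /nbhs_normP[d1 /= d10 H1] /nbhs_normP[d2 /= d20 H2].
pose del := Num.min d1 d2.
have del0 : 0 < del by rewrite lt_min d10 d20.
(* Bounds the displacement from x per unit of h; the summand 1 keeps it positive. *)
pose Cw := `|w| + `|c| * `|evec R j| + 1.
have Cw0 : 0 < Cw by rewrite ltr_wpDl// addr_ge0// mulr_ge0.
near=> h.
have h0 : h != 0 by near: h; exact: nbhs_dnbhs_neq.
have hs : `|h| < del / Cw.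
  near: h; apply: dnbhs0_lt; exact: divr_gt0.
have close t : `|t| <= `|h * c| -> `|x - (x + h *: w + t *: evec R j)| < del.
  move=> th; rewrite -addrA opprD addrA subrr add0r normrN.
  apply: le_lt_trans (ler_normD _ _) _; rewrite !normrZ.
  apply: (@le_lt_trans _ _ (`|h| * Cw)); last by rewrite -ltr_pdivlMr.
  rewrite /Cw !mulrDr mulr1 -!addrA lerD2l.
  apply: (@le_trans _ _ (`|h| * (`|c| * `|evec R j|))); last by rewrite lerDl.
  by rewrite mulrA -normrM ler_wpM2r.
have [] := @MVT0 (fun t : R => f (x + h *: w + t *: evec R j))
  (fun t => d (x + h *: w + t *: evec R j)) (h * c).
  move=> t th; apply: is_derive_line; apply: H1.
  by apply: lt_le_trans (close _ th) _; rewrite ge_min lexx.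
move=> t th; rewrite scale0r addr0 => ->.
rewrite [h^-1 * _](_ : _ = c * d (x + h *: w + t *: evec R j)); last by field.
rewrite -mulrBr normrM.
have : `|d x - d (x + h *: w + t *: evec R j)| < e / (`|c| + 1).
  by apply: H2; apply: lt_le_trans (close _ th) _; rewrite ge_min lexx orbT.
rewrite ltr_pdivlMr; last by rewrite ltr_wpDl.
by apply: le_lt_trans; rewrite mulrC ler_wpM2l// lerDl.
Unshelve. all: by end_near. Qed.

(** [dunkl_kernel] offers partial derivatives only, while the energy estimate needs derivatives
    along rays; the basis directions are added one at a time. *)
Lemma partial_is_derive f (d : 'I_m -> 'rV[R]_m -> R) x v :
  (forall j, \forall z \near x, is_derive z (evec R j) f (d j z)) ->
  (forall j, {for x, continuous (d j)}) ->
  is_derive x v f (\sum_j v 0 j * d j x).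
Proof.
move=> dn cd.
suff H : (fun h : R => h^-1 * (f (x + h *: v) - f x)) @ (0 : R)^' --> \sum_j v 0 j * d j x.
  have E : (fun h : R => h^-1 *: ((f \o shift x) (h *: v) - f x)) =
      (fun h : R => h^-1 * (f (x + h *: v) - f x)).
    by apply/funext => h; rewrite /= [h *: v + x]addrC.
  by apply: DeriveDef; [apply/cvg_ex; exists (\sum_j v 0 j * d j x)|apply: cvg_lim => //]; rewrite E.
have main (s : seq 'I_m) : (fun h : R => h^-1 * (f (x + h *: \sum_(j <- s) v 0 j *: evec R j) - f x))
    @ (0 : R)^' --> \sum_(j <- s) v 0 j * d j x.
  elim: s => [|j s IH].
    rewrite !big_nil (_ : (fun h : R => _) = (fun=> 0)); first exact: cvg_cst.
    by apply/funext => h; rewrite scaler0 addr0 subrr mulr0.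
  rewrite !big_cons.
  have H := cvgD (@partial_increment f (d j) x (\sum_(j <- s) v 0 j *: evec R j) (v 0 j) j (dn j) (cd j)) IH.
  apply: (cvg_trans _ (H _)); apply: near_eq_cvg; near=> h.
  rewrite /= -mulrDr addrA subrK; congr (_ * (f _ - _)).
  by rewrite scalerDr scalerA -addrA; congr (_ + _); rewrite addrC.
by have := main (index_enum 'I_m); rewrite sum_evec.
Unshelve. all: by end_near. Qed.

End DirectionalDerivative.

(** * Energy estimate for the singular linear system along rays *)

Lemma is_derive_bigsum (R : realType) (I : eqType) (s : seq I) (f : I -> R -> R) (df : I -> R) (t : R) :
  (forall i, i \in s -> is_derive t 1 (f i) (df i)) ->
  is_derive t 1 (fun u => \sum_(i <- s) f i u) (\sum_(i <- s) df i).
Proof.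
elim: s => [_|i s IH H].
  rewrite big_nil (_ : (fun t => _) = (fun=> 0)); first exact: is_derive_cst.
  by apply/funext => u; rewrite big_nil.
rewrite (_ : (fun t => _) = (fun t => f i t + \sum_(i <- s) f i t)); last first.
  by apply/funext => u; rewrite big_cons.
rewrite big_cons; apply: is_deriveD; first by apply: H; rewrite mem_head.
by apply: IH => j js; apply: H; rewrite inE js orbT.
Qed.

Section Energy.
Variables (R : realType) (I A : eqType) (s : seq I) (r : seq A) (kap : A -> R).
Variables (rho : A -> I -> I) (lam : I -> R) (eps : R).
Hypothesis kap0 : forall a, a \in r -> 0 <= kap a.
Hypothesis rhoE : forall a (phi : I -> R), a \in r ->
  \sum_(i <- s) phi (rho a i) = \sum_(i <- s) phi i.
Variables (U V DU DV ru rv : I -> R -> R).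
Hypothesis cU : forall i, i \in s -> continuous (U i).
Hypothesis cV : forall i, i \in s -> continuous (V i).
Hypothesis dU : forall i (t : R), i \in s -> 0 < t < 1 -> is_derive t 1 (U i) (DU i t).
Hypothesis dV : forall i (t : R), i \in s -> 0 < t < 1 -> is_derive t 1 (V i) (DV i t).
Hypothesis eU : forall i (t : R), i \in s -> 0 < t < 1 ->
  t * DU i t = t * (lam i * V i t + ru i t) - \sum_(a <- r) kap a * (U i t - U (rho a i) t).
Hypothesis eV : forall i (t : R), i \in s -> 0 < t < 1 ->
  t * DV i t = t * (- lam i * U i t + rv i t) - \sum_(a <- r) kap a * (V i t - V (rho a i) t).
Hypothesis bu : forall i (t : R), i \in s -> 0 < t < 1 -> `|ru i t| <= eps.
Hypothesis bv : forall i (t : R), i \in s -> 0 < t < 1 -> `|rv i t| <= eps.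
Hypothesis U0 : forall i, i \in s -> U i 0 = 0.
Hypothesis V0 : forall i, i \in s -> V i 0 = 0.

(** Invariance of sums under [rho] turns each W (W - W o rho) into half a sum of squares of
    differences. *)
Let dissipation (W : I -> R) :
  0 <= \sum_(i <- s) W i * \sum_(a <- r) kap a * (W i - W (rho a i)).
Proof.
under eq_bigr do rewrite mulr_sumr.
rewrite exchange_big/= big_seq; apply: sumr_ge0 => a ar.
have E : \sum_(i <- s) W i * (kap a * (W i - W (rho a i))) =
    kap a / 2 * \sum_(i <- s) (W i - W (rho a i)) ^+ 2.
  transitivity (kap a / 2 * (\sum_(i <- s) (2 * W i ^+ 2 - 2 * (W i * W (rho a i))))).
    by rewrite mulr_sumr; apply: eq_bigr => i _; field.
  congr (_ * _); apply/eqP; rewrite -subr_eq0 -sumrB; apply/eqP.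
  rewrite (eq_bigr (fun i => W i ^+ 2 - W (rho a i) ^+ 2)); last by move=> i _; ring.
  by rewrite sumrB (@rhoE a (fun i => W i ^+ 2) ar) subrr.
rewrite E mulr_ge0// ?divr_ge0 ?kap0//.
by apply: sumr_ge0 => i _; exact: sqr_ge0.
Qed.

(** In U U' + V V' the [lam] terms cancel and the terms singular at t = 0 have a favourable sign, so
    S' <= S + c. Hence S(t) exp(-t) - c t, which is 0 at t = 0, does not increase. *)
Lemma energy_estimate :
  \sum_(i <- s) (U i 1 ^+ 2 + V i 1 ^+ 2) <= expR 1 * ((size s)%:R * (2 * eps ^+ 2)).
Proof.
pose S (t : R) := \sum_(i <- s) (U i t ^+ 2 + V i t ^+ 2).
pose DS (t : R) := \sum_(i <- s) (2 * (U i t * DU i t) + 2 * (V i t * DV i t)).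
pose c := (size s)%:R * (2 * eps ^+ 2).
pose phi (t : R) := S t * expR (- t) - c * t.
pose dphi (t : R) := (DS t - S t) * expR (- t) - c.
have c0 : 0 <= c by rewrite mulr_ge0// mulr_ge0// sqr_ge0.
have dS (t : R) : 0 < t < 1 -> is_derive t 1 S (DS t).
  move=> t01; apply: is_derive_bigsum => i is'.
  have dUi := dU is' t01; have dVi := dV is' t01.
  rewrite (_ : (fun t => _) = U i * U i + V i * V i); last by [].
  apply: is_derive_eq (is_deriveD (is_deriveM dUi dUi) (is_deriveM dVi dVi)) _.
  by rewrite /GRing.scale/=; ring.
have dphiE (t : R) : 0 < t < 1 -> is_derive t 1 phi (dphi t).
  move=> t01; have dSt := dS t t01.
  have dE : is_derive t 1 (fun u : R => expR (- u)) (- expR (- t)).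
    apply: is_derive_eq; rewrite /GRing.scale/=; ring.
  rewrite /phi /dphi.
  rewrite (_ : (fun t => _) = (S * (fun u => expR (- u)) - (c *: id))); last by [].
  apply: is_derive_eq; rewrite /GRing.scale/=; ring.
have DSle t : 0 < t < 1 -> DS t - S t <= c.
  move=> t01; have /andP[t0 _] := t01.
  have tDS : t * DS t = \sum_(i <- s) t * (2 * (U i t * ru i t) + 2 * (V i t * rv i t)) -
      2 * (\sum_(i <- s) U i t * \sum_(a <- r) kap a * (U i t - U (rho a i) t)) -
      2 * (\sum_(i <- s) V i t * \sum_(a <- r) kap a * (V i t - V (rho a i) t)).
    rewrite /DS !mulr_sumr -!sumrB big_seq [RHS]big_seq; apply: eq_bigr => i is'.
    have -> : t * (2 * (U i t * DU i t) + 2 * (V i t * DV i t)) =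
      2 * U i t * (t * DU i t) + 2 * V i t * (t * DV i t) by ring.
    by rewrite eU// eV//; ring.
  have H1 := dissipation (U ^~ t); have H2 := dissipation (V ^~ t).
  have : t * DS t <= t * \sum_(i <- s) (2 * (U i t * ru i t) + 2 * (V i t * rv i t)).
    by rewrite tDS [in leRHS]mulr_sumr; lra.
  rewrite ler_pM2l// => /le_trans H; rewrite lerBlDr; apply: H.
  (* Each index leaves at most 2 eps^2, by 2 U ru <= U^2 + ru^2 and the same for V. *)
  rewrite /c -[size s]sum1_size natr_sum mulr_suml /S -big_split/=.
  rewrite big_seq [leRHS]big_seq; apply: ler_sum => i is'.
  have h1 : ru i t ^+ 2 <= eps ^+ 2 by rewrite -real_normK ?num_real// ler_sqr ?nnegrE// ?(le_trans _ (bu is' t01))// bu.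
  have h2 : rv i t ^+ 2 <= eps ^+ 2 by rewrite -real_normK ?num_real// ler_sqr ?nnegrE// ?(le_trans _ (bv is' t01))// bv.
  have := sqr_ge0 (U i t - ru i t); have := sqr_ge0 (V i t - rv i t).
  by nra.
have dphi_le t : 0 < t < 1 -> dphi t <= 0.
  move=> t01; have /andP[t0 _] := t01.
  rewrite /dphi subr_le0; apply: (@le_trans _ _ (c * expR (- t))).
    by rewrite ler_wpM2r ?expR_ge0// DSle.
  by rewrite ler_piMr// -expR0 ler_expR oppr_le0 ltW.
have cphi : continuous phi.
  apply: continuous_funB; last by apply: continuous_funZ => u ?.
  apply: continuous_funM.
    apply: continuous_sumr => i is'.
    by apply: continuous_funD; apply: continuous_funM; [exact: cU|exact: cU|exact: cV|exact: cV].
  apply: (@continuous_funcomp _ _ _ -%R (@expR R)).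
    exact: opp_continuous.
  exact: continuous_expR.
have [u u01 E] := MVT ltr01 (fun t t01 => dphiE t t01) (continuous_subspaceT cphi).
have phi0 : phi 0 = 0.
  rewrite /phi mulr0 subr0 /S big_seq big1 ?mul0r// => i is'.
  by rewrite U0// V0// expr0n addr0.
have : phi 1 <= 0.
  by move: E; rewrite phi0 !subr0 mulr1 => ->; exact: dphi_le.
rewrite /phi mulr1 subr_le0 => H.
rewrite -/(S 1) -/c -ler_pdivrMl ?expR_gt0//.
by rewrite mulrC -expRN.
Qed.

End Energy.

(** * Real and imaginary parts *)

Section ComplexParts.
Variable R : realType.
Implicit Types (z w : R[i]) (r : R).

Lemma ReD z w : complex.Re (z + w) = complex.Re z + complex.Re w.
Proof. by case: z => a b; case: w. Qed.
Lemma ImD z w : complex.Im (z + w) = complex.Im z + complex.Im w.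
Proof. by case: z => a b; case: w. Qed.
Lemma ReN z : complex.Re (- z) = - complex.Re z.
Proof. by case: z. Qed.
Lemma ImN z : complex.Im (- z) = - complex.Im z.
Proof. by case: z. Qed.
Lemma ReZ r z : complex.Re (r%:C * z) = r * complex.Re z.
Proof. by case: z => a b; simpc. Qed.
Lemma ImZ r z : complex.Im (r%:C * z) = r * complex.Im z.
Proof. by case: z => a b; simpc. Qed.
Lemma ReMNi z : complex.Re (- 'i%R * z) = complex.Im z.
Proof. by rewrite -complexiE; case: z => a b; simpc. Qed.
Lemma ImMNi z : complex.Im (- 'i%R * z) = - complex.Re z.
Proof. by rewrite -complexiE; case: z => a b; simpc. Qed.
Lemma Re_sum (I : Type) (s : seq I) (f : I -> R[i]) :
  complex.Re (\sum_(i <- s) f i) = \sum_(i <- s) complex.Re (f i).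
Proof. by elim: s => [|i s IH]; rewrite ?big_nil// !big_cons ReD IH. Qed.
Lemma Im_sum (I : Type) (s : seq I) (f : I -> R[i]) :
  complex.Im (\sum_(i <- s) f i) = \sum_(i <- s) complex.Im (f i).
Proof. by elim: s => [|i s IH]; rewrite ?big_nil// !big_cons ImD IH. Qed.

Lemma complex_ext z w :
  complex.Re z = complex.Re w -> complex.Im z = complex.Im w -> z = w.
Proof. by case: z => a b; case: w => c d /= -> ->. Qed.

Lemma continuous_Re : continuous (fun z : R[i] => complex.Re z).
Proof.
move=> z; apply/(@cvgrPdist_lt R R R[i] (nbhs z) (nbhs_filter z)) => e e0.
have e0' : 0 < e%:C :> R[i] by rewrite ltcR.
have /(@cvgrPdist_lt _ _ _ _ (nbhs_filter z))/(_ _ e0') : (id : R[i] -> R[i]) @ z --> z by exact: cvg_id.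
apply: filterS => w /= zw.
rewrite -ltcR; apply: le_lt_trans zw.
by rewrite -ReN -ReD; exact: normc_ge_Re.
Qed.

Lemma continuous_Im : continuous (fun z : R[i] => complex.Im z).
Proof.
have -> : (fun z : R[i] => complex.Im z) = (fun z => complex.Re (- 'i%R * z)).
  by apply/funext => z; rewrite ReMNi.
apply: (@continuous_funcomp _ _ _ (fun z : R[i] => - 'i%R * z) (fun z : R[i] => complex.Re z)).
  apply: continuous_funZ => z; exact: cvg_id.
exact: continuous_Re.
Qed.

Lemma continuous_real_complex : continuous (fun r : R => r%:C : R[i]).
Proof.
move=> r; apply/cvgrPdist_lt => e e0.
have eE : e = (complex.Re e)%:C by rewrite RRe_real// gtr0_real.
have e0' : 0 < complex.Re e by rewrite -ltcR -eE.
have /cvgrPdist_lt/(_ _ e0') : (id : R -> R) @ r --> r by exact: cvg_id.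
apply: filterS => w /= zw.
rewrite eE -rmorphB/= normc_def/= expr0n addr0 sqrtr_sqr ltcR.
exact: zw.
Qed.

End ComplexParts.

(** * The Dunkl equations on the slice -ix as a real system *)

Section KernelEquation.
Variables (R : realType) (m : nat) (Rp : seq 'rV[R]_m) (kap : 'rV[R]_m -> R).
Variable E : 'rV[R[i]]_m -> 'rV[R[i]]_m -> R[i].
Hypothesis HE : dunkl_kernel Rp kap E.
Hypothesis Rp0 : forall a, a \in Rp -> a != 0.
Variable y : 'rV[R]_m.
Implicit Types (a x : 'rV[R]_m).

Definition kre x : R := complex.Re (E (minus_i x) (cvec y)).
Definition kim x : R := complex.Im (E (minus_i x) (cvec y)).

Lemma continuous_kernel : continuous (fun x : 'rV[R]_m => E (minus_i x) (cvec y)).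
Proof.
case: HE => -[cE _] _ _.
pose G (w : 'rV[R[i]]_(m + m)) := E (lsubmx w) (rsubmx w).
have -> : (fun x : 'rV[R]_m => E (minus_i x) (cvec y)) = (fun x => G (row_mx (minus_i x) (cvec y))).
  by apply/funext => x; rewrite /G row_mxKl row_mxKr.
apply: (@continuous_funcomp _ _ _ (fun x : 'rV[R]_m => row_mx (minus_i x) (cvec y)) G _ cE).
apply: continuous_mx => i j; rewrite ord1.
case: (split_ordP j) => k ->.
  have -> : (fun x : 'rV[R]_m => row_mx (minus_i x) (cvec y) 0 (lshift m k)) =
      (fun x => - 'i%R * (x 0 k)%:C).
    by apply/funext => x; rewrite row_mxEl mxE.
  apply: continuous_funZ.
  apply: (@continuous_funcomp _ _ _ (fun x : 'rV[R]_m => x 0 k) (fun r : R => r%:C : R[i])).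
    exact: coord_continuous.
  exact: continuous_real_complex.
have -> : (fun x : 'rV[R]_m => row_mx (minus_i x) (cvec y) 0 (rshift m k)) =
    (fun x => cvec y 0 k).
  by apply/funext => x; rewrite row_mxEr.
exact: continuous_cst.
Qed.

Lemma continuous_kre : continuous kre.
Proof.
by apply: (@continuous_funcomp _ _ _ _ (fun z : R[i] => complex.Re z));
  [exact: continuous_kernel|exact: continuous_Re].
Qed.

Lemma continuous_kim : continuous kim.
Proof.
by apply: (@continuous_funcomp _ _ _ _ (fun z : R[i] => complex.Im z));
  [exact: continuous_kernel|exact: continuous_Im].
Qed.

Lemma kernel_at0 : E (minus_i (0 : 'rV[R]_m)) (cvec y) = 1.
Proof.
case: HE => _ _ H; rewrite -(H (cvec y)); congr E; apply/rowP => i.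
by rewrite !mxE mulr0.
Qed.

Lemma dotv_minus_i a x : dotv (map_mx (@cplx R) a) (minus_i x) = - 'i%R * (dotv a x)%:C.
Proof.
rewrite /dotv rmorph_sum mulr_sumr; apply: eq_bigr => i _.
by rewrite !mxE rmorphM /cplx mulrCA.
Qed.

Lemma refl_minus_i a x : refl (map_mx (@cplx R) a) (minus_i x) = minus_i (refl a x).
Proof.
have aaE : dotv (map_mx (@cplx R) a) (map_mx (@cplx R) a) = (dotv a a)%:C.
  by rewrite /dotv rmorph_sum; apply: eq_bigr => i _; rewrite !mxE rmorphM.
apply/rowP => i; rewrite /refl dotvC dotv_minus_i aaE !mxE (dotvC x a).
by rewrite rmorphB/= 2!rmorphM/= fmorphV/= rmorphM/= rmorph_nat /cplx; ring.
Qed.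

Let kernel_derivable (w : 'rV[R[i]]_m) j : derivable (E ^~ (cvec y)) w (evec _ j).
Proof.
case: HE => -[_ dE] _ _.
have := dE (row_mx w (cvec y)) (lshift m j).
rewrite /derivable row_mxKl row_mxKr.
have shE (h : R[i]) : h *: evec R[i] (lshift m j) + row_mx w (cvec y) = row_mx (h *: evec _ j + w) (cvec y).
  apply/rowP => i; rewrite !mxE; case: split_ordP => k ->; rewrite !mxE ?eq_lshift//.
  by rewrite eq_rlshift andbF mulr0 add0r.
rewrite (_ : (fun h : R[i] => _) = (fun h : R[i] => h^-1 *:
  ((E ^~ (cvec y) \o shift w) (h *: evec _ j) - E w (cvec y))))//.
by apply/funext => h; rewrite /= /shift/= shE row_mxKl row_mxKr.
Qed.

(** A real increment s of x along e_j is the complex increment -is of the argument of E, whence the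
    factor -i. *)
Lemma kernel_partial x j :
  (fun s : R => (s%:C)^-1 * (E (minus_i (x + s *: evec R j)) (cvec y) - E (minus_i x) (cvec y)))
    @ (0 : R)^' --> - 'i%R * 'D_(evec _ j) (E ^~ (cvec y)) (minus_i x).
Proof.
have D := @kernel_derivable (minus_i x) j.
have D' : (fun h : R[i] => h^-1 *: ((E ^~ (cvec y) \o shift (minus_i x)) (h *: evec _ j) - E (minus_i x) (cvec y)))
  @ (0 : R[i])^' --> 'D_(evec _ j) (E ^~ (cvec y)) (minus_i x) by exact: D.
have i0 : - 'i%R != 0 :> R[i] by rewrite oppr_eq0 neq0Ci.
have lim0 : (fun s : R => - 'i%R * s%:C : R[i]) @ (0 : R)^' --> (0 : R[i])^'.
  have cs : continuous (fun s : R => - 'i%R * s%:C : R[i]).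
    by apply: continuous_funZ; exact: continuous_real_complex.
  move=> P P0.
  have P1 : \forall s \near (0 : R), - 'i%R * s%:C != 0 -> P (- 'i%R * s%:C).
    by have := @cs 0 (fun w => w != 0 -> P w); rewrite mulr0 => /(_ P0).
  change (\forall s \near (0 : R)^', P (- 'i%R * s%:C)); near=> s.
  have s0 : s != 0 by near: s; exact: nbhs_dnbhs_neq.
  have : - 'i%R * s%:C != 0 -> P (- 'i%R * s%:C) by near: s; apply: nbhs_dnbhs; exact: P1.
  by apply; rewrite mulf_neq0// (fmorph_eq0 (real_complex R)).
have C := cvg_comp _ _ lim0 D'.
have H := @cvgM _ _ _ _ _ _ _ _ (@cvg_cst _ (- 'i%R : R[i]) _ _ _) C.
apply: (cvg_trans _ (H _ _)); apply: near_eq_cvg; near=> s.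
have shE : (- 'i%R * s%:C) *: evec _ j + minus_i x = minus_i (x + s *: evec R j).
  apply/rowP => k; rewrite !mxE rmorphD rmorphM/= rmorph_nat.
  by ring.
rewrite /= shE /GRing.scale/= invfM mulrA mulrA mulfV// mul1r.
by [].
Unshelve. all: by end_near. Qed.

(** At -ix the denominators are -i <a, x>, and the -i of the chain rule cancels theirs. What remains
    has real coefficients, and y_j couples the two parts with opposite signs, like a rotation. *)
Lemma kernel_is_derive x j : (forall a, a \in Rp -> dotv a x != 0) ->
  is_derive x (evec R j) kre (y 0 j * kim x -
     \sum_(a <- Rp) kap a * a 0 j * ((kre x - kre (refl a x)) / dotv a x)) /\
  is_derive x (evec R j) kim (- y 0 j * kre x -
     \sum_(a <- Rp) kap a * a 0 j * ((kim x - kim (refl a x)) / dotv a x)).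
Proof.
move=> xreg.
have H := @kernel_partial x j.
have i0 : - 'i%R != 0 :> R[i] by rewrite oppr_eq0 neq0Ci.
have DE : - 'i%R * 'D_(evec _ j) (E ^~ (cvec y)) (minus_i x) =
   - 'i%R * ((y 0 j)%:C * E (minus_i x) (cvec y)) -
   \sum_(a <- Rp) (kap a * a 0 j / dotv a x)%:C * (E (minus_i x) (cvec y) - E (minus_i (refl a x)) (cvec y)).
  case: HE => _ /(_ (cvec y) (minus_i x) j) + _; rewrite /dunkl [cvec y 0 j]mxE => H1.
  rewrite -[X in _ * ((y 0 j)%:C * X)]/(E (minus_i x) (cvec y)) -H1 mulrDr -addrA.
  rewrite [X in _ + X](_ : _ = 0) ?addr0//.
  apply/eqP; rewrite subr_eq0 mulr_sumr; apply/eqP.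
  rewrite big_seq [RHS]big_seq; apply: eq_bigr => a aR.
  have ax0 : (dotv a x)%:C != 0 :> R[i] by rewrite (fmorph_eq0 (real_complex R)) xreg.
  rewrite dotv_minus_i mulf_eq0 (negbTE i0) (negbTE ax0)/= refl_minus_i.
  rewrite rmorphM/= rmorphM/= fmorphV/= /cplx.
  by field; rewrite ?ax0 ?neq0Ci.
have drv (f : 'rV[R]_m -> R) (d : R) (pr : R[i] -> R) : continuous pr ->
    (forall (s : R), pr ((s%:C)^-1 * (E (minus_i (x + s *: evec R j)) (cvec y) - E (minus_i x) (cvec y))) =
       s^-1 * (f (x + s *: evec R j) - f x)) ->
    pr (- 'i%R * 'D_(evec _ j) (E ^~ (cvec y)) (minus_i x)) = d ->
    is_derive x (evec R j) f d.
  move=> cpr prE <-.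
  have L : (fun h : R => h^-1 *: ((f \o shift x) (h *: evec R j) - f x)) @ (0 : R)^' -->
      pr (- 'i%R * 'D_(evec _ j) (E ^~ (cvec y)) (minus_i x)).
    have := cvg_comp _ _ H (@cpr (- 'i%R * 'D_(evec _ j) (E ^~ (cvec y)) (minus_i x))).
    apply: cvg_trans; apply: near_eq_cvg; near=> s.
    by rewrite /= prE [s *: _ + x]addrC.
  by apply: DeriveDef; [apply/cvg_ex; eexists; exact: L|exact: cvg_lim L].
have invC (s : R) : (s%:C)^-1 = (s^-1)%:C :> R[i] by rewrite fmorphV.
split.
- apply: (drv kre _ (fun z : R[i] => complex.Re z) (@continuous_Re R)).
    by move=> s; rewrite invC ReZ ReD ReN.
  rewrite DE ReD ReN ReMNi ImZ Re_sum; congr (_ - _).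
  apply: eq_bigr => a _; rewrite ReZ ReD ReN -!mulrA; congr (_ * (_ * _)).
  by rewrite mulrC.
- apply: (drv kim _ (fun z : R[i] => complex.Im z) (@continuous_Im R)).
    by move=> s; rewrite invC ImZ ImD ImN.
  rewrite DE ImD ImN ImMNi ReZ Im_sum mulNr; congr (_ - _).
  apply: eq_bigr => a _; rewrite ImZ ImD ImN -!mulrA; congr (_ * (_ * _)).
  by rewrite mulrC.
Unshelve. all: by end_near. Qed.

End KernelEquation.

(** * The kernel on the slice -ix as the sum of its homogeneous components *)

Lemma hpoly_homogeneous (R : realType) m n M (f : 'rV[R]_m -> R) (t : R) x :
  hpoly n M f -> f (t *: x) = t ^+ n * f x.
Proof.
elim=> {n M f}[c|n M v f _ IH|n M M' f g _ IH _ IH'|n M M' f MM' _ IH] //.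
- by rewrite expr0 mul1r.
- by rewrite dotvZr IH exprS; ring.
- by rewrite IH IH'; ring.
Qed.

Section ExponentialSums.
Variable R : realType.

Lemma sum_exp_coeff_le (t : R) K : 0 <= t -> \sum_(n < K) t ^+ n / n`!%:R <= expR t.
Proof.
move=> t0; rewrite -(big_mkord xpredT (fun n => t ^+ n / n`!%:R)).
have := @nondecreasing_cvgn_le R (series (exp_coeff t)) _ _ K.
apply; last exact: is_cvg_series_exp_coeff.
apply: nondecreasing_series => n _ _; exact: exp_coeff_ge0.
Qed.

Lemma exp_coeff_cvg0 (t : R) : (fun n => t ^+ n / n`!%:R) @ \oo --> (0 : R).
Proof. by have := cvg_series_cvg_0 (is_cvg_series_exp_coeff t). Qed.

Definition cre n : R := complex.Re ((- 'i%R : R[i]) ^+ n).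
Definition cim n : R := complex.Im ((- 'i%R : R[i]) ^+ n).

Lemma creS n : cre n.+1 = cim n.
Proof. by rewrite /cre exprS ReMNi. Qed.

Lemma cimS n : cim n.+1 = - cre n.
Proof. by rewrite /cim exprS ImMNi. Qed.

Lemma cre0 : cre 0 = 1. Proof. by rewrite /cre expr0. Qed.
Lemma cim0 : cim 0 = 0. Proof. by rewrite /cim expr0. Qed.

Lemma cre_cim n : cre n ^+ 2 + cim n ^+ 2 = 1.
Proof.
elim: n => [|n <-]; first by rewrite cre0 cim0 expr1n expr0n addr0.
by rewrite creS cimS sqrrN addrC.
Qed.

Lemma cre_le1 n : `|cre n| <= 1.
Proof.
by rewrite -(@expr_le1 _ 2)// real_normK ?num_real// -(cre_cim n) lerDl sqr_ge0.
Qed.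

Lemma cim_le1 n : `|cim n| <= 1.
Proof.
by rewrite -(@expr_le1 _ 2)// real_normK ?num_real// -(cre_cim n) lerDr sqr_ge0.
Qed.

End ExponentialSums.

Section KernelSeries.
Variables (R : realType) (m : nat) (Rt Rp : seq 'rV[R]_m) (kap : 'rV[R]_m -> R).
Hypothesis rsRt : root_system Rt.
Hypothesis psRp : positive_subsystem Rt Rp.
Hypothesis mkap : multiplicity Rt kap.
Variable E : 'rV[R[i]]_m -> 'rV[R[i]]_m -> R[i].
Hypothesis HE : dunkl_kernel Rp kap E.
Variable EE : nat -> 'rV[R]_m -> 'rV[R]_m -> R.
Hypothesis HT : kernel_terms Rp kap EE.
Implicit Types (a x y v : 'rV[R]_m).

Definition psum (c : nat -> R) K x y : R := \sum_(n < K) c n * EE n x y.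

Lemma continuous_psum c K y : continuous (psum c K ^~ y).
Proof.
apply: continuous_sumr => i _; apply: continuous_funZ.
by have [M /hpoly_continuous] := kt_hpoly HT i y.
Qed.

Lemma psum_bound c K x y : (forall n, `|c n| <= 1) ->
  `|psum c K x y| <= expR (enorm x * enorm y).
Proof.
move=> c1; apply: le_trans (ler_norm_sum _ _ _) _.
apply: le_trans (sum_exp_coeff_le K _); last by rewrite mulr_ge0 ?enorm_ge0.
apply: ler_sum => n _; rewrite normrM -[leRHS]mul1r ler_pM//.
exact: (kt_bound HT).
Qed.

Lemma kt_at0 n y : EE n.+1 0 y = 0.
Proof.
apply/eqP; rewrite -normr_le0; apply: le_trans (kt_bound HT _ _ _) _.
by rewrite /enorm /sqnorm dotv0l sqrtr0 mul0r expr0n mul0r.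
Qed.

Definition regular x := forall a, a \in Rt -> dotv a x != 0.

Lemma regular_gword x g : gword Rt g -> regular x -> regular (x *m g).
Proof.
move=> gg; elim: gg x => [|b h bR _ IH] x xr; first by rewrite mulmx1.
rewrite mulmxA mulmx_refl; apply: IH => a aR.
by rewrite -dotv_refll; apply: xr; exact: (root_refl rsRt).
Qed.

Lemma regularZ x (t : R) : t != 0 -> regular x -> regular (t *: x).
Proof. by move=> t0 xr a aR; rewrite dotvZr mulf_neq0// xr. Qed.

Lemma near_regular x : regular x -> \forall z \near x, regular z.
Proof.
move=> xr.
have H : \forall z \near x, forall i : 'I_(size Rt), dotv (nth 0 Rt i) z != 0.
  apply: (@filter_forall _ _ _ (nbhs x) (nbhs_filter x)) => i.
  have /xr x0 : nth 0 Rt i \in Rt by rewrite mem_nth.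
  have := @continuous_dotvr R m (nth 0 Rt i) x.
  by move=> /(@cvgr_neq0 _ _ _ (nbhs x) (nbhs_filter x)); apply.
apply: (@filterS _ (nbhs x) (nbhs_filter x) _ _ _ H) => z {}H a aR.
have ia : (index a Rt < size Rt)%N by rewrite index_mem.
by have := H (Ordinal ia); rewrite /= nth_index.
Qed.

Let reg_pos x a : regular x -> a \in Rp -> dotv a x != 0.
Proof. by move=> xr /(pos_root psRp); exact: xr. Qed.

Let quot_continuous (p : 'rV[R]_m -> R) j x (q : 'rV[R]_m -> R) (c : R) :
  continuous p -> continuous q -> regular x ->
  {for x, continuous (fun x => c * q x -
     \sum_(a <- Rp) kap a * a 0 j * ((p x - p (refl a x)) / dotv a x))}.
Proof.
move=> cp cq xr.
apply: (@cvgB _ _ _ (nbhs x)).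
  by apply: continuous_funZ.
apply: (@cvg_sumr _ _ (nbhs x)) => a aR.
apply: (@cvgM _ _ (nbhs x)); first exact: cvg_cst.
apply: (@cvgM _ _ (nbhs x)).
  apply: continuous_funB => //.
  by apply: continuous_funcomp cp; exact: continuous_refl.
apply: (@cvgV _ _ (nbhs x)); first exact: reg_pos.
exact: continuous_dotvr.
Qed.

(* Derivative along a ray: the Dunkl equations combine into t d/dt. *)
Let ray (p q : 'rV[R]_m -> R) (c : 'I_m -> R) v (t : R) :
  continuous p -> continuous q -> regular v -> 0 < t ->
  (forall x j, regular x -> is_derive x (evec R j) p (c j * q x -
     \sum_(a <- Rp) kap a * a 0 j * ((p x - p (refl a x)) / dotv a x))) ->
  exists2 d, is_derive t 1 (fun s : R => p (s *: v)) d &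
    t * d = t * ((\sum_j v 0 j * c j) * q (t *: v)) -
      \sum_(a <- Rp) kap a * (p (t *: v) - p (refl a (t *: v))).
Proof.
move=> cp cq vr t0 H.
have tr : regular (t *: v) by apply: regularZ => //; rewrite gt_eqF.
exists (\sum_j v 0 j * (c j * q (t *: v) -
     \sum_(a <- Rp) kap a * a 0 j * ((p (t *: v) - p (refl a (t *: v))) / dotv a (t *: v)))).
  rewrite (_ : (fun s : R => _) = (fun s : R => p (0 + s *: v))); last first.
    by apply/funext => s; rewrite add0r.
  apply: is_derive_line; rewrite add0r.
  apply: (@partial_is_derive R m p (fun j x => c j * q x -
     \sum_(a <- Rp) kap a * a 0 j * ((p x - p (refl a x)) / dotv a x))).
    move=> j; apply: (@filterS _ (nbhs (t *: v)) (nbhs_filter _) _ _ _ (near_regular tr)).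
    by move=> z zr; exact: H.
  by move=> j; exact: quot_continuous.
under eq_bigr do rewrite mulrBr.
rewrite sumrB mulrBr; congr (_ - _).
  by rewrite mulr_suml; congr (_ * _); apply: eq_bigr => j _; rewrite mulrA.
under eq_bigr do rewrite mulr_sumr.
rewrite exchange_big/= mulr_sumr big_seq [RHS]big_seq; apply: eq_bigr => a aR.
have av : dotv a v != 0 by exact: reg_pos.
rewrite dotvZr.
transitivity (t * (dotv a v * (kap a * ((p (t *: v) - p (refl a (t *: v))) / (t * dotv a v))))).
  by rewrite [dotv a v in RHS]/dotv !mulr_suml; congr (_ * _); apply: eq_bigr => j _; ring.
by field; rewrite av gt_eqF.
Qed.

(** A truncated series obeys the same ray equation, except that K + 1 terms on the left face K terms
    on the right: the radial recursion lowers the degree by one. *)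
Let ray_psum c c' K v y (t : R) : (forall n, c n.+1 = c' n) ->
  is_derive t 1 (fun s : R => psum c K.+1 (s *: v) y)
     (\sum_(n < K.+1) c n * (n%:R * t ^+ n.-1 * EE n v y)) /\
  t * (\sum_(n < K.+1) c n * (n%:R * t ^+ n.-1 * EE n v y)) =
    t * (dotv v y * psum c' K (t *: v) y) -
    \sum_(a <- Rp) kap a * (psum c K.+1 (t *: v) y - psum c K.+1 (refl a (t *: v)) y).
Proof.
move=> cc'.
have hom n (s : R) x : EE n (s *: x) y = s ^+ n * EE n x y.
  by have [M pM] := kt_hpoly HT n y; exact: (hpoly_homogeneous s x pM).
split.
  have -> : (fun s : R => psum c K.+1 (s *: v) y) =
      (fun s : R => \sum_(n < K.+1) (c n * EE n v y) * s ^+ n).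
    by apply/funext => s; apply: eq_bigr => n _; rewrite hom; ring.
  have -> : \sum_(n < K.+1) c n * (n%:R * t ^+ n.-1 * EE n v y) =
      \sum_(n < K.+1) (c n * EE n v y) * (n%:R * t ^+ n.-1).
    by apply: eq_bigr => n _; ring.
  apply: is_derive_bigsum => n _.
  have dX : is_derive t 1 (fun s : R => s ^+ n) (n%:R * t ^+ n.-1).
    case: n => -[|n] nK /=.
      rewrite mul0r; exact: is_derive_cst.
    rewrite (_ : (fun s : R => _) = (id : R -> R) ^+ n.+1); last first.
      by apply/funext => s; rewrite exprfctE.
    by apply: is_derive_eq; rewrite /GRing.scale/= mulr1.
  rewrite (_ : (fun s : R => _) = (c n * EE n v y) *: (fun s : R => s ^+ n)); last by [].
  exact: is_derive_eq.
have -> : \sum_(a <- Rp) kap a * (psum c K.+1 (t *: v) y - psum c K.+1 (refl a (t *: v)) y) =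
    \sum_(n < K.+1) c n * (\sum_(a <- Rp) kap a * EE n (t *: v) y -
       \sum_(a <- Rp) kap a * EE n (refl a (t *: v)) y).
  under eq_bigr do rewrite -sumrB mulr_sumr.
  rewrite exchange_big/=; apply: eq_bigr => n _; rewrite -sumrB mulr_sumr.
  by apply: eq_bigr => a _; ring.
rewrite big_ord_recl [X in _ = _ - X]big_ord_recl /= mul0r mul0r mulr0 add0r.
have -> : \sum_(a <- Rp) kap a * EE 0%N (t *: v) y - \sum_(a <- Rp) kap a * EE 0%N (refl a (t *: v)) y = 0.
  by rewrite -sumrB big1// => a _; rewrite !(kt0 HT) subrr.
rewrite mulr0 add0r /psum !mulr_sumr -sumrB; apply: eq_bigr => n _.
rewrite /= /bump leq0n add1n /=.
have := kt_radial HT n (t *: v) y; rewrite mulrDl -mulr_suml dotvZl cc' => H.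
rewrite (_ : t * (c' n * (n.+1%:R * t ^+ n * EE n.+1 v y)) = c' n * (n.+1%:R * EE n.+1 (t *: v) y)); last first.
  by rewrite hom exprS; ring.
rewrite (_ : t * (dotv v y * (c' n * EE n (t *: v) y)) = c' n * (t * dotv v y * EE n (t *: v) y)); last by ring.
by rewrite -H; ring.
Qed.

Let sum_gl Gl a (phi : 'M[R]_m -> R) : uniq Gl -> (forall g, g \in Gl <-> gword Rt g) ->
  a \in Rp -> \sum_(g <- Gl) phi (g *m refl_mx a) = \sum_(g <- Gl) phi g.
Proof.
move=> uGl memGl aR.
have inj : injective (fun g : 'M[R]_m => g *m refl_mx a).
  by move=> g h gh; rewrite -[g]mulmx1 -[h]mulmx1 -(refl_mxK a) !mulmxA gh.
have sub : {subset [seq g *m refl_mx a | g <- Gl] <= Gl}.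
  by move=> _ /mapP[g /memGl gG ->]; apply/memGl; apply: gword_r => //; exact: (pos_root psRp).
have us : uniq [seq g *m refl_mx a | g <- Gl] by rewrite map_inj_uniq.
have pm : perm_eq [seq g *m refl_mx a | g <- Gl] Gl.
  apply: uniq_perm => //.
  by have [|_ //] := uniq_min_size us sub; rewrite size_map.
by rewrite -[RHS](perm_big _ pm) big_map.
Qed.

(** The reflection terms couple the ray through x with those through its images, so the energy is
    summed over the whole orbit. *)
Let kernel_error_regular Gl x y K : uniq Gl -> (forall g, g \in Gl <-> gword Rt g) ->
  regular x ->
  (kre E y x - psum (@cre R) K.+1 x y) ^+ 2 + (kim E y x - psum (@cim R) K.+1 x y) ^+ 2 <=
  expR 1 * ((size Gl)%:R * (2 * (enorm x * enorm y * ((enorm x * enorm y) ^+ K / K`!%:R)) ^+ 2)).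
Proof.
move=> uGl memGl xr.
set ee := enorm x * enorm y.
have ee0 : 0 <= ee by rewrite mulr_ge0 ?enorm_ge0.
pose U (g : 'M[R]_m) (t : R) := kre E y (t *: (x *m g)) - psum (@cre R) K.+1 (t *: (x *m g)) y.
pose V (g : 'M[R]_m) (t : R) := kim E y (t *: (x *m g)) - psum (@cim R) K.+1 (t *: (x *m g)) y.
pose lam (g : 'M[R]_m) := dotv (x *m g) y.
(* The residuals [ru] and [rv] carry the single term of degree K that the truncation leaves
   unmatched. *)
pose ru (g : 'M[R]_m) (t : R) := lam g * (cim R K * EE K (t *: (x *m g)) y).
pose rv (g : 'M[R]_m) (t : R) := - lam g * (cre R K * EE K (t *: (x *m g)) y).
have ck : continuous (kre E y) by exact: (continuous_kre HE).
have ci : continuous (kim E y) by exact: (continuous_kim HE).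
have Rp0 a : a \in Rp -> a != 0 by exact: (pos_root_neq0 rsRt psRp).
have gr g : g \in Gl -> regular (x *m g) by move=> /memGl gG; exact: (regular_gword gG xr).
have genorm g : g \in Gl -> enorm (x *m g) = enorm x.
  by move=> /memGl gG; rewrite /enorm /sqnorm (gword_dotv _ _ gG).
have cline (f : 'rV[R]_m -> R) (v : 'rV[R]_m) : continuous f -> continuous (fun t : R => f (t *: v)).
  move=> cf; apply: (@continuous_funcomp _ _ _ (fun t : R => t *: v) f _ cf) => t.
  by apply: cvgZr_tmp; exact: cvg_id.
have bnd g (t : R) : g \in Gl -> 0 < t < 1 ->
    `|lam g| * `|EE K (t *: (x *m g)) y| <= ee * (ee ^+ K / K`!%:R).
  move=> gG /andP[t0 t1]; rewrite ler_pM//.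
    by rewrite /ee -(genorm g gG) dotv_le.
  apply: le_trans (kt_bound HT _ _ _) _; rewrite ler_wpM2r ?invr_ge0 ?ler0n//.
  have -> : enorm (t *: (x *m g)) = t * enorm x.
    rewrite -(genorm g gG) /enorm /sqnorm dotvZl dotvZr mulrA -expr2 sqrtrM ?sqr_ge0//.
    by rewrite sqrtr_sqr gtr0_norm.
  rewrite lerXn2r ?nnegrE ?mulr_ge0 ?enorm_ge0 ?(ltW t0)//.
  by rewrite -mulrA ler_piMl// ltW.
have psumS c g (t : R) : psum c K.+1 (t *: (x *m g)) y = psum c K (t *: (x *m g)) y + c K * EE K (t *: (x *m g)) y.
  by rewrite /psum big_ord_recr.
have rayU g (t : R) : g \in Gl -> 0 < t < 1 -> is_derive t 1 (U g) ('D_1 (U g) t) /\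
    t * 'D_1 (U g) t = t * (lam g * V g t + ru g t) - \sum_(a <- Rp) kap a * (U g t - U (g *m refl_mx a) t).
  move=> gG /andP[t0 _].
  have [d dk0 dE] := @ray (kre E y) (kim E y) (fun j => y 0 j) (x *m g) t ck ci (gr _ gG) t0
    (fun z j zr => (kernel_is_derive HE y j (fun a aR => reg_pos zr aR)).1).
  have [dp pE] := @ray_psum (@cre R) (@cim R) K (x *m g) y t (@creS R).
  have dd : is_derive t 1 (U g) (d - \sum_(n < K.+1) cre R n * (n%:R * t ^+ n.-1 * EE n (x *m g) y)).
    exact: is_deriveB.
  have -> : 'D_1 (U g) t = d - \sum_(n < K.+1) cre R n * (n%:R * t ^+ n.-1 * EE n (x *m g) y) by case: dd.
  split; first exact: dd.
  have lE : \sum_j (x *m g) 0 j * y 0 j = lam g by [].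
  rewrite mulrBr dE pE lE -/(lam g) /ru /V (psumS (@cim R)).
  rewrite [X in _ = _ - X](_ : _ = \sum_(a <- Rp) kap a * (kre E y (t *: (x *m g)) - kre E y (refl a (t *: (x *m g)))) -
    \sum_(a <- Rp) kap a * (psum (@cre R) K.+1 (t *: (x *m g)) y - psum (@cre R) K.+1 (refl a (t *: (x *m g))) y)).
    by ring.
  rewrite -sumrB; apply: eq_bigr => a _.
  by rewrite /U mulmxA mulmx_refl reflZr; ring.
have rayV g (t : R) : g \in Gl -> 0 < t < 1 -> is_derive t 1 (V g) ('D_1 (V g) t) /\
    t * 'D_1 (V g) t = t * (- lam g * U g t + rv g t) - \sum_(a <- Rp) kap a * (V g t - V (g *m refl_mx a) t).
  move=> gG /andP[t0 _].
  have [d dk0 dE] := @ray (kim E y) (kre E y) (fun j => - y 0 j) (x *m g) t ci ck (gr _ gG) t0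
    (fun z j zr => (kernel_is_derive HE y j (fun a aR => reg_pos zr aR)).2).
  have [dp pE] := @ray_psum (@cim R) (fun n => - cre R n) K (x *m g) y t (@cimS R).
  have dd : is_derive t 1 (V g) (d - \sum_(n < K.+1) cim R n * (n%:R * t ^+ n.-1 * EE n (x *m g) y)).
    exact: is_deriveB.
  have -> : 'D_1 (V g) t = d - \sum_(n < K.+1) cim R n * (n%:R * t ^+ n.-1 * EE n (x *m g) y) by case: dd.
  split; first exact: dd.
  have lE : \sum_j (x *m g) 0 j * - y 0 j = - lam g.
    by rewrite /lam /dotv -sumrN; apply: eq_bigr => j _; rewrite mulrN.
  have pN : psum (fun n => - cre R n) K (t *: (x *m g)) y = - psum (@cre R) K (t *: (x *m g)) y.
    by rewrite /psum -sumrN; apply: eq_bigr => n _; rewrite mulNr.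
  rewrite mulrBr dE pE lE pN -/(lam g) /rv /U (psumS (@cre R)).
  rewrite [X in _ = _ - X](_ : _ = \sum_(a <- Rp) kap a * (kim E y (t *: (x *m g)) - kim E y (refl a (t *: (x *m g)))) -
    \sum_(a <- Rp) kap a * (psum (@cim R) K.+1 (t *: (x *m g)) y - psum (@cim R) K.+1 (refl a (t *: (x *m g))) y)).
    by ring.
  rewrite -sumrB; apply: eq_bigr => a _.
  by rewrite /V mulmxA mulmx_refl reflZr; ring.
have G1 : 1%:M \in Gl by apply/memGl; exact: gword1.
have p0 c : psum c K.+1 0 y = c 0%N.
  rewrite /psum big_ord_recl (kt0 HT) mulr1 big1 ?addr0// => i _.
  by rewrite [EE _ _ _]kt_at0 mulr0.
have := @energy_estimate R _ _ Gl Rp kap (fun a g => g *m refl_mx a) lam (ee * (ee ^+ K / K`!%:R))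
  (fun a aR => kap_ge0 psRp mkap aR) (fun a phi aR => sum_gl phi uGl memGl aR)
  U V (fun g => 'D_1 (U g)) (fun g => 'D_1 (V g)) ru rv.
have H : U 1%:M 1 ^+ 2 + V 1%:M 1 ^+ 2 <= \sum_(i <- Gl) (U i 1 ^+ 2 + V i 1 ^+ 2).
  rewrite (bigD1_seq 1%:M)//= lerDl sumr_ge0// => g _.
  by rewrite addr_ge0// sqr_ge0.
move: H; rewrite {1}/U {1}/V mulmx1 scale1r => H1 H2; apply: le_trans H1 _; apply: H2.
- move=> g gG; apply: continuous_funB; first exact: cline.
  by apply: (cline (psum (@cre R) K.+1 ^~ y)); exact: continuous_psum.
- move=> g gG; apply: continuous_funB; first exact: cline.
  by apply: (cline (psum (@cim R) K.+1 ^~ y)); exact: continuous_psum.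
- by move=> g t gG t01; exact: (rayU g t gG t01).1.
- by move=> g t gG t01; exact: (rayV g t gG t01).1.
- by move=> g t gG t01; exact: (rayU g t gG t01).2.
- by move=> g t gG t01; exact: (rayV g t gG t01).2.
- move=> g t gG t01; apply: le_trans (bnd g t gG t01); rewrite /ru 2!normrM ler_wpM2l//.
  by rewrite ler_piMl// cim_le1.
- move=> g t gG t01; apply: le_trans (bnd g t gG t01); rewrite /rv 2!normrM normrN ler_wpM2l//.
  by rewrite ler_piMl// cre_le1.
- by move=> g _; rewrite /U scale0r p0 cre0 /kre (kernel_at0 HE) subrr.
- by move=> g _; rewrite /V scale0r p0 cim0 /kim (kernel_at0 HE) subrr.
Qed.

(** The vector that selects the positive roots lies on no root hyperplane, so a small move along it
    leaves every one of them. *)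
Lemma near_regular_line x : exists2 b, True &
  \forall s \near (0 : R)^', regular (x + s *: b).
Proof.
case: psRp => b [b0 _]; exists b => //.
have H : \forall s \near (0 : R)^', forall i : 'I_(size Rt), dotv (nth 0 Rt i) (x + s *: b) != 0.
  apply: filter_forall => i; set a := nth 0 Rt i.
  have aR : a \in Rt by rewrite mem_nth.
  have [ax|ax] := eqVneq (dotv a x) 0.
    near=> s; rewrite dotvDr dotvZr ax add0r mulf_neq0 ?b0//.
    by near: s; exact: nbhs_dnbhs_neq.
  apply: nbhs_dnbhs.
  have cs : (fun s : R => dotv a (x + s *: b)) @ (0 : R) --> dotv a x.
    have cl : continuous (fun s : R => dotv a (x + s *: b)).
      have -> : (fun s : R => dotv a (x + s *: b)) = (fun s => dotv a x + s * dotv a b).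
        by apply/funext => s; rewrite dotvDr dotvZr.
      apply: continuous_funD; first exact: continuous_cst.
      by apply: continuous_funM; [move=> s ?|exact: continuous_cst].
    by have := @cl 0; rewrite /continuous_at scale0r addr0.
  by move/cvgr_neq0 : cs; apply.
apply: filterS H => s H a aR.
have ia : (index a Rt < size Rt)%N by rewrite index_mem.
by have := H (Ordinal ia); rewrite /= nth_index.
Unshelve. all: by end_near. Qed.

Lemma continuous_enorm : continuous (@enorm R m).
Proof.
apply: (@continuous_funcomp _ _ _ (@sqnorm R m) (@Num.sqrt R)).
  exact: continuous_sqnorm.
exact: sqrt_continuous.
Qed.

(** Both sides are continuous in x, so the estimate passes from regular points to the hyperplanes
    along the line of [near_regular_line]. *)
Lemma kernel_error : exists C, forall x y K,
  (kre E y x - psum (@cre R) K.+1 x y) ^+ 2 + (kim E y x - psum (@cim R) K.+1 x y) ^+ 2 <=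
  C * (enorm x * enorm y * ((enorm x * enorm y) ^+ K / K`!%:R)) ^+ 2.
Proof.
have [Gl [uGl memGl]] := finite_reflection_group rsRt.
exists (expR 1 * ((size Gl)%:R * 2)) => x y K.
pose f z := expR 1 * ((size Gl)%:R * 2) * (enorm z * enorm y * ((enorm z * enorm y) ^+ K / K`!%:R)) ^+ 2 -
  ((kre E y z - psum (@cre R) K.+1 z y) ^+ 2 + (kim E y z - psum (@cim R) K.+1 z y) ^+ 2).
rewrite -subr_ge0 -/(f x).
have cX (g : 'rV[R]_m -> R) k : continuous g -> continuous (fun z => g z ^+ k).
  move=> cg; apply: (@continuous_funcomp _ _ _ g (fun r : R => r ^+ k) cg).
  exact: exprn_continuous.
have cn : continuous (fun z : 'rV[R]_m => enorm z * enorm y).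
  by apply: continuous_funM; [exact: continuous_enorm|exact: continuous_cst].
have cf : continuous f.
  apply: continuous_funB.
    apply: continuous_funZ; apply: (cX (fun z => enorm z * enorm y * ((enorm z * enorm y) ^+ K / K`!%:R))).
    apply: continuous_funM => //.
    by apply: continuous_funM; [exact: (cX (fun z => enorm z * enorm y))|exact: continuous_cst].
  apply: continuous_funD.
    apply: (cX (fun z => kre E y z - psum (@cre R) K.+1 z y)).
    apply: continuous_funB; [exact: (continuous_kre HE)|exact: continuous_psum].
  apply: (cX (fun z => kim E y z - psum (@cim R) K.+1 z y)).
  apply: continuous_funB; [exact: (continuous_kim HE)|exact: continuous_psum].
have [b _ nb] := near_regular_line x.
have cs : (fun s : R => f (x + s *: b)) @ (0 : R)^' --> f x.
  have cl : continuous (fun s : R => f (x + s *: b)).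
    apply: (@continuous_funcomp _ _ _ (fun s : R => x + s *: b) f _ cf) => s.
    apply: cvgD; first exact: cvg_cst.
    by apply: cvgZr_tmp; exact: cvg_id.
  have /continuous_withinNx := @cl 0.
  by rewrite scale0r addr0.
apply: (@cvgr_to_ge _ _ _ _ _ _ _ cs).
apply: filterS nb => s reg; rewrite subr_ge0.
by apply: le_trans (kernel_error_regular y K uGl memGl reg) _; rewrite -!mulrA.
Qed.

Lemma psum_cvg x y :
  psum (@cre R) K x y @[K --> \oo] --> kre E y x /\
  psum (@cim R) K x y @[K --> \oo] --> kim E y x.
Proof.
have [C HC] := kernel_error.
set ee := enorm x * enorm y.
have ee0 : 0 <= ee by rewrite mulr_ge0 ?enorm_ge0.
pose B K := Num.sqrt `|C| * (ee * (ee ^+ K / K`!%:R)).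
have B0 : B @ \oo --> (0 : R).
  have : B @ \oo --> Num.sqrt `|C| * (ee * 0); last by rewrite !mulr0.
  apply: cvgM; first exact: cvg_cst.
  by apply: cvgM; [exact: cvg_cst|exact: exp_coeff_cvg0].
have sq (u v K : R) : u ^+ 2 + v ^+ 2 <= C * K ^+ 2 -> 0 <= K -> `|u| <= Num.sqrt `|C| * K /\ `|v| <= Num.sqrt `|C| * K.
  move=> H K0.
  have CK : C * K ^+ 2 <= (Num.sqrt `|C| * K) ^+ 2.
    by rewrite exprMn sqr_sqrtr// ler_wpM2r ?sqr_ge0// ler_norm.
  have nn : 0 <= Num.sqrt `|C| * K by rewrite mulr_ge0// sqrtr_ge0.
  split; rewrite -(@ler_sqr _ `|_|) ?nnegrE// real_normK ?num_real//; apply: le_trans CK; apply: le_trans H.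
    by rewrite lerDl sqr_ge0.
  by rewrite lerDr sqr_ge0.
have Kp K : 0 <= ee * (ee ^+ K / K`!%:R) by rewrite mulr_ge0// mulr_ge0 ?invr_ge0 ?ler0n// exprn_ge0.
have cv (f : nat -> R) l : (forall K, `|l - f K.+1| <= B K) -> f K @[K --> \oo] --> l.
  move=> H; rewrite -(cvg_shiftS f).
  apply/cvgrPdist_lt => e e0.
  have /cvgrPdist_lt/(_ _ e0) := B0.
  apply: filterS => K; rewrite sub0r normrN; apply: le_lt_trans.
  by apply: le_trans (H K) _; exact: ler_norm.
by split; apply: cv => K; have [H1 H2] := sq _ _ _ (HC x y K) (Kp K).
Qed.

End KernelSeries.

(** * Functions of exponential growth *)

Lemma continuous_powR_norm (R : realType) (p : R) : 0 <= p -> continuous (fun s : R => `|s| `^ p).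
Proof.
rewrite le_eqVlt => /predU1P[<-|p0] s.
  (* The convention that 0 to the power 0 is 1 makes the function constant here, including at s =
     0. *)
  rewrite (_ : (fun s : R => _) = (fun=> 1)); first exact: cst_continuous.
  by apply/funext => u; rewrite powRr0.
have [->|s0] := eqVneq s 0; last first.
  apply: (@continuous_comp _ _ _ (fun s : R => `|s|) (fun s : R => s `^ p)).
    exact: norm_continuous.
  apply: differentiable_continuous; apply/derivable1_diffP.
  by apply: derivable_powR; rewrite in_itv/= andbT normr_gt0.
rewrite /continuous_at normr0 powR0 ?gt_eqF//.
apply/cvgrPdist_lt => e e0.
have /cvgrPdist_lt/(_ _ e0) := powR_cvg0 p0.
move=> H.
have cn : (fun t : R => `|t|) @ (0 : R) --> (0 : R).
  by have := @norm_continuous R R (0 : R); rewrite /continuous_at normr0.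
have H' : \forall t \near (0 : R), 0 < `|t| -> `|0 - `|t| `^ p| < e := cn _ H.
apply: filterS H' => t H'.
have [->|t0] := eqVneq t 0; first by rewrite normr0 powR0 ?gt_eqF// subrr normr0.
by apply: H'; rewrite normr_gt0.
Qed.

Section ExponentialGrowth.
Variables (R : realType) (m : nat).
Implicit Types (f g : 'rV[R]_m -> R) (x : 'rV[R]_m).

Definition ebounded (A B : R) f := forall x, `|f x| <= A * expR (B * enorm x).

(** A single class for polynomials, the weight and the kernel on the real space: closed under
    products and integrable against the Gaussian. *)
Definition egrowth f := continuous f /\ exists A B, ebounded A B f.

Lemma ebounded_ge0 A B f : ebounded A B f -> 0 <= A.
Proof.
by move=> /(_ 0)/(le_trans (normr_ge0 _)); rewrite pmulr_lge0 ?expR_gt0.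
Qed.

Lemma ebounded_le A B A' B' f : ebounded A B f -> A <= A' -> B <= B' -> ebounded A' B' f.
Proof.
move=> H AA BB x; apply: le_trans (H x) _.
by rewrite ler_pM ?expR_ge0 ?(ebounded_ge0 H)// ler_expR ler_wpM2r// enorm_ge0.
Qed.

Lemma eboundedM A B A' B' f g : ebounded A B f -> ebounded A' B' g ->
  ebounded (A * A') (B + B') (fun x => f x * g x).
Proof.
move=> Hf Hg x; rewrite normrM mulrDl expRD mulrACA.
by rewrite ler_pM.
Qed.

Lemma egrowthD f g : egrowth f -> egrowth g -> egrowth (fun x => f x + g x).
Proof.
move=> [cf [A [B Hf]]] [cg [A' [B' Hg]]]; split; first exact: continuous_funD.
exists (A + A'), (Num.max B B') => x; rewrite mulrDl.
apply: le_trans (ler_normD _ _) _; rewrite lerD//.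
  by apply: (ebounded_le Hf); rewrite // le_max lexx.
by apply: (ebounded_le Hg); rewrite // le_max lexx orbT.
Qed.

Lemma egrowthM f g : egrowth f -> egrowth g -> egrowth (fun x => f x * g x).
Proof.
move=> [cf [A [B Hf]]] [cg [A' [B' Hg]]]; split; first exact: continuous_funM.
by exists (A * A'), (B + B'); exact: eboundedM.
Qed.

Lemma egrowth_cst c : egrowth (fun=> c).
Proof.
split; first exact: continuous_cst.
by exists `|c|, 0 => x; rewrite mul0r expR0 mulr1.
Qed.

Lemma egrowthZ c f : egrowth f -> egrowth (fun x => c * f x).
Proof. by apply: egrowthM; exact: egrowth_cst. Qed.

Lemma egrowthB f g : egrowth f -> egrowth g -> egrowth (fun x => f x - g x).
Proof.
move=> Hf Hg; rewrite (_ : (fun x => _) = (fun x => f x + -1 * g x)).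
  by apply: egrowthD => //; exact: egrowthZ.
by apply/funext => x; rewrite mulN1r.
Qed.

Lemma egrowth_sum (I : eqType) (r : seq I) (f : I -> 'rV[R]_m -> R) :
  (forall i, i \in r -> egrowth (f i)) -> egrowth (fun x => \sum_(i <- r) f i x).
Proof.
elim: r => [_|i r IH H].
  rewrite (_ : (fun x => _) = (fun=> 0)); first exact: egrowth_cst.
  by apply/funext => x; rewrite big_nil.
rewrite (_ : (fun x => _) = (fun x => f i x + \sum_(i <- r) f i x)).
  apply: egrowthD; first by apply: H; rewrite mem_head.
  by apply: IH => j jr; apply: H; rewrite inE jr orbT.
by apply/funext => x; rewrite big_cons.
Qed.

Lemma egrowth_dotv v : egrowth (dotv v).
Proof.
split; first exact: continuous_dotvr.
exists 1, (enorm v) => x; rewrite mul1r; apply: le_trans (dotv_le _ _) _.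
by apply: le_trans (expR_ge1Dx _); rewrite lerDr.
Qed.

Lemma egrowth_refl a f : egrowth f -> egrowth (fun x => f (refl a x)).
Proof.
move=> [cf [A [B Hf]]]; split.
  by apply: continuous_funcomp cf; exact: continuous_refl.
by exists A, B => x; rewrite -(enorm_refl a x); exact: Hf.
Qed.

Lemma hpoly_egrowth n M f : hpoly n M f -> egrowth f.
Proof.
elim=> {n M f}[c|n M v f _ IH|n M M' f g _ IH _ IH'|n M M' f MM' _ IH] //.
- exact: egrowth_cst.
- by apply: egrowthM => //; exact: egrowth_dotv.
- exact: egrowthD.
Qed.

Lemma derive_egrowth n M f u : hpoly n M f -> egrowth ('D_u f).
Proof.
elim=> {n M f}[c|n M v f pf IH|n M M' f g pf IH pg IH'|n M M' f MM' _ IH] //.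
- rewrite (_ : 'D_u _ = (fun=> 0)); first exact: egrowth_cst.
  by apply/funext => x; rewrite derive_cst.
- have sf := hpoly_smooth pf.
  rewrite (_ : 'D_u _ = (fun x => dotv v x * 'D_u f x + dotv v u * f x)).
    apply: egrowthD; first by apply: egrowthM => //; exact: egrowth_dotv.
    by apply: egrowthZ; exact: hpoly_egrowth pf.
  by apply/funext => x; rewrite derive_mul_dotv.
- have sf := hpoly_smooth pf; have sg := hpoly_smooth pg.
  rewrite (_ : 'D_u _ = (fun x => 'D_u f x + 'D_u g x)); first exact: egrowthD.
  by apply/funext => x; rewrite derive_add.
Qed.

Lemma dquot_egrowth n M f a : a != 0 -> hpoly n M f -> egrowth (dquot a f).
Proof.
move=> a0; elim=> {n M f}[c|n M v f pf IH|n M M' f g pf IH pg IH'|n M M' f MM' _ IH] //.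
- rewrite (_ : dquot a _ = (fun=> 0)); first exact: egrowth_cst.
  by apply/funext => x; rewrite /dquot derive_cst subrr mul0r if_same.
- have sf := hpoly_smooth pf.
  rewrite (_ : dquot a _ = (fun x => dotv v x * dquot a f x + 2 * dotv v a / dotv a a * f (refl a x))).
    apply: egrowthD; first by apply: egrowthM => //; exact: egrowth_dotv.
    by apply: egrowthZ; apply: egrowth_refl; exact: hpoly_egrowth pf.
  by apply/funext => x; rewrite dquot_mul.
- have sf := hpoly_smooth pf; have sg := hpoly_smooth pg.
  rewrite (_ : dquot a _ = (fun x => dquot a f x + dquot a g x)); first exact: egrowthD.
  by apply/funext => x; rewrite dquotD.
Qed.

(* Completing the square: B r - r^2 / 2 <= B^2 - r^2 / 4. *)
Lemma ebounded_gauss A B f : ebounded A B f ->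
  gauss_bounded (A * expR (B ^+ 2)) (4^-1) (fun x => f x * gauss x).
Proof.
move=> H x; rewrite normrM (ger0_norm (expR_ge0 _)) -mulrA -expRD.
apply: (@le_trans _ _ (A * expR (B * enorm x) * gauss x)).
  by rewrite ler_wpM2r ?expR_ge0.
rewrite -mulrA -expRD ler_wpM2l ?(ebounded_ge0 H)// ler_expR -enorm_sqr -subr_ge0.
rewrite [X in 0 <= X](_ : _ = (B - enorm x / 2) ^+ 2); last by field.
exact: sqr_ge0.
Qed.

End ExponentialGrowth.

(** * Integration against the Gaussian times the weight *)

Section GaussianFunctional.
Variables (R : realType) (m : nat) (Rt Rp : seq 'rV[R]_m) (kap : 'rV[R]_m -> R).
Hypothesis rsRt : root_system Rt.
Hypothesis psRp : positive_subsystem Rt Rp.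
Hypothesis mkap : multiplicity Rt kap.
Implicit Types (a b u v x : 'rV[R]_m) (f g : 'rV[R]_m -> R).
Notation wgt := (weight Rp kap).

Let k0 a : a \in Rp -> 0 <= kap a. Proof. exact: (kap_ge0 psRp mkap). Qed.

Lemma continuous_gauss : continuous (@gauss R m).
Proof.
apply: (@continuous_funcomp _ _ _ (fun x : 'rV[R]_m => - (sqnorm x / 2)) (@expR R)).
  apply: continuous_funN; apply: continuous_funM; last exact: continuous_cst.
  exact: continuous_sqnorm.
exact: continuous_expR.
Qed.

Lemma continuous_weight : continuous wgt.
Proof.
apply: continuous_prodr => a aR.
apply: (@continuous_funcomp _ _ _ (dotv a) (fun s : R => `|s| `^ (2 * kap a))).
  exact: continuous_dotvr.
by apply: continuous_powR_norm; rewrite mulr_ge0// k0.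
Qed.

Let wB : R := \sum_(a <- Rp) 2 * kap a * enorm a.

(** Every factor is estimated by t <= exp t with t = |a| |x|. *)
Lemma weight_ebounded : ebounded 1 wB wgt.
Proof.
move=> x; rewrite mul1r /weight /wB mulr_suml expR_sum ger0_norm; last first.
  by apply: prodr_ge0 => a _; exact: powR_ge0.
rewrite big_seq [leRHS]big_seq; apply: ler_prod => a aR; rewrite powR_ge0/=.
have ka := k0 aR.
apply: (@le_trans _ _ ((expR (enorm a * enorm x)) `^ (2 * kap a))).
  apply: ge0_ler_powR; rewrite ?mulr_ge0// ?nnegrE ?expR_ge0//.
  apply: le_trans (dotv_le _ _) _; apply: le_trans (expR_ge1Dx _).
  by rewrite lerDr.
by rewrite /powR (gt_eqF (expR_gt0 _)) expRK mulrA.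
Qed.

Lemma weight_refl b x : b \in Rt -> wgt (refl b x) = wgt x.
Proof.
move=> bR; rewrite /weight.
rewrite -[RHS](big_pos_refl rsRt psRp _ bR); last first.
  by move=> a aR; rewrite dotvNl normrN (kap_opp rsRt mkap).
rewrite big_seq [RHS]big_seq; apply: eq_bigr => a /(pos_root psRp) aR.
by rewrite (kap_refl mkap)// dotv_refll.
Qed.

Lemma gauss_refl b x : gauss (refl b x) = gauss x.
Proof. by rewrite /gauss sqnorm_refl. Qed.

Definition Lam f : R := intRm (fun x => f x * (gauss x * wgt x)).

Lemma gauss_lim_weight A B (f_ : nat -> _) f :
  (forall k, continuous (f_ k)) -> (forall k, ebounded A B (f_ k)) ->
  (forall x, f_ ^~ x @ \oo --> f x) ->
  exists C, gauss_lim C 4^-1 (fun k x => f_ k x * (gauss x * wgt x))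
    (fun x => f x * (gauss x * wgt x)).
Proof.
move=> cf bf ff; exists (A * 1 * expR ((B + wB) ^+ 2)); split.
- move=> k; apply: continuous_funM => //.
  by apply: continuous_funM; [exact: continuous_gauss|exact: continuous_weight].
- move=> k x; rewrite [gauss x * _]mulrC mulrA.
  exact: (ebounded_gauss (eboundedM (bf k) weight_ebounded)).
- by move=> x; apply: cvgM; [exact: ff|exact: cvg_cst].
Qed.

Let c4 : (0 : R) < 4^-1. Proof. by rewrite invr_gt0. Qed.

Lemma egrowth_lim f : egrowth f ->
  exists C, gauss_lim C 4^-1 (fun _ x => f x * (gauss x * wgt x))
    (fun x => f x * (gauss x * wgt x)).
Proof.
move=> [cf [A [B Hf]]].
by apply: (@gauss_lim_weight A B (fun=> f)) => // x; exact: cvg_cst.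
Qed.

Lemma Lam_rint f : egrowth f -> Lam f = rint (fun x => f x * (gauss x * wgt x)).
Proof. by move=> /egrowth_lim[C H]; exact: (intRm_rint c4 H). Qed.

Lemma Lam_dct A B (f_ : nat -> _) f :
  (forall k, continuous (f_ k)) -> (forall k, ebounded A B (f_ k)) ->
  (forall x, f_ ^~ x @ \oo --> f x) -> Lam (f_ k) @[k --> \oo] --> Lam f.
Proof.
move=> cf bf ff; have [C H] := gauss_lim_weight cf bf ff.
rewrite /Lam (intRm_rint c4 H).
rewrite (_ : (fun k => _) = (fun k => rint (fun x => f_ k x * (gauss x * wgt x)))).
  exact: (rint_dct c4 H).1.
apply/funext => k; apply: Lam_rint; split => //.
by exists A, B; exact: bf.
Qed.

Lemma LamD f g : egrowth f -> egrowth g -> Lam (fun x => f x + g x) = Lam f + Lam g.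
Proof.
move=> Hf Hg; rewrite !Lam_rint//; last exact: egrowthD.
have [C HC] := egrowth_lim Hf; have [C' HC'] := egrowth_lim Hg.
rewrite -(rintD c4 c4 HC HC'); congr rint; apply/funext => x.
by rewrite mulrDl.
Qed.

Lemma LamZ c f : egrowth f -> Lam (fun x => c * f x) = c * Lam f.
Proof.
move=> Hf; rewrite !Lam_rint//; last exact: egrowthZ.
have [C HC] := egrowth_lim Hf.
rewrite -(rintZ c c4 HC); congr rint; apply/funext => x.
by rewrite -mulrA.
Qed.

Lemma LamB f g : egrowth f -> egrowth g -> Lam (fun x => f x - g x) = Lam f - Lam g.
Proof.
move=> Hf Hg; rewrite -mulN1r -LamZ// -LamD//; last exact: egrowthZ.
by congr Lam; apply/funext => x; rewrite mulN1r.
Qed.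

Lemma Lam0 : Lam (fun=> 0) = 0.
Proof.
rewrite -[RHS](mul0r (Lam (fun=> 0))) -(LamZ 0 (@egrowth_cst R m 0)).
by congr Lam; apply/funext => x; rewrite mul0r.
Qed.

Lemma Lam_sum (I : eqType) (r : seq I) (f : I -> 'rV[R]_m -> R) :
  (forall i, i \in r -> egrowth (f i)) ->
  Lam (fun x => \sum_(i <- r) f i x) = \sum_(i <- r) Lam (f i).
Proof.
elim: r => [_|i r IH H].
  rewrite big_nil -[RHS]Lam0; congr Lam.
  by apply/funext => x; rewrite big_nil.
rewrite big_cons -IH; last by move=> j jr; apply: H; rewrite inE jr orbT.
rewrite -LamD; first by congr Lam; apply/funext => x; rewrite big_cons.
  by apply: H; rewrite mem_head.
by apply: egrowth_sum => j jr; apply: H; rewrite inE jr orbT.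
Qed.

Lemma Lam_refl b f : b \in Rt -> egrowth f -> Lam (fun x => f (refl b x)) = Lam f.
Proof.
move=> bR Hf; rewrite !Lam_rint//; last exact: egrowth_refl.
have [C [cg bg _]] := egrowth_lim Hf.
rewrite -(rint_refl b c4 (cg 0%N) (bg 0%N)); congr rint; apply/funext => x.
by rewrite weight_refl// gauss_refl.
Qed.

Lemma Lam_odd b f : b \in Rt -> egrowth f -> (forall x, f (refl b x) = - f x) -> Lam f = 0.
Proof.
move=> bR Hf odd; have := Lam_refl bR Hf.
under eq_fun do rewrite odd -mulN1r.
by rewrite LamZ// mulN1r => /eqP; rewrite eq_sym -addr_eq0 -mulr2n mulrn_eq0/= => /eqP.
Qed.

End GaussianFunctional.

(** Along a line both |x|^2 and <a, x>^2 are quadratic in h, so this serves the Gaussian as well as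
    the regularized weight. *)
Lemma is_derive_quad (R : realType) (a b c : R) :
  is_derive (0 : R) 1 (fun h : R => a + h * b + h ^+ 2 * c) b.
Proof.
have H : (fun h : R => h^-1 *: (((fun h : R => a + h * b + h ^+ 2 * c) \o shift 0) (h *: 1) -
    (a + 0 * b + 0 ^+ 2 * c))) @ (0 : R)^' --> b.
  have : (fun h : R => b + h * c) @ (0 : R)^' --> b.
    rewrite -[X in _ --> X]addr0 -[X in _ --> _ + X](mul0r c).
    apply: cvgD; first exact: cvg_cst.
    apply: cvgM; last exact: cvg_cst.
    by apply: cvg_within_filter; exact: cvg_id.
  apply: cvg_trans; apply: near_eq_cvg; near=> h.
  have h0 : h != 0 by near: h; exact: nbhs_dnbhs_neq.
  by rewrite /= addr0 /GRing.scale/= mulr1; field.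
by apply: DeriveDef; [apply/cvg_ex; exists b|exact: cvg_lim H].
Unshelve. all: by end_near. Qed.

(** * Gaussian integrals without the weight, and their integration by parts *)

Section GaussianIntegral.
Variables (R : realType) (m : nat).
Implicit Types (f g : 'rV[R]_m -> R) (x : 'rV[R]_m).

Definition gint f : R := rint (fun x => f x * gauss x).

Let c4 : (0 : R) < 4^-1. Proof. by rewrite invr_gt0. Qed.

Lemma egrowth_gauss f : egrowth f -> exists C : R,
  continuous (fun x => f x * gauss x) /\ gauss_bounded C 4^-1 (fun x => f x * gauss x).
Proof.
move=> [cf [A [B Hf]]]; exists (A * expR (B ^+ 2)); split; last exact: ebounded_gauss.
by apply: continuous_funM => //; exact: continuous_gauss.
Qed.

Lemma egrowth_gauss_lim f : egrowth f -> exists C : R,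
  gauss_lim C 4^-1 (fun _ x => f x * gauss x) (fun x => f x * gauss x).
Proof. by move=> /egrowth_gauss[C [cf bf]]; exists C; exact: gauss_lim_cst. Qed.

Lemma gintD f g : egrowth f -> egrowth g -> gint (fun x => f x + g x) = gint f + gint g.
Proof.
move=> /egrowth_gauss_lim[C HC] /egrowth_gauss_lim[C' HC'].
rewrite /gint -(rintD c4 c4 HC HC'); congr rint; apply/funext => x.
by rewrite mulrDl.
Qed.

Lemma gintZ c f : egrowth f -> gint (fun x => c * f x) = c * gint f.
Proof.
move=> /egrowth_gauss_lim[C HC]; rewrite /gint -(rintZ c c4 HC); congr rint.
by apply/funext => x; rewrite -mulrA.
Qed.

Lemma gint_sum (I : eqType) (r : seq I) (f : I -> 'rV[R]_m -> R) :
  (forall i, i \in r -> egrowth (f i)) ->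
  gint (fun x => \sum_(i <- r) f i x) = \sum_(i <- r) gint (f i).
Proof.
elim: r => [_|i r IH H].
  rewrite big_nil -[RHS](mul0r (gint (fun=> 0))) -(gintZ 0 (@egrowth_cst R m 0)).
  by congr gint; apply/funext => x; rewrite big_nil mul0r.
rewrite big_cons -IH; last by move=> j jr; apply: H; rewrite inE jr orbT.
rewrite -gintD; first by congr gint; apply/funext => x; rewrite big_cons.
  by apply: H; rewrite mem_head.
by apply: egrowth_sum => j jr; apply: H; rewrite inE jr orbT.
Qed.

Lemma gint_refl b f : egrowth f -> gint (fun x => f (refl b x)) = gint f.
Proof.
move=> /egrowth_gauss[C [cf bf]]; rewrite /gint -(rint_refl b c4 cf bf).
by congr rint; apply/funext => x; rewrite gauss_refl.
Qed.

Lemma gint_dct A B (f_ : nat -> _) f :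
  (forall k, continuous (f_ k)) -> (forall k, ebounded A B (f_ k)) ->
  (forall x, f_ ^~ x @ \oo --> f x) -> gint (f_ k) @[k --> \oo] --> gint f.
Proof.
move=> cf bf ff.
apply: (@rint_dct _ _ 4^-1 (A * expR (B ^+ 2)) (fun k x => f_ k x * gauss x) _ c4 _).1; split.
- by move=> k; apply: continuous_funM => //; exact: continuous_gauss.
- by move=> k; exact: ebounded_gauss.
- by move=> x; apply: cvgM; [exact: ff|exact: cvg_cst].
Qed.

(* The integral of the divergence of (f gauss) v. *)
Lemma gint_derive f df (v : 'rV[R]_m) : egrowth f -> egrowth df ->
  (forall x, is_derive (0 : R) 1 (fun h : R => f (x + h *: v)) (df x)) ->
  gint (fun x => df x - dotv v x * f x) = 0.
Proof.
move=> ef edf dfP.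
have eD : egrowth (fun x => df x - dotv v x * f x).
  by apply: egrowthB => //; apply: egrowthM => //; exact: egrowth_dotv.
have [C [cf bf]] := egrowth_gauss ef; have [C' [cD bD]] := egrowth_gauss eD.
have mono (C1 C2 : R) (g : 'rV[R]_m -> R) : C1 <= C2 ->
    gauss_bounded C1 4^-1 g -> gauss_bounded C2 4^-1 g.
  by move=> C12 H x; apply: le_trans (H x) _; rewrite ler_wpM2r// expR_ge0.
have H1 : C <= Num.max C C' by rewrite le_max lexx.
have H2 : C' <= Num.max C C' by rewrite le_max lexx orbT.
apply: (rint_derive c4 cf (mono _ _ _ H1 bf) cD (mono _ _ _ H2 bD) (v := v)) => x.
have dg : is_derive (0 : R) 1 (fun h : R => gauss (x + h *: v)) (gauss x * - dotv v x).
  have E : (fun h : R => gauss (x + h *: v)) =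
      expR \o (fun h : R => - (sqnorm x / 2) + h * (- dotv v x) + h ^+ 2 * (- (sqnorm v / 2))).
    apply/funext => h; rewrite /gauss /=; congr expR.
    rewrite /sqnorm !(dotvDl, dotvDr, dotvZl, dotvZr) (dotvC x v).
    by field.
  rewrite E; apply: is_derive1_comp; last exact: is_derive_quad.
  by rewrite mul0r addr0 expr0n/= mul0r addr0; exact: is_derive_expR.
apply: is_derive_eq (is_deriveM (dfP x) dg) _.
by rewrite scale0r addr0 /GRing.scale/=; ring.
Qed.

End GaussianIntegral.

(** * Integration by parts against the regularized weight *)

Section RegularizedWeight.
Variables (R : realType) (m : nat) (Rt Rp : seq 'rV[R]_m) (kap : 'rV[R]_m -> R).
Hypothesis rsRt : root_system Rt.
Hypothesis psRp : positive_subsystem Rt Rp.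
Hypothesis mkap : multiplicity Rt kap.
Implicit Types (a b u v x : 'rV[R]_m) (f g : 'rV[R]_m -> R) (e : R).

Let k0 a : a \in Rp -> 0 <= kap a. Proof. exact: (kap_ge0 psRp mkap). Qed.

(** The product of (<a, x>^2 + e)^kap(a): for e > 0 differentiable also on the hyperplanes, with the
    symmetry of the weight. *)
Definition wreg e x : R := expR (\sum_(a <- Rp) kap a * ln (dotv a x ^+ 2 + e)).

(** Regularization of 1/<a, x>, arising as half the logarithmic derivative of s^2 + e at s = <a,
    x>. *)
Definition rquot e a x : R := dotv a x / (dotv a x ^+ 2 + e).

Lemma reg_gt0 e (s : R) : 0 < e -> 0 < s ^+ 2 + e.
Proof. by move=> e0; rewrite ltr_wpDl// sqr_ge0. Qed.

Lemma continuous_reg e a : continuous (fun x => dotv a x ^+ 2 + e).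
Proof.
apply: continuous_funD; last exact: continuous_cst.
rewrite (_ : (fun x => _) = (fun x => dotv a x * dotv a x)).
  by apply: continuous_funM; exact: continuous_dotvr.
by apply/funext => x; rewrite expr2.
Qed.

(** For e <= 1 the bound is uniform in e: t^2 + e <= (1 + t)^2 <= exp(2t). This is what allows e to
    tend to 0 under the integral. *)
Lemma wreg_egrowth e : 0 < e <= 1 ->
  continuous (wreg e) /\ ebounded 1 (\sum_(a <- Rp) 2 * kap a * enorm a) (wreg e).
Proof.
move=> /andP[e0 e1]; split.
  apply: (@continuous_funcomp _ _ _ _ (@expR R)); last exact: continuous_expR.
  apply: continuous_sumr => a aR; apply: continuous_funZ => x.
  apply: (@continuous_comp _ _ _ (fun x => dotv a x ^+ 2 + e) (@ln R)).
    exact: continuous_reg.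
  by apply: continuous_ln; exact: reg_gt0.
move=> x; rewrite mul1r (gtr0_norm (expR_gt0 _)) ler_expR mulr_suml.
rewrite big_seq [leRHS]big_seq; apply: ler_sum => a aR.
rewrite [2 * _]mulrC -2!mulrA ler_wpM2l ?k0//.
set t := enorm a * enorm x.
have t0 : 0 <= t by rewrite mulr_ge0// enorm_ge0.
rewrite -[leRHS]expRK ler_ln ?posrE ?expR_gt0 ?reg_gt0//.
have st : dotv a x ^+ 2 <= t ^+ 2.
  by rewrite -real_normK ?num_real// ler_sqr ?nnegrE// dotv_le.
apply: (@le_trans _ _ ((1 + t) ^+ 2)); first by nra.
by rewrite expRM_natl ler_sqr ?nnegrE ?expR_ge0// ?addr_ge0// expR_ge1Dx.
Qed.

Lemma wreg_refl e b x : b \in Rt -> wreg e (refl b x) = wreg e x.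
Proof.
move=> bR; congr expR.
rewrite -[RHS](big_pos_refl rsRt psRp _ bR); last first.
  by move=> a aR; rewrite dotvNl sqrrN (kap_opp rsRt mkap).
rewrite big_seq [RHS]big_seq; apply: eq_bigr => a /(pos_root psRp) aR.
by rewrite (kap_refl mkap)// dotv_refll.
Qed.

Lemma rquot_egrowth e a : 0 < e -> egrowth (rquot e a).
Proof.
move=> e0; split.
  move=> x; apply: (@continuous_funM _ _ (dotv a)); first exact: continuous_dotvr.
  move=> {}x; apply: (@continuous_comp _ _ _ (fun x => dotv a x ^+ 2 + e) (@GRing.inv R)).
    exact: continuous_reg.
  by apply: inv_continuous; rewrite gt_eqF// reg_gt0.
have [_ [A [B H]]] := egrowthZ e^-1 (egrowth_dotv a).
exists A, B => x; apply: le_trans (H x).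
rewrite /rquot !normrM mulrC ler_wpM2r// !normfV !gtr0_norm ?reg_gt0//.
by rewrite lef_pV2 ?posrE ?reg_gt0// lerDr sqr_ge0.
Qed.

Lemma is_derive_wreg e x v : 0 < e ->
  is_derive (0 : R) 1 (fun h : R => wreg e (x + h *: v))
    (wreg e x * \sum_(a <- Rp) 2 * (kap a * dotv a v) * rquot e a x).
Proof.
move=> e0.
have H : is_derive (0 : R) 1
    (fun h : R => \sum_(a <- Rp) kap a * ln (dotv a (x + h *: v) ^+ 2 + e))
    (\sum_(a <- Rp) 2 * (kap a * dotv a v) * rquot e a x).
  apply: is_derive_bigsum => a aR.
  have E : (fun h : R => kap a * ln (dotv a (x + h *: v) ^+ 2 + e)) =
    kap a *: (@ln R \o (fun h : R => dotv a x ^+ 2 + e + h * (2 * (dotv a x * dotv a v)) +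
      h ^+ 2 * dotv a v ^+ 2)).
    apply/funext => h; rewrite -[RHS]/(kap a * _)/=; congr (_ * ln _).
    by rewrite dotvDr dotvZr; ring.
  rewrite E.
  pose g (h : R) := dotv a x ^+ 2 + e + h * (2 * (dotv a x * dotv a v)) + h ^+ 2 * dotv a v ^+ 2.
  have g0 : g 0 = dotv a x ^+ 2 + e by rewrite /g mul0r addr0 expr0n/= mul0r addr0.
  have H1 : is_derive (g 0) 1 (@ln R) (dotv a x ^+ 2 + e)^-1.
    by rewrite g0; exact: is_derive1_ln (reg_gt0 _ e0).
  have H2 := is_derive1_comp H1 (is_derive_quad (dotv a x ^+ 2 + e) (2 * (dotv a x * dotv a v)) (dotv a v ^+ 2)).
  apply: is_derive_eq (is_deriveZ (kap a) H2) _.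
  by rewrite /GRing.scale/= /rquot; ring.
have := is_derive1_comp (is_derive_expR _) H.
by rewrite scale0r addr0.
Qed.

Lemma dquotE a f x : dotv a x * dquot a f x = f x - f (refl a x).
Proof.
rewrite /dquot; case: ifPn => [ax|/negPn/eqP ax]; first by rewrite mulrCA divff ?mulr1.
by rewrite refl_fix// ax mul0r subrr.
Qed.

(** Differentiating [wreg] yields 2 kap(a) <a, v> p [rquot]. As [rquot] is odd under the reflection
    in a, twice the integral with p is the integral with p minus its reflection, which is <a, x>
    times the difference quotient. *)
Lemma gint_dk_reg n M p v e : 0 < e <= 1 -> hpoly n M p ->
  gint (fun x => ('D_v p x - dotv v x * p x) * wreg e x) +
  \sum_(a <- Rp) kap a * dotv a v *
     gint (fun x => dquot a p x * (dotv a x * rquot e a x) * wreg e x) = 0.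
Proof.
move=> e01 pp; have /andP[e0 e1] := e01.
have [cw bw] := wreg_egrowth e01.
have ew : egrowth (wreg e) by split => //; exists 1; eexists; exact: bw.
have ep := hpoly_egrowth pp.
have edp := derive_egrowth v pp.
have eq a : egrowth (rquot e a) by exact: rquot_egrowth.
have ed := egrowth_dotv.
pose S x := \sum_(a <- Rp) 2 * (kap a * dotv a v) * rquot e a x.
have eS : egrowth S by apply: egrowth_sum => a _; exact: egrowthZ.
have epw := egrowthM ep ew.
have := @gint_derive _ _ (fun x => p x * wreg e x)
  (fun x => 'D_v p x * wreg e x + p x * (wreg e x * S x)) v epw.
move=> H.
have {H} : gint (fun x => 'D_v p x * wreg e x + p x * (wreg e x * S x) - dotv v x * (p x * wreg e x)) = 0.
  apply: H.
    by apply: egrowthD; apply: egrowthM => //; exact: egrowthM.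
  move=> x.
  have H1 : is_derive (0 : R) 1 (fun h : R => p (x + h *: v)) ('D_v p x).
    apply: is_derive_line; rewrite scale0r addr0.
    by apply: DeriveDef => //; exact: (hpoly_smooth pp).
  apply: is_derive_eq (is_deriveM H1 (is_derive_wreg x v e0)) _.
  by rewrite scale0r addr0 /GRing.scale/= /S; ring.
rewrite (_ : (fun x => _) = (fun x => ('D_v p x - dotv v x * p x) * wreg e x +
   \sum_(a <- Rp) (2 * (kap a * dotv a v)) * (p x * rquot e a x * wreg e x))); last first.
  apply/funext => x.
  have -> : \sum_(a <- Rp) (2 * (kap a * dotv a v)) * (p x * rquot e a x * wreg e x) =
      p x * (wreg e x * S x).
    by rewrite /S mulrA [RHS]mulr_sumr; apply: eq_bigr => a _; ring.
  by ring.
have e1' : egrowth (fun x => ('D_v p x - dotv v x * p x) * wreg e x).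
  by apply: egrowthM => //; apply: egrowthB => //; apply: egrowthM.
have e2 a : egrowth (fun x => p x * rquot e a x * wreg e x).
  by apply: egrowthM => //; apply: egrowthM.
rewrite gintD//; last by apply: egrowth_sum => a _; exact: egrowthZ.
rewrite gint_sum; last by move=> a _; exact: egrowthZ.
move=> H; rewrite -[RHS]H; congr (_ + _); rewrite big_seq [RHS]big_seq; apply: eq_bigr => a aR.
rewrite gintZ// [2 * _]mulrC -[RHS]mulrA; congr (_ * _).
have rE : gint (fun x => p (refl a x) * rquot e a x * wreg e x) = - gint (fun x => p x * rquot e a x * wreg e x).
  rewrite -(gint_refl a (e2 a)) -mulN1r -gintZ; last exact: (egrowth_refl a (e2 a)).
  congr gint; apply/funext => x; rewrite (wreg_refl e x (pos_root psRp aR)).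
  by rewrite /rquot dotv_refl_root sqrrN; ring.
have e3 : egrowth (fun x => p (refl a x) * rquot e a x * wreg e x).
  by apply: egrowthM => //; apply: egrowthM => //; exact: egrowth_refl.
rewrite (_ : (fun x => dquot a p x * _ * _) = (fun x => p x * rquot e a x * wreg e x +
   (-1) * (p (refl a x) * rquot e a x * wreg e x))).
  by rewrite gintD//; [rewrite gintZ// rE; ring|exact: egrowthZ].
by apply/funext => x; rewrite mulrA [dquot _ _ _ * _]mulrC dquotE; ring.
Qed.

End RegularizedWeight.

(** * Removing the regularization *)

Section GaussianAdjoint.
Variables (R : realType) (m : nat) (Rt Rp : seq 'rV[R]_m) (kap : 'rV[R]_m -> R).
Hypothesis rsRt : root_system Rt.
Hypothesis psRp : positive_subsystem Rt Rp.
Hypothesis mkap : multiplicity Rt kap.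
Implicit Types (a b u v x : 'rV[R]_m) (f g p : 'rV[R]_m -> R) (e : R).
Notation wgt := (weight Rp kap).
Notation Lam := (Lam Rp kap).
Notation wreg := (wreg Rp kap).
Notation dk := (dk Rp kap).

Let k0 a : a \in Rp -> 0 <= kap a. Proof. exact: (kap_ge0 psRp mkap). Qed.
Let Rp0 a : a \in Rp -> a != 0. Proof. exact: (pos_root_neq0 rsRt psRp). Qed.

Lemma Lam_gint f : egrowth f -> Lam f = gint (fun x => f x * wgt x).
Proof.
move=> ef; rewrite (Lam_rint psRp mkap ef); congr rint; apply/funext => x.
by rewrite [gauss x * _]mulrC mulrA.
Qed.

Let eps k : R := k.+1%:R^-1.
Let eps01 k : 0 < eps k <= 1.
Proof. by rewrite invr_gt0 ltr0n/= invf_le1// ler1n. Qed.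
Let eps_cvg : eps @ \oo --> (0 : R). Proof. exact: cvg_harmonic. Qed.

Lemma wreg_cvg x : wreg (eps k) x @[k --> \oo] --> wgt x.
Proof.
rewrite (_ : (fun k => _) = (fun k => \prod_(a <- Rp) `|dotv a x ^+ 2 + eps k| `^ kap a)); last first.
  apply/funext => k; rewrite /wreg expR_sum; apply: eq_bigr => a _.
  have /andP[e0 _] := eps01 k; have h := reg_gt0 (dotv a x) e0.
  by rewrite gtr0_norm// /powR (gt_eqF h).
rewrite (_ : wgt x = \prod_(a <- Rp) `|dotv a x ^+ 2| `^ kap a); last first.
  apply: eq_bigr => a _; rewrite powRrM; congr (_ `^ _).
  by rewrite normrX powR_mulrn.
apply: cvg_prodr => a aR.
apply: (@continuous_cvg _ _ _ _ _ (fun k => dotv a x ^+ 2 + eps k) (fun s : R => `|s| `^ kap a)).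
  by apply: continuous_powR_norm; exact: k0.
rewrite -[X in _ --> X]addr0; apply: cvgD; [exact: cvg_cst|exact: eps_cvg].
Qed.

(** The factor [rho] is either 1 or the cutoff <a, x> [rquot], which tends to 1 off the hyperplane
    and is 0 on it. *)
Lemma gint_reg_cvg f (rho : nat -> 'rV[R]_m -> R) : egrowth f ->
  (forall k, continuous (rho k)) -> (forall k x, `|rho k x| <= 1) ->
  (forall x, f x * rho k x * wreg (eps k) x @[k --> \oo] --> f x * wgt x) ->
  gint (fun x => f x * rho k x * wreg (eps k) x) @[k --> \oo] --> Lam f.
Proof.
move=> ef cr br fr; rewrite Lam_gint//.
have [cf [A [B bf]]] := ef.
apply: (@gint_dct _ _ (A * 1) (B + \sum_(a <- Rp) 2 * kap a * enorm a)
  (fun k x => f x * rho k x * wreg (eps k) x)) => [k|k|//].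
- apply: continuous_funM; first exact: continuous_funM.
  exact: (wreg_egrowth psRp mkap (eps01 k)).1.
- apply: eboundedM; last exact: (wreg_egrowth psRp mkap (eps01 k)).2.
  by move=> x; apply: le_trans (bf x); rewrite normrM ler_piMr.
Qed.

Lemma Lam_dk n M p v : hpoly n M p -> Lam (dk v p) = Lam (fun x => dotv v x * p x).
Proof.
move=> pp; have ep := hpoly_egrowth pp; have edp := derive_egrowth v pp.
have edq a : a \in Rp -> egrowth (dquot a p) by move=> aR; exact: dquot_egrowth (Rp0 aR) pp.
have evp : egrowth (fun x => dotv v x * p x) by apply: egrowthM => //; exact: egrowth_dotv.
have e1 : egrowth (fun x => 'D_v p x - dotv v x * p x) by exact: egrowthB.
have L1 : gint (fun x => ('D_v p x - dotv v x * p x) * wreg (eps k) x) @[k --> \oo]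
    --> Lam (fun x => 'D_v p x - dotv v x * p x).
  have H : gint (fun x => ('D_v p x - dotv v x * p x) * 1 * wreg (eps k) x) @[k --> \oo]
      --> Lam (fun x => 'D_v p x - dotv v x * p x).
    apply: (@gint_reg_cvg _ (fun _ _ => 1)) => //.
    - by move=> k; exact: continuous_cst.
    - by move=> k x; rewrite normr1.
    - move=> x; under eq_fun do rewrite mulr1.
      by apply: cvgM; [exact: cvg_cst|exact: wreg_cvg].
  apply: (cvg_trans _ H); apply: near_eq_cvg; apply: nearW => k.
  by congr gint; apply/funext => x; rewrite mulr1.
have L2 a : a \in Rp -> kap a * dotv a v *
    gint (fun x => dquot a p x * (dotv a x * rquot (eps k) a x) * wreg (eps k) x) @[k --> \oo]
    --> kap a * dotv a v * Lam (dquot a p).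
  (* For kap(a) = 0 the weight need not vanish on the hyperplane, where the cutoff stays 0, so
     pointwise convergence could fail; the coefficient kap(a) removes this case. *)
  move=> aR; have [ka|ka] := eqVneq (kap a) 0.
    by rewrite ka !mul0r; under eq_fun do rewrite !mul0r; exact: cvg_cst.
  apply: cvgM; first exact: cvg_cst.
  apply: gint_reg_cvg; first exact: edq.
  - move=> k; apply: continuous_funM; first exact: continuous_dotvr.
    by have /andP[e0 _] := eps01 k; case: (rquot_egrowth a e0).
  - move=> k x; have /andP[e0 _] := eps01 k; have h := reg_gt0 (dotv a x) e0.
    rewrite /rquot mulrA -expr2 ger0_norm; last by rewrite divr_ge0 ?sqr_ge0// ltW.
    by rewrite ler_pdivrMr// mul1r lerDl ltW.
  - move=> x; have [ax|ax] := eqVneq (dotv a x) 0.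
      have -> : wgt x = 0.
        rewrite /weight (big_rem a)//= ax normr0 powR0 ?mul0r//.
        by rewrite mulf_neq0// pnatr_eq0.
      rewrite mulr0; under eq_fun do rewrite ax mul0r mulr0 mul0r.
      exact: cvg_cst.
    apply: cvgM; last exact: wreg_cvg.
    rewrite -[X in _ --> X]mulr1; apply: cvgM; first exact: cvg_cst.
    rewrite -[X in _ --> X](divff (expf_neq0 2 ax)).
    under eq_fun do rewrite /rquot mulrA -expr2.
    apply: cvgM; first exact: cvg_cst.
    apply: cvgV; first exact: expf_neq0.
    rewrite -[X in _ --> X]addr0; apply: cvgD; [exact: cvg_cst|exact: eps_cvg].
have L3 : gint (fun x => ('D_v p x - dotv v x * p x) * wreg (eps k) x) +
  \sum_(a <- Rp) kap a * dotv a v *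
     gint (fun x => dquot a p x * (dotv a x * rquot (eps k) a x) * wreg (eps k) x) @[k --> \oo]
   --> Lam (fun x => 'D_v p x - dotv v x * p x) +
      \sum_(a <- Rp) kap a * dotv a v * Lam (dquot a p).
  by apply: cvgD; [exact: L1|apply: cvg_sumr].
have E : Lam (fun x => 'D_v p x - dotv v x * p x) +
   \sum_(a <- Rp) kap a * dotv a v * Lam (dquot a p) = 0.
  have L4 : (fun _ : nat => (0 : R)) @ \oo --> Lam (fun x => 'D_v p x - dotv v x * p x) +
      \sum_(a <- Rp) kap a * dotv a v * Lam (dquot a p).
    apply: (cvg_trans _ L3); apply: near_eq_cvg; apply: nearW => k.
    exact: (gint_dk_reg rsRt psRp mkap v (eps01 k) pp).
  by apply: (@cvg_unique _ _ _ _ _ _ L4) => //; exact: cvg_cst.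
move: E; rewrite (LamB psRp mkap)// => E; apply/eqP; rewrite -subr_eq0 -[X in _ == X]E; apply/eqP.
rewrite /dk [in LHS](LamD psRp mkap)//; last first.
  by apply: egrowth_sum => a aR; apply: egrowthZ; exact: edq.
rewrite (Lam_sum psRp mkap); last by move=> a aR; apply: egrowthZ; exact: edq.
rewrite addrAC; congr (_ + _); rewrite big_seq [RHS]big_seq; apply: eq_bigr => a aR.
by rewrite (LamZ psRp mkap)//; exact: edq.
Qed.

End GaussianAdjoint.

(** * Inhomogeneous polynomials, their majorants and the adjoint of T_v *)

Section InhomogeneousPolynomials.
Variables (R : realType) (m : nat) (Rt Rp : seq 'rV[R]_m) (kap : 'rV[R]_m -> R).
Hypothesis rsRt : root_system Rt.
Hypothesis psRp : positive_subsystem Rt Rp.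
Hypothesis mkap : multiplicity Rt kap.
Implicit Types (a b u v x : 'rV[R]_m) (f g p : 'rV[R]_m -> R) (P Q : {poly R}).
Notation Lam := (Lam Rp kap).
Notation dk := (dk Rp kap).
Notation dkC := (dkC Rp kap).

Let Rp0 a : a \in Rp -> a != 0. Proof. exact: (pos_root_neq0 rsRt psRp). Qed.

(* The coefficient of P in degree n bounds the norm of the component of
   degree n. *)
Inductive ipoly : {poly R} -> ('rV[R]_m -> R) -> Prop :=
| ipoly_h n M f : hpoly n M f -> ipoly (M *: 'X^n) f
| ipolyD P Q f g : ipoly P f -> ipoly Q g -> ipoly (P + Q) (fun x => f x + g x).

Lemma ipoly_ext P f g : f =1 g -> ipoly P f -> ipoly P g.
Proof. by move=> /funext ->. Qed.

Lemma ipoly_cst c : ipoly (`|c|%:P) (fun=> c).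
Proof. by rewrite -alg_polyC; exact: (ipoly_h (hpoly_cst m c)). Qed.

Lemma ipolyZ c P f : ipoly P f -> ipoly (`|c| *: P) (fun x => c * f x).
Proof.
elim=> {P f}[n M f pf|P Q f g _ IH _ IH'].
  by rewrite scalerA; apply: ipoly_h; exact: hpolyZ.
rewrite scalerDr; apply: ipoly_ext (ipolyD IH IH') => x.
by rewrite mulrDr.
Qed.

Lemma ipolyN P f : ipoly P f -> ipoly P (fun x => - f x).
Proof.
move=> /(ipolyZ (-1)); rewrite normrN1 scale1r; apply: ipoly_ext => x.
by rewrite mulN1r.
Qed.

Lemma ipoly_mul v P f : ipoly P f -> ipoly (enorm v *: ('X * P)) (fun x => dotv v x * f x).
Proof.
elim=> {P f}[n M f pf|P Q f g _ IH _ IH'].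
  by rewrite -scalerAr scalerA -exprS; apply: ipoly_h; exact: hpoly_mul.
rewrite mulrDr scalerDr; apply: ipoly_ext (ipolyD IH IH') => x.
by rewrite mulrDr.
Qed.

Lemma ipoly_smooth P f : ipoly P f -> smooth f.
Proof.
by elim=> {P f}[n M f /hpoly_smooth//|P Q f g _ IH _ IH']; exact: smoothD.
Qed.

Lemma ipoly_egrowth P f : ipoly P f -> egrowth f.
Proof.
by elim=> {P f}[n M f /hpoly_egrowth//|P Q f g _ IH _ IH']; exact: egrowthD.
Qed.

Lemma ipoly_bound P f x : ipoly P f -> `|f x| <= P.[enorm x].
Proof.
elim=> {P f}[n M f pf|P Q f g _ IH _ IH'].
  by rewrite hornerZ hornerXn; exact: hpoly_bound.
by rewrite hornerD (le_trans (ler_normD _ _))// lerD.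
Qed.

Lemma ipoly_refl a P f : ipoly P f -> ipoly P (fun x => f (refl a x)).
Proof.
elim=> {P f}[n M f pf|P Q f g _ IH _ IH']; last exact: ipolyD.
by apply: ipoly_h; exact: hpoly_refl.
Qed.

(** On majorants T_u acts as a multiple of the derivative, since the constant of [dk_hpoly] is
    linear in the degree. *)
Lemma ipoly_dk u P f : ipoly P f -> ipoly ((dkC * enorm u) *: P^`()) (dk u f).
Proof.
elim=> {P f}[[|n] M f pf|P Q f g pf IH pg IH'].
- rewrite derivZ expr0 derivC !scaler0 -[0]/(0%:P) -(normr0 R).
  by apply: ipoly_ext (ipoly_cst 0) => x; rewrite (dk_hpoly0 _ _ _ _ pf).
- rewrite derivZ derivXn scalerA -scaler_nat scalerA.
  have -> : dkC * enorm u * M * n.+1%:R = dkC * n.+1%:R * enorm u * M by ring.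
  by apply: ipoly_h; exact: (dk_hpoly rsRt psRp mkap).
- rewrite derivD scalerDr; apply: ipoly_ext (ipolyD IH IH') => x.
  by rewrite dkD//; [exact: ipoly_smooth pf|exact: ipoly_smooth pg].
Qed.

Lemma ipoly_dk_dirD P f u v x : ipoly P f -> dk (u + v) f x = dk u f x + dk v f x.
Proof.
elim=> {P f}[n M f pf|P Q f g pf IH pg IH']; first exact: (dk_dirD _ _ _ _ _ pf).
have sf := ipoly_smooth pf; have sg := ipoly_smooth pg.
by rewrite !dkD// IH IH'; ring.
Qed.

Lemma ipoly_dk_dirZ P f c u x : ipoly P f -> dk (c *: u) f x = c * dk u f x.
Proof.
elim=> {P f}[n M f pf|P Q f g pf IH pg IH']; first exact: (dk_dirZ _ _ _ _ _ pf).
have sf := ipoly_smooth pf; have sg := ipoly_smooth pg.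
by rewrite !dkD// IH IH'; ring.
Qed.

Lemma ipoly_dk_refl P f b u x : b \in Rt -> ipoly P f ->
  dk u (fun x => f (refl b x)) x = dk (refl b u) f (refl b x).
Proof.
move=> bR; elim=> {P f}[n M f pf|P Q f g pf IH pg IH'].
  exact: (dk_refl rsRt psRp mkap _ _ bR pf).
have sf := ipoly_smooth pf; have sg := ipoly_smooth pg.
have sf' := ipoly_smooth (ipoly_refl b pf); have sg' := ipoly_smooth (ipoly_refl b pg).
by rewrite (dkD _ _ _ _ sf' sg') (dkD _ _ _ _ sf sg) IH IH'.
Qed.

Lemma dquotM a f g x : smooth f -> smooth g ->
  dquot a (fun x => f x * g x) x =
  dquot a f x * g x + f x * dquot a g x - (f x - f (refl a x)) * dquot a g x.
Proof.
move=> sf sg; rewrite /dquot; case: ifPn => [ax|/negPn/eqP ax]; first by field.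
rewrite (refl_fix ax) subrr mul0r subr0 (@deriveM _ _ f g)// /GRing.scale/=.
by rewrite addrC [g x * _]mulrC.
Qed.

(* The correction to the Leibniz rule is odd under each reflection, hence
   invisible to [Lam]. *)
Lemma hpoly_Lam_dkM n M f k M' g v : hpoly n M f -> hpoly k M' g ->
  Lam (fun x => dk v f x * g x) + Lam (fun x => f x * dk v g x) =
  Lam (fun x => dotv v x * (f x * g x)).
Proof.
move=> pf pg; rewrite -(Lam_dk rsRt psRp mkap v (hpolyM pf pg)).
have sf := hpoly_smooth pf; have sg := hpoly_smooth pg.
have ef := hpoly_egrowth pf; have eg := hpoly_egrowth pg.
have edf : egrowth (dk v f) by exact: ipoly_egrowth (ipoly_dk v (ipoly_h pf)).
have edg : egrowth (dk v g) by exact: ipoly_egrowth (ipoly_dk v (ipoly_h pg)).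
have eq a : a \in Rp -> egrowth (fun x => (f x - f (refl a x)) * dquot a g x).
  move=> aR; apply: egrowthM; first by apply: egrowthB => //; exact: egrowth_refl.
  exact: dquot_egrowth (Rp0 aR) pg.
have q0 a : a \in Rp -> Lam (fun x => (f x - f (refl a x)) * dquot a g x) = 0.
  move=> aR; apply: (Lam_odd rsRt psRp mkap (pos_root psRp aR) (eq a aR)) => x.
  rewrite reflK -mulNr opprB; have [ax|ax] := eqVneq (dotv a x) 0.
    by rewrite refl_fix// subrr !mul0r.
  congr (_ * _); rewrite /dquot dotv_refl_root oppr_eq0 ax reflK.
  by rewrite invrN mulrN -mulNr opprB.
have e1 : egrowth (fun x => dk v f x * g x) by exact: egrowthM.
have e2 : egrowth (fun x => f x * dk v g x) by exact: egrowthM.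
rewrite -(LamD psRp mkap e1 e2).
have -> : dk v (fun x => f x * g x) = (fun x => (dk v f x * g x + f x * dk v g x) -
    \sum_(a <- Rp) kap a * dotv a v * ((f x - f (refl a x)) * dquot a g x)).
  apply/funext => x; rewrite /dk (@deriveM _ _ f g)// /GRing.scale/=.
  have -> : \sum_(a <- Rp) kap a * dotv a v * dquot a (fun x => f x * g x) x =
    \sum_(a <- Rp) kap a * dotv a v * dquot a f x * g x +
    \sum_(a <- Rp) kap a * dotv a v * dquot a g x * f x -
    \sum_(a <- Rp) kap a * dotv a v * ((f x - f (refl a x)) * dquot a g x).
    by rewrite -big_split/= -sumrB; apply: eq_bigr => a _; rewrite dquotM//; ring.
  by rewrite -!mulr_suml; ring.
have e3 : egrowth (fun x => \sum_(a <- Rp) kap a * dotv a v * ((f x - f (refl a x)) * dquot a g x)).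
  by apply: egrowth_sum => a aR; apply: egrowthZ; exact: eq.
rewrite (LamB psRp mkap (egrowthD e1 e2) e3).
rewrite (Lam_sum psRp mkap); last by move=> a aR; apply: egrowthZ; exact: eq.
rewrite [X in _ = _ - X]big_seq big1 ?subr0// => a aR.
by rewrite (LamZ psRp mkap) ?q0 ?mulr0//; exact: eq.
Qed.

Lemma Lam_dkM P f Q g v : ipoly P f -> ipoly Q g ->
  Lam (fun x => dk v f x * g x) + Lam (fun x => f x * dk v g x) =
  Lam (fun x => dotv v x * (f x * g x)).
Proof.
have lin f1 f2 g1 : egrowth f1 -> egrowth f2 -> egrowth g1 ->
    Lam (fun x => (f1 x + f2 x) * g1 x) = Lam (fun x => f1 x * g1 x) + Lam (fun x => f2 x * g1 x).
  move=> e1 e2 e3; rewrite -(LamD psRp mkap) ?egrowthM//; [|exact: egrowthM..].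
  by congr Lam; apply/funext => x; rewrite mulrDl.
have edk P' f' : ipoly P' f' -> egrowth (dk v f').
  by move=> H; exact: ipoly_egrowth (ipoly_dk v H).
have em f1 : egrowth f1 -> egrowth (fun x => dotv v x * f1 x).
  by move=> e1; apply: egrowthM => //; exact: egrowth_dotv.
have dkDE P1 f1 P2 f2 : ipoly P1 f1 -> ipoly P2 f2 ->
    dk v (fun x => f1 x + f2 x) = (fun x => dk v f1 x + dk v f2 x).
  by move=> p1 p2; apply/funext => x; rewrite dkD//; [exact: ipoly_smooth p1|exact: ipoly_smooth p2].
move=> pf pg; elim: pf => {P f}[n M f pf|P P' f f' pf IH pf' IH']; last first.
  have := ipoly_egrowth pf; have := ipoly_egrowth pf'; have := ipoly_egrowth pg => eg ef' ef.
  have edg := edk _ _ pg; have edf := edk _ _ pf; have edf' := edk _ _ pf'.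
  rewrite (dkDE _ _ _ _ pf pf') (lin _ _ _ edf edf' eg) (lin _ _ _ ef ef' edg).
  rewrite addrACA IH IH' -(LamD psRp mkap); [|exact/em/egrowthM..].
  by congr Lam; apply/funext => x; ring.
elim: pg => {Q g}[k M' g pg|Q Q' g g' pg IH pg' IH']; first exact: hpoly_Lam_dkM pf pg.
have eg := ipoly_egrowth pg; have eg' := ipoly_egrowth pg'; have ef := hpoly_egrowth pf.
have ef' := edk _ _ (ipoly_h pf); have edg := edk _ _ pg; have edg' := edk _ _ pg'.
have linr f1 g1 g2 : egrowth f1 -> egrowth g1 -> egrowth g2 ->
    Lam (fun x => f1 x * (g1 x + g2 x)) = Lam (fun x => f1 x * g1 x) + Lam (fun x => f1 x * g2 x).
  move=> e1 e2 e3; rewrite -(LamD psRp mkap) ?egrowthM//; [|exact: egrowthM..].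
  by congr Lam; apply/funext => x; rewrite mulrDr.
rewrite (dkDE _ _ _ _ pg pg') (linr _ _ _ ef' eg eg') (linr _ _ _ ef edg edg').
rewrite addrACA IH IH' -(LamD psRp mkap); [|exact/em/egrowthM..].
by congr Lam; apply/funext => x; ring.
Qed.

Lemma ipoly_Lam_dk P f v : ipoly P f -> Lam (dk v f) = Lam (fun x => dotv v x * f x).
Proof.
move=> pf; have := Lam_dkM v pf (ipoly_cst 1).
have -> : (fun x => f x * dk v (fun=> 1) x) = (fun=> 0).
  by apply/funext => x; rewrite dk_cst mulr0.
rewrite (Lam0 psRp mkap) addr0.
under eq_fun do rewrite mulr1.
by move=> ->; congr Lam; apply/funext => x; rewrite mulr1.
Qed.

End InhomogeneousPolynomials.

(** * Commutativity of the Dunkl operators *)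

Section Commutativity.
Variables (R : realType) (m : nat) (Rt Rp : seq 'rV[R]_m) (kap : 'rV[R]_m -> R).
Hypothesis rsRt : root_system Rt.
Hypothesis psRp : positive_subsystem Rt Rp.
Hypothesis mkap : multiplicity Rt kap.
Implicit Types (a b u v x : 'rV[R]_m) (f g p : 'rV[R]_m -> R).
Notation dk := (dk Rp kap).

(* The commutator of T_u and T_v commutes with multiplication by <w, .>: by
   T_u s_a - s_a T_u = - 2 <u, a> / <a, a> s_a T_a, the iterated commutators
   with <w, .> are symmetric in u and v. *)
Lemma hpoly_dk_comm n M f u v x : hpoly n M f -> dk u (dk v f) x = dk v (dk u f) x.
Proof.
have idk k N g w : hpoly k N g -> smooth (dk w g).
  by move=> pg; exact: ipoly_smooth (ipoly_dk rsRt psRp mkap w (ipoly_h pg)).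
move=> pf; elim: pf x => {n M f}[c|n M w f pf IH|n M M' f g pf IH pg IH'|n M M' f MM' _ IH] x //.
- have E z : dk z (fun=> c) = fun=> 0 by apply/funext => y; rewrite dk_cst.
  by rewrite !E !dk_cst.
- have sf := hpoly_smooth pf.
  have sfr a := hpoly_smooth (hpoly_refl a pf).
  pose K z a := kap a * dotv a z * (2 * dotv w a / dotv a a).
  have E z : dk z (fun x => dotv w x * f x) = (fun x => (dotv w x * dk z f x + dotv w z * f x) +
     \sum_(a <- Rp) K z a * f (refl a x)).
    by apply/funext => y; rewrite (dk_mul kap rsRt psRp).
  have E2 y z : dk y (fun x => (dotv w x * dk z f x + dotv w z * f x) +
       \sum_(a <- Rp) K z a * f (refl a x)) x =
     dotv w x * dk y (dk z f) x + dotv w y * dk z f x + dotv w z * dk y f x +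
     \sum_(a <- Rp) (K y a * dk z f (refl a x) + K z a * dk y f (refl a x)
       - K z a * (2 * dotv y a / dotv a a) * dk a f (refl a x)).
    have sz := idk _ _ _ z pf.
    rewrite dkD; first last.
    - by apply: smooth_sum => a; exact: (smoothZ (sfr a)).
    - by apply: smoothD; [exact: smooth_mul_dotv|exact: (smoothZ sf)].
    rewrite dkD; [|exact: smooth_mul_dotv|exact: smoothZ].
    rewrite (dk_mul kap rsRt psRp)// (@dkZ _ _ _ _ _ _ f _ sf) dk_sum; last by move=> a; exact: smoothZ.
    have -> : \sum_(a <- Rp) (K y a * dk z f (refl a x) + K z a * dk y f (refl a x)
       - K z a * (2 * dotv y a / dotv a a) * dk a f (refl a x)) =
       \sum_(a <- Rp) K y a * dk z f (refl a x) +
       \sum_(a <- Rp) dk y (fun x => K z a * f (refl a x)) x.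
      rewrite -big_split/= big_seq [RHS]big_seq; apply: eq_bigr => a aR.
      rewrite (@dkZ _ _ _ _ _ _ (fun x => f (refl a x)) _ (sfr a)).
      rewrite (dk_refl rsRt psRp mkap _ _ (pos_root psRp aR) pf).
      have -> : refl a y = y + (- (2 * dotv y a / dotv a a)) *: a by rewrite /refl scaleNr.
      by rewrite (dk_dirD _ _ _ _ _ pf) (dk_dirZ _ _ _ _ _ pf); ring.
    by rewrite /K; ring.
  rewrite !E !E2 IH; congr (_ + _); first by ring.
  by apply: eq_bigr => a _; rewrite /K (dotvC u a) (dotvC v a); ring.
- have sf := hpoly_smooth pf; have sg := hpoly_smooth pg.
  have E z : dk z (fun x => f x + g x) = (fun x => dk z f x + dk z g x).
    by apply/funext => y; rewrite dkD.
  have sfd z := idk _ _ _ z pf; have sgd z := idk _ _ _ z pg.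
  by rewrite !E (dkD _ _ _ _ (sfd v) (sgd v)) (dkD _ _ _ _ (sfd u) (sgd u)) IH IH'.
Qed.

Lemma dk_comm P f u v x : ipoly P f -> dk u (dk v f) x = dk v (dk u f) x.
Proof.
elim=> {P f}[n M f pf|P Q f g pf IH pg IH']; first exact: hpoly_dk_comm pf.
have sf := ipoly_smooth pf; have sg := ipoly_smooth pg.
have sfd z := ipoly_smooth (ipoly_dk rsRt psRp mkap z pf).
have sgd z := ipoly_smooth (ipoly_dk rsRt psRp mkap z pg).
have E z : dk z (fun x => f x + g x) = (fun x => dk z f x + dk z g x).
  by apply/funext => y; rewrite dkD.
by rewrite !E (dkD _ _ _ _ (sfd v) (sgd v)) (dkD _ _ _ _ (sfd u) (sgd u)) IH IH'.
Qed.

End Commutativity.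

(** * The kernel integrated against polynomials *)

Section GaussianTransform.
Variables (R : realType) (m : nat) (Rt Rp : seq 'rV[R]_m) (kap : 'rV[R]_m -> R).
Hypothesis rsRt : root_system Rt.
Hypothesis psRp : positive_subsystem Rt Rp.
Hypothesis mkap : multiplicity Rt kap.
Variable E : 'rV[R[i]]_m -> 'rV[R[i]]_m -> R[i].
Hypothesis HE : dunkl_kernel Rp kap E.
Implicit Types (a b u v x y : 'rV[R]_m) (f g p : 'rV[R]_m -> R).
Notation Lam := (Lam Rp kap).
Notation dk := (dk Rp kap).

Section Series.
Variable EE : nat -> 'rV[R]_m -> 'rV[R]_m -> R.
Hypothesis HT : kernel_terms Rp kap EE.

Lemma ipoly_kt n y : exists P, ipoly P (EE n ^~ y).
Proof. by have [M H] := kt_hpoly HT n y; eexists; exact: (ipoly_h H). Qed.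

Let ekt n y : egrowth (EE n ^~ y).
Proof. by have [P /ipoly_egrowth] := ipoly_kt n y. Qed.

Lemma kt_dkl n u x y : dk u (EE n.+1 ^~ y) x = dotv y u * EE n x y.
Proof.
rewrite (_ : (EE n.+1 ^~ y) = EE n.+1 y); last by apply/funext => z; exact: (kt_sym HT).
by rewrite (kt_dk HT) (kt_sym HT).
Qed.

Lemma kt_dkl0 u x y : dk u (EE 0 ^~ y) x = 0.
Proof.
rewrite (_ : (EE 0 ^~ y) = fun=> 1) ?dk_cst//.
by apply/funext => z; exact: (kt0 HT).
Qed.

(** [Lam] does not see reflections, so it annihilates the range of K and the radial equation keeps
    only its factor n + 1. *)
Lemma Lam_kt_radial n y : n.+1%:R * Lam (EE n.+1 ^~ y) = Lam (dk y (EE n ^~ y)).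
Proof.
have [P pE] := ipoly_kt n y; rewrite (ipoly_Lam_dk rsRt psRp mkap y pE).
have -> : (fun x => dotv y x * EE n x y) = (fun x => (n.+1%:R + \sum_(a <- Rp) kap a) * EE n.+1 x y -
    \sum_(a <- Rp) kap a * EE n.+1 (refl a x) y).
  by apply/funext => x; rewrite (kt_radial HT) dotvC.
have er a : egrowth (fun x => kap a * EE n.+1 (refl a x) y).
  by apply: egrowthZ; exact: (egrowth_refl a (ekt n.+1 y)).
rewrite (LamB psRp mkap); [|exact: egrowthZ|by apply: egrowth_sum => a _].
rewrite (LamZ psRp mkap)// (Lam_sum psRp mkap)//.
have -> : \sum_(a <- Rp) Lam (fun x => kap a * EE n.+1 (refl a x) y) =
    \sum_(a <- Rp) kap a * Lam (EE n.+1 ^~ y).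
  rewrite big_seq [RHS]big_seq; apply: eq_bigr => a aR.
  rewrite (LamZ psRp mkap); last exact: (egrowth_refl a (ekt n.+1 y)).
  by rewrite (Lam_refl rsRt psRp mkap (pos_root psRp aR) (ekt n.+1 y)).
by rewrite -mulr_suml -mulrBl addrK.
Qed.

(** With T_y E_(n+1) = |y|^2 E_n the radial identity becomes a two-step recursion with factor |y|^2
    / (n + 2). The odd terms start from 0. *)
Lemma Lam_kt y j :
  Lam (EE j.*2 ^~ y) = Lam (fun=> 1) * ((sqnorm y / 2) ^+ j / j`!%:R) /\
  Lam (EE j.*2.+1 ^~ y) = 0.
Proof.
elim: j => [|j [IH1 IH2]].
  split.
    rewrite expr0 fact0 divr1 mulr1; congr Lam; apply/funext => x.
    exact: (kt0 HT).
  have := Lam_kt_radial 0 y; rewrite mul1r => ->.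
  rewrite -[RHS](Lam0 psRp mkap); congr Lam; apply/funext => x.
  exact: kt_dkl0.
have rec n : Lam (EE n.+2 ^~ y) = n.+2%:R^-1 * (sqnorm y * Lam (EE n ^~ y)).
  apply: (@mulfI _ n.+2%:R); first by rewrite pnatr_eq0.
  rewrite Lam_kt_radial mulVKf ?pnatr_eq0// -(LamZ psRp mkap)//.
  by congr Lam; apply/funext => x; exact: kt_dkl.
rewrite doubleS; split; last by rewrite rec IH2 !mulr0.
rewrite rec IH1 exprS factS natrM -doubleS -[j.+1.*2]mul2n natrM.
by field; rewrite nat1r !pnatr_eq0 -lt0n fact_gt0.
Qed.

Lemma cre_even j : cre R j.*2 = (-1) ^+ j /\ cim R j.*2 = 0.
Proof.
elim: j => [|j [IH1 IH2]]; first by rewrite cre0 cim0.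
by rewrite doubleS !(creS, cimS) IH1 IH2 exprS mulN1r oppr0.
Qed.

Let ebounded_psum c K y : (forall n, `|c n| <= 1) -> ebounded 1 (enorm y) (psum EE c K ^~ y).
Proof. by move=> c1 x; rewrite mul1r mulrC; exact: (psum_bound HT). Qed.

Lemma Lam_kernel_cvg p y : egrowth p ->
  \sum_(n < K) cre R n * Lam (fun x => EE n x y * p x) @[K --> \oo]
    --> Lam (fun x => kre E y x * p x) /\
  \sum_(n < K) cim R n * Lam (fun x => EE n x y * p x) @[K --> \oo]
    --> Lam (fun x => kim E y x * p x).
Proof.
move=> ep.
have lin (c : nat -> R) K : \sum_(n < K) c n * Lam (fun x => EE n x y * p x) =
    Lam (fun x => psum EE c K x y * p x).
  have eE n : egrowth (fun x => EE n x y * p x) by apply: egrowthM => //; exact: ekt.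
  transitivity (Lam (fun x => \sum_(n < K) c n * (EE n x y * p x))).
    rewrite (Lam_sum psRp mkap); last by move=> n _; exact: egrowthZ.
    by apply: eq_bigr => n _; rewrite (LamZ psRp mkap).
  congr Lam; apply/funext => x; rewrite /psum mulr_suml.
  by apply: eq_bigr => n _; rewrite mulrA.
have [cp [A [B bp]]] := ep.
have lim (c : nat -> R) (k : _ -> R) : (forall n, `|c n| <= 1) -> (forall x, psum EE c K x y @[K --> \oo] --> k x) ->
    \sum_(n < K) c n * Lam (fun x => EE n x y * p x) @[K --> \oo] --> Lam (fun x => k x * p x).
  move=> c1 ck.
  apply: (@cvg_trans _ (Lam (fun x => psum EE c K x y * p x) @[K --> \oo])).
    by apply: near_eq_cvg; apply: nearW => K; rewrite lin.
  apply: (@Lam_dct _ _ _ _ _ psRp mkap (1 * A) (enorm y + B) (fun K x => psum EE c K x y * p x)).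
  - by move=> K; apply: continuous_funM => //; exact: (continuous_psum HT).
  - by move=> K; apply: eboundedM => //; exact: ebounded_psum.
  - by move=> x; apply: cvgM; [exact: ck|exact: cvg_cst].
split; apply: lim; [exact: cre_le1| |exact: cim_le1|] => x.
  exact: (psum_cvg rsRt psRp mkap HE HT x y).1.
exact: (psum_cvg rsRt psRp mkap HE HT x y).2.
Qed.

Lemma Lam_kernel1_series y :
  Lam (kre E y) = Lam (fun=> 1) * gauss y /\ Lam (kim E y) = 0.
Proof.
have [H1 H2] := Lam_kernel_cvg y (@egrowth_cst R m 1).
have E1 (k : 'rV[R]_m -> R) : (fun x => k x * 1) = k by apply/funext => x; rewrite mulr1.
rewrite !E1 in H1 H2.
have S (c : nat -> R) J : \sum_(n < J.*2) c n * Lam (fun x => EE n x y * 1) =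
    Lam (fun=> 1) * \sum_(0 <= j < J) c j.*2 * ((sqnorm y / 2) ^+ j / j`!%:R).
  elim: J => [|J IH]; first by rewrite big_ord0 big_geq// mulr0.
  rewrite doubleS !big_ord_recr/= IH big_nat_recr//= mulrDr.
  have [-> ->] : Lam (fun x => EE J.*2 x y * 1) = Lam (fun=> 1) * ((sqnorm y / 2) ^+ J / J`!%:R) /\
     Lam (fun x => EE J.*2.+1 x y * 1) = 0 by rewrite !E1; exact: Lam_kt.
  by rewrite mulr0 addr0 [c _ * _]mulrCA.
(* The full series is known to converge, so truncations at even order determine the limit; in them
   only the even terms contribute. *)
have sub (u : nat -> R) (l : R) : u @ \oo --> l -> u (J.*2) @[J --> \oo] --> l.
  move=> ul; apply: (@cvg_comp _ _ _ (fun J : nat => J.*2) u _ _ _ _ ul).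
  rewrite (_ : (fun J => _) = (fun J => 2 * J)%N); last by apply/funext => J; rewrite mul2n.
  exact: cvg_mulnl.
have {}H1 := sub _ _ H1; have {}H2 := sub _ _ H2.
split.
  apply: (@cvg_unique _ _ _ _ _ _ H1) => //.
  apply: (@cvg_trans _ (Lam (fun=> 1) * series (exp_coeff (- (sqnorm y / 2))) J @[J --> \oo])).
    apply: near_eq_cvg; apply: nearW => J; rewrite S; congr (_ * _).
    apply: eq_bigr => j _; rewrite (cre_even j).1 /exp_coeff/= mulrA.
    by rewrite -exprMn mulN1r.
  by apply: cvgM; [exact: cvg_cst|exact: is_cvg_series_exp_coeff].
apply: (@cvg_unique _ _ _ _ _ _ H2) => //.
apply: (@cvg_trans _ ((fun _ : nat => (0 : R)) @ \oo)); last exact: cvg_cst.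
apply: near_eq_cvg; apply: nearW => J; rewrite S big1 ?mulr0// => j _.
by rewrite (cre_even j).2 mul0r.
Qed.

(** [Lam_dkM] applies to polynomials, not to the kernel, so the adjunction is done termwise. T_v
    lowers E_n to <y, v> E_(n-1), and the shift of index costs a factor -i. *)
Lemma Lam_kernel_mul_series P p v y : ipoly P p ->
  Lam (fun x => kre E y x * (dotv v x * p x)) =
    Lam (fun x => kre E y x * dk v p x) + dotv y v * Lam (fun x => kim E y x * p x) /\
  Lam (fun x => kim E y x * (dotv v x * p x)) =
    Lam (fun x => kim E y x * dk v p x) - dotv y v * Lam (fun x => kre E y x * p x).
Proof.
move=> pp; have ep := ipoly_egrowth pp.
have edp : egrowth (dk v p) := ipoly_egrowth (ipoly_dk rsRt psRp mkap v pp).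
have evp : egrowth (fun x => dotv v x * p x) by apply: egrowthM => //; exact: egrowth_dotv.
have [L1 L1'] := Lam_kernel_cvg y evp.
have [L2 L2'] := Lam_kernel_cvg y edp.
have [L3 L3'] := Lam_kernel_cvg y ep.
have T n : Lam (fun x => EE n x y * (dotv v x * p x)) =
    Lam (fun x => dk v (EE n ^~ y) x * p x) + Lam (fun x => EE n x y * dk v p x).
  have [Q pQ] := ipoly_kt n y; rewrite (Lam_dkM rsRt psRp mkap v pQ pp).
  by congr Lam; apply/funext => x; ring.
have S (c c' : nat -> R) K : (forall n, c n.+1 = c' n) ->
    \sum_(n < K.+1) c n * Lam (fun x => EE n x y * (dotv v x * p x)) =
    \sum_(n < K.+1) c n * Lam (fun x => EE n x y * dk v p x) +
    dotv y v * \sum_(n < K) c' n * Lam (fun x => EE n x y * p x).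
  move=> cc'.
  have -> : \sum_(n < K.+1) c n * Lam (fun x => EE n x y * (dotv v x * p x)) =
    \sum_(n < K.+1) c n * Lam (fun x => EE n x y * dk v p x) +
    \sum_(n < K.+1) c n * Lam (fun x => dk v (EE n ^~ y) x * p x).
    by rewrite -big_split/=; apply: eq_bigr => n _; rewrite T addrC mulrDr.
  congr (_ + _); rewrite big_ord_recl/=.
  have -> : Lam (fun x => dk v (EE 0 ^~ y) x * p x) = 0.
    rewrite -[RHS](Lam0 psRp mkap); congr Lam; apply/funext => x.
    by rewrite kt_dkl0 mul0r.
  rewrite mulr0 add0r mulr_sumr; apply: eq_bigr => n _.
  rewrite /bump/= add1n cc' mulrCA; congr (_ * _).
  rewrite -(LamZ psRp mkap); last by apply: egrowthM => //; exact: ekt.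
  by congr Lam; apply/funext => x; rewrite kt_dkl mulrA.
have sh (u : nat -> R) (l : R) : u @ \oo --> l -> u (K.+1) @[K --> \oo] --> l.
  by move=> ul; rewrite (cvg_shiftS u).
split.
  apply: (@cvg_unique _ _ _ _ _ _ (sh _ _ L1)) => //.
  apply: (@cvg_trans _ (\sum_(n < K.+1) cre R n * Lam (fun x => EE n x y * dk v p x) +
    dotv y v * \sum_(n < K) cim R n * Lam (fun x => EE n x y * p x) @[K --> \oo])).
    by apply: near_eq_cvg; apply: nearW => K; rewrite (S _ (@cim R))// => n; rewrite creS.
  apply: cvgD; first exact: (sh _ _ L2).
  by apply: cvgM; [exact: cvg_cst|exact: L3'].
apply: (@cvg_unique _ _ _ _ _ _ (sh _ _ L1')) => //.
apply: (@cvg_trans _ (\sum_(n < K.+1) cim R n * Lam (fun x => EE n x y * dk v p x) -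
  dotv y v * \sum_(n < K) cre R n * Lam (fun x => EE n x y * p x) @[K --> \oo])).
  apply: near_eq_cvg; apply: nearW => K.
  rewrite (S _ (fun n => - cre R n)); last by move=> n; rewrite cimS.
  congr (_ + _); rewrite -mulrN -sumrN; congr (_ * _); apply: eq_bigr => n _.
  by rewrite mulNr.
apply: cvgB; first exact: (sh _ _ L2').
by apply: cvgM; [exact: cvg_cst|exact: L3].
Qed.

End Series.

Lemma Lam_kernel1 y : Lam (kre E y) = Lam (fun=> 1) * gauss y /\ Lam (kim E y) = 0.
Proof.
by have [EE HT] := kernel_terms_exist rsRt psRp mkap; exact: (Lam_kernel1_series HT).
Qed.

Lemma Lam_kernel_mul P p v y : ipoly P p ->
  Lam (fun x => kre E y x * (dotv v x * p x)) =
    Lam (fun x => kre E y x * dk v p x) + dotv y v * Lam (fun x => kim E y x * p x) /\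
  Lam (fun x => kim E y x * (dotv v x * p x)) =
    Lam (fun x => kim E y x * dk v p x) - dotv y v * Lam (fun x => kre E y x * p x).
Proof.
by have [EE HT] := kernel_terms_exist rsRt psRp mkap; exact: (Lam_kernel_mul_series HT).
Qed.

(** The definition of the kernel gives no growth estimate; exp(|x| |y|) is inherited from the
    partial sums. *)
Lemma kernel_egrowth y : egrowth (kre E y) /\ egrowth (kim E y).
Proof.
have [EE HT] := kernel_terms_exist rsRt psRp mkap.
split; split; [exact: (continuous_kre HE)| |exact: (continuous_kim HE)|];
  exists 1, (enorm y) => x; rewrite mul1r mulrC.
  apply: (@cvgr_to_le _ \oo _ _ (fun K => `|psum EE (@cre R) K x y|)).
    by apply: cvg_norm; exact: (psum_cvg rsRt psRp mkap HE HT x y).1.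
  by apply: nearW => K; apply: (psum_bound HT); exact: cre_le1.
apply: (@cvgr_to_le _ \oo _ _ (fun K => `|psum EE (@cim R) K x y|)).
  by apply: cvg_norm; exact: (psum_cvg rsRt psRp mkap HE HT x y).2.
by apply: nearW => K; apply: (psum_bound HT); exact: cim_le1.
Qed.

End GaussianTransform.

(** * Polynomials paired with their Dunkl-Hermite transforms *)

Section Hermite.
Variables (R : realType) (m : nat) (Rt Rp : seq 'rV[R]_m) (kap : 'rV[R]_m -> R).
Hypothesis rsRt : root_system Rt.
Hypothesis psRp : positive_subsystem Rt Rp.
Hypothesis mkap : multiplicity Rt kap.
Implicit Types (a b u v x y z : 'rV[R]_m) (f g p h : 'rV[R]_m -> R).
Notation dk := (dk Rp kap).

Lemma dkN u f x : smooth f -> dk u (fun y => - f y) x = - dk u f x.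
Proof.
move=> sf; rewrite -mulN1r -(@dkZ _ _ _ _ _ _ f _ sf).
by rewrite (_ : (fun y => - f y) = (fun y => -1 * f y))//; apply/funext => y; rewrite mulN1r.
Qed.

Lemma dkB u f g x : smooth f -> smooth g ->
  dk u (fun y => f y - g y) x = dk u f x - dk u g x.
Proof.
move=> sf sg.
have sN : smooth (fun y => - g y) by move=> y v; apply: derivableN; exact: sg.
by rewrite (dkD _ _ _ _ sf sN) dkN.
Qed.

(* [herm d p h1 h2]: the Dunkl transform of p gauss is (h1 + i h2) gauss; the
   rule [herm_mul] is h |-> - i (<v, .> - T_v) h. *)
Inductive herm : nat -> ('rV[R]_m -> R) -> ('rV[R]_m -> R) -> ('rV[R]_m -> R) -> Prop :=
| herm_cst c : herm 0 (fun=> c) (fun=> c) (fun=> 0)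
| herm_mul d v p h1 h2 : herm d p h1 h2 ->
    herm d.+1 (fun x => dotv v x * p x) (fun y => dotv v y * h2 y - dk v h2 y)
      (fun y => dk v h1 y - dotv v y * h1 y)
| hermD d p h1 h2 p' h1' h2' : herm d p h1 h2 -> herm d p' h1' h2' ->
    herm d (fun x => p x + p' x) (fun x => h1 x + h1' x) (fun x => h2 x + h2' x)
| hermS d p h1 h2 : herm d p h1 h2 -> herm d.+1 p h1 h2.

Lemma herm_ext d p h1 h2 p' h1' h2' : p =1 p' -> h1 =1 h1' -> h2 =1 h2' ->
  herm d p h1 h2 -> herm d p' h1' h2'.
Proof. by move=> /funext -> /funext -> /funext ->. Qed.

Lemma herm_le d d' p h1 h2 : (d <= d')%N -> herm d p h1 h2 -> herm d' p h1 h2.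
Proof.
elim: d' => [|d' IH]; first by rewrite leqn0 => /eqP ->.
rewrite leq_eqVlt => /predU1P[->//|]; rewrite ltnS => dd' H.
exact: hermS (IH dd' H).
Qed.

Lemma herm_ipoly d p h1 h2 : herm d p h1 h2 ->
  [/\ exists P, ipoly P p, exists P, ipoly P h1 & exists P, ipoly P h2].
Proof.
elim=> {d p h1 h2}[c|d v p h1 h2 _ [[P Hp] [P1 H1] [P2 H2]]|
  d p h1 h2 p' h1' h2' _ [[P Hp] [P1 H1] [P2 H2]] _ [[P' Hp'] [P1' H1'] [P2' H2']]|d p h1 h2 _ //].
- by split; eexists; exact: ipoly_cst.
- split; first by exists (enorm v *: ('X * P)); exact: (ipoly_mul v Hp).
    eexists; apply: ipolyD (ipoly_mul v H2) _.
    by apply: ipolyN; exact: (ipoly_dk rsRt psRp mkap v H2).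
  eexists; apply: ipolyD (ipoly_dk rsRt psRp mkap v H1) _.
  by apply: ipolyN; exact: (ipoly_mul v H1).
- by split; eexists; apply: ipolyD; eassumption.
Qed.

Let herm_smooth d p h1 h2 : herm d p h1 h2 -> [/\ smooth p, smooth h1 & smooth h2].
Proof.
by move=> /herm_ipoly[[P /ipoly_smooth Hp] [P1 /ipoly_smooth H1] [P2 /ipoly_smooth H2]].
Qed.

Lemma hermZ d p h1 h2 c : herm d p h1 h2 ->
  herm d (fun x => c * p x) (fun x => c * h1 x) (fun x => c * h2 x).
Proof.
elim=> {d p h1 h2}[c'|d v p h1 h2 H IH|d p h1 h2 p' h1' h2' _ IH _ IH'|d p h1 h2 _ IH].
- by apply: herm_ext (herm_cst (c * c')) => x //; rewrite mulr0.
- have [_ s1 s2] := herm_smooth H.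
  apply: herm_ext (herm_mul v IH) => x; first by ring.
    by rewrite (@dkZ _ _ _ _ _ _ h2 _ s2); ring.
  by rewrite (@dkZ _ _ _ _ _ _ h1 _ s1); ring.
- by apply: herm_ext (hermD IH IH') => x; rewrite mulrDr.
- exact: hermS.
Qed.

Lemma herm_sum d (I : eqType) (r : seq I) (p h1 h2 : I -> 'rV[R]_m -> R) :
  (forall i, i \in r -> herm d (p i) (h1 i) (h2 i)) ->
  herm d (fun x => \sum_(i <- r) p i x) (fun x => \sum_(i <- r) h1 i x)
    (fun x => \sum_(i <- r) h2 i x).
Proof.
elim: r => [_|i r IH H].
  by apply: herm_ext (herm_le (leq0n d) (herm_cst 0)) => x; rewrite big_nil.
have H1 := H i (mem_head _ _).
have H2 := IH (fun j jr => H j (mem_behead (s := i :: r) jr)).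
by apply: herm_ext (hermD H1 H2) => x; rewrite big_cons.
Qed.

Lemma herm_refl d p h1 h2 b : b \in Rt -> herm d p h1 h2 ->
  herm d (fun x => p (refl b x)) (fun x => h1 (refl b x)) (fun x => h2 (refl b x)).
Proof.
move=> bR.
elim=> {d p h1 h2}[c'|d v p h1 h2 H IH|d p h1 h2 p' h1' h2' _ IH _ IH'|d p h1 h2 _ IH].
- exact: herm_cst.
- have [_ [P1 i1] [P2 i2]] := herm_ipoly H.
  apply: herm_ext (herm_mul (refl b v) IH) => x; first by rewrite dotv_refll.
    by rewrite (ipoly_dk_refl rsRt psRp mkap _ _ bR i2) reflK dotv_refll.
  by rewrite (ipoly_dk_refl rsRt psRp mkap _ _ bR i1) reflK dotv_refll.
- exact: hermD.
- exact: hermS.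
Qed.

(** The index is not lowered, although the degree is: [herm_transform] only needs the index of T_v p
    to stay below that of <v, .> p. *)
Lemma herm_dk d p h1 h2 v : herm d p h1 h2 ->
  herm d (dk v p) (fun y => - dk v h2 y) (dk v h1).
Proof.
elim=> {d p h1 h2}[c'|d u p h1 h2 H IH|d p h1 h2 p' h1' h2' H IH H' IH'|d p h1 h2 _ IH].
- by apply: herm_ext (herm_cst 0) => x; rewrite dk_cst ?oppr0.
- have [sp s1 s2] := herm_smooth H.
  have [_ [P1 i1] [P2 i2]] := herm_ipoly H.
  pose K a := kap a * dotv a v * (2 * dotv u a / dotv a a).
  have := hermD (herm_mul u IH) (hermS (hermD (hermZ (dotv u v) H)
    (@herm_sum d _ Rp (fun a x => K a * p (refl a x)) (fun a x => K a * h1 (refl a x))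
      (fun a x => K a * h2 (refl a x)) (fun a aR => hermZ (K a) (herm_refl (pos_root psRp aR) H))))).
  have sd1 : smooth (dk u h1) := ipoly_smooth (ipoly_dk rsRt psRp mkap u i1).
  have sd2 : smooth (dk u h2) := ipoly_smooth (ipoly_dk rsRt psRp mkap u i2).
  have sv1 : smooth (dk v h1) := ipoly_smooth (ipoly_dk rsRt psRp mkap v i1).
  have sv2 : smooth (dk v h2) := ipoly_smooth (ipoly_dk rsRt psRp mkap v i2).
  apply: herm_ext => x.
  + by rewrite (dk_mul kap rsRt psRp)// addrA.
  + rewrite (dkB _ _ sd1 (@smooth_mul_dotv _ _ u _ s1)) (dk_mul kap rsRt psRp)//.
    by rewrite (dk_comm rsRt psRp mkap _ _ _ i1) /K; ring.
  + rewrite (dkB _ _ (@smooth_mul_dotv _ _ u _ s2) sd2) (dk_mul kap rsRt psRp)// dkN//.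
    by rewrite (dk_comm rsRt psRp mkap _ _ _ i2) /K; ring.
- have [sp s1 s2] := herm_smooth H; have [sp' s1' s2'] := herm_smooth H'.
  apply: herm_ext (hermD IH IH') => x.
  + by rewrite (dkD _ _ _ _ sp sp').
  + by rewrite (dkD _ _ _ _ s2 s2'); exact/esym/opprD.
  + by rewrite (dkD _ _ _ _ s1 s1').
- exact: hermS.
Qed.

End Hermite.

(** * The transform and the pairing of Hermite polynomials *)

Section HermiteTransform.
Variables (R : realType) (m : nat) (Rt Rp : seq 'rV[R]_m) (kap : 'rV[R]_m -> R).
Hypothesis rsRt : root_system Rt.
Hypothesis psRp : positive_subsystem Rt Rp.
Hypothesis mkap : multiplicity Rt kap.
Implicit Types (a b u v x y z : 'rV[R]_m) (f g p h : 'rV[R]_m -> R).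
Notation Lam := (Lam Rp kap).
Notation dk := (dk Rp kap).
Notation dkC := (dkC Rp kap).
Notation herm := (herm Rp kap).

Lemma hpoly_herm n M p : hpoly n M p -> exists h1 h2, herm n p h1 h2.
Proof.
elim=> {n M p}[c|n M v p _ [h1 [h2 H]]|n M M' p p' _ [h1 [h2 H]] _ [h1' [h2' H']]|n M M' p _ _ //].
- by eexists; eexists; exact: herm_cst.
- by eexists; eexists; exact: (herm_mul v H).
- by eexists; eexists; exact: (hermD H H').
Qed.

Lemma ipoly_herm P p : ipoly P p -> exists d h1 h2, herm d p h1 h2.
Proof.
elim=> {P p}[n M p /hpoly_herm[h1 [h2 H]]|P Q p p' _ [d [h1 [h2 H]]] _ [d' [h1' [h2' H']]]].
  by exists n, h1, h2.
exists (maxn d d'); eexists; eexists.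
exact: (hermD (herm_le (leq_maxl d d') H) (herm_le (leq_maxr d d') H')).
Qed.

Lemma Lam_adjoint P f Q g v : ipoly P f -> ipoly Q g ->
  Lam (fun y => (dotv v y * f y - dk v f y) * g y) = Lam (fun y => f y * dk v g y).
Proof.
move=> pf pg; have := Lam_dkM rsRt psRp mkap v pf pg.
have ef := ipoly_egrowth pf; have eg := ipoly_egrowth pg.
have edf : egrowth (dk v f) := ipoly_egrowth (ipoly_dk rsRt psRp mkap v pf).
have e1 : egrowth (fun x => dk v f x * g x) by exact: egrowthM.
have e2 : egrowth (fun x => dotv v x * (f x * g x)).
  by apply: egrowthM; [exact: egrowth_dotv|exact: egrowthM].
move=> H; have -> : (fun y => (dotv v y * f y - dk v f y) * g y) =
    (fun y => dotv v y * (f y * g y) - dk v f y * g y) by apply/funext => y; ring.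
by rewrite (LamB psRp mkap e2 e1) -H addrC addKr.
Qed.

(** Inversion at the origin. For <v, .> p both sides vanish, because [Lam] annihilates the range of
    <v, .> - T_v, the adjoint of an operator that kills constants. *)
Lemma herm_Lam d p h1 h2 : herm d p h1 h2 ->
  Lam h1 = Lam (fun=> 1) * p 0 /\ Lam h2 = 0.
Proof.
have L0 v h : (exists P, ipoly P h) -> Lam (fun y => dotv v y * h y - dk v h y) = 0.
  move=> [P ih]; have := Lam_adjoint v ih (ipoly_cst m 1).
  under eq_fun do rewrite mulr1.
  move=> ->; rewrite -[RHS](Lam0 psRp mkap); congr Lam; apply/funext => y.
  by rewrite dk_cst mulr0.
elim=> {d p h1 h2}[c|d v p h1 h2 H IH|d p h1 h2 p' h1' h2' H [IH1 IH2] H' [IH1' IH2']|d p h1 h2 _ //].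
- split; last exact: (Lam0 psRp mkap).
  rewrite mulrC -(LamZ psRp mkap); last exact: egrowth_cst.
  by congr Lam; apply/funext => x; rewrite mulr1.
- have [_ i1 i2] := herm_ipoly rsRt psRp mkap H.
  rewrite dotv0r mul0r mulr0 L0//; split => //.
  have [P1 p1] := i1.
  have e : egrowth (fun y => dotv v y * h1 y - dk v h1 y).
    apply: egrowthB; last exact: (ipoly_egrowth (ipoly_dk rsRt psRp mkap v p1)).
    by apply: egrowthM; [exact: egrowth_dotv|exact: (ipoly_egrowth p1)].
  rewrite -[RHS](mulr0 (-1)) -(L0 v h1 i1) -(LamZ psRp mkap)//.
  by congr Lam; apply/funext => y; ring.
- have [_ [P1 /ipoly_egrowth e1] [P2 /ipoly_egrowth e2]] := herm_ipoly rsRt psRp mkap H.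
  have [_ [P1' /ipoly_egrowth e1'] [P2' /ipoly_egrowth e2']] := herm_ipoly rsRt psRp mkap H'.
  by rewrite !(LamD psRp mkap)// IH1 IH2 IH1' IH2' mulrDr addr0.
Qed.

Section Kernel.
Variable E : 'rV[R[i]]_m -> 'rV[R[i]]_m -> R[i].
Hypothesis HE : dunkl_kernel Rp kap E.

(** The transform of <v, .> p involves that of T_v p, whose derivation is not a part of the given
    one; hence an outer induction on d around the induction on derivations. *)
Lemma herm_transform d p h1 h2 y : herm d p h1 h2 ->
  Lam (fun x => kre E y x * p x) = Lam (fun=> 1) * (h1 y * gauss y) /\
  Lam (fun x => kim E y x * p x) = Lam (fun=> 1) * (h2 y * gauss y).
Proof.
have [ekr eki] := kernel_egrowth rsRt psRp mkap HE y.
have [K1 K2] := Lam_kernel1 rsRt psRp mkap HE y.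
have add p1 p2 : egrowth p1 -> egrowth p2 ->
   Lam (fun x => kre E y x * (p1 x + p2 x)) = Lam (fun x => kre E y x * p1 x) + Lam (fun x => kre E y x * p2 x) /\
   Lam (fun x => kim E y x * (p1 x + p2 x)) = Lam (fun x => kim E y x * p1 x) + Lam (fun x => kim E y x * p2 x).
  move=> ep1 ep2; split; rewrite -(LamD psRp mkap); try exact: egrowthM.
    by congr Lam; apply/funext => x; rewrite mulrDr.
  by congr Lam; apply/funext => x; rewrite mulrDr.
elim: d p h1 h2 => [|d IHd] p h1 h2.
  suff base e : herm e p h1 h2 -> e = 0%N ->
      Lam (fun x => kre E y x * p x) = Lam (fun=> 1) * (h1 y * gauss y) /\
      Lam (fun x => kim E y x * p x) = Lam (fun=> 1) * (h2 y * gauss y).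
    by move=> H; exact: base H erefl.
  elim=> {e p h1 h2}[c|//|e p h1 h2 p' h1' h2' H IH H' IH' e0|//].
    move=> _; split.
      transitivity (c * Lam (kre E y)); last by rewrite K1; ring.
      by rewrite -(LamZ psRp mkap)//; congr Lam; apply/funext => x; rewrite mulrC.
    transitivity (c * Lam (kim E y)); last by rewrite K2; ring.
    by rewrite -(LamZ psRp mkap)//; congr Lam; apply/funext => x; rewrite mulrC.
  have [[P /ipoly_egrowth ep] _ _] := herm_ipoly rsRt psRp mkap H.
  have [[P' /ipoly_egrowth ep'] _ _] := herm_ipoly rsRt psRp mkap H'.
  have [A1 A2] := add _ _ ep ep'; have [I1 I2] := IH e0; have [I1' I2'] := IH' e0.
  by rewrite A1 A2 I1 I2 I1' I2'; split; ring.
move: {-2}d.+1 (erefl d.+1) => e e0 H.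
elim: H e0 => {e p h1 h2}[//|e v p h1 h2 H _ [ed]|e p h1 h2 p' h1' h2' H IH H' IH' e0|e p h1 h2 H _ [ed]].
- rewrite ed in H.
  have [[P ip] _ _] := herm_ipoly rsRt psRp mkap H.
  have [-> ->] := Lam_kernel_mul rsRt psRp mkap HE v y ip.
  have [-> ->] := IHd _ _ _ (herm_dk rsRt psRp mkap v H).
  have [-> ->] := IHd _ _ _ H.
  by rewrite (dotvC y v); split; ring.
- have [[P /ipoly_egrowth ep] _ _] := herm_ipoly rsRt psRp mkap H.
  have [[P' /ipoly_egrowth ep'] _ _] := herm_ipoly rsRt psRp mkap H'.
  have [A1 A2] := add _ _ ep ep'; have [I1 I2] := IH e0; have [I1' I2'] := IH' e0.
  by rewrite A1 A2 I1 I2 I1' I2'; split; ring.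
- by rewrite ed in H; exact: IHd.
Qed.

End Kernel.

Section PowerHermite.
Variable z : 'rV[R]_m.

(** Real and imaginary part of the polynomial that iterating [herm_mul] attaches to <z, .>^n. *)
Fixpoint hz n : ('rV[R]_m -> R) * ('rV[R]_m -> R) :=
  if n is n'.+1 then
    (fun y => dotv z y * (hz n').2 y - dk z (hz n').2 y,
     fun y => dk z (hz n').1 y - dotv z y * (hz n').1 y)
  else (fun=> 1, fun=> 0).

Lemma herm_hz n : herm n (fun x => dotv z x ^+ n) (hz n).1 (hz n).2.
Proof.
elim: n => [|n IH]; first exact: herm_cst.
by apply: herm_ext (herm_mul z IH) => x //; rewrite exprS.
Qed.

(** The pairing is bilinear, without conjugation. Each adjunction moves one T_z onto h with a factor
    -i, and T_z h is -i times the polynomial of T_z p; so n steps give (-1)^n and [herm_Lam]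
    evaluates the rest. *)
Lemma Lam_hz n d p h1 h2 : herm d p h1 h2 ->
  Lam (fun y => (hz n).1 y * h1 y) - Lam (fun y => (hz n).2 y * h2 y) =
    (-1) ^+ n * (Lam (fun=> 1) * iter n (dk z) p 0) /\
  Lam (fun y => (hz n).1 y * h2 y) + Lam (fun y => (hz n).2 y * h1 y) = 0.
Proof.
elim: n p h1 h2 => [|n IH] p h1 h2 H.
  have [H1 H2] := herm_Lam H; rewrite /= mul1r -H1.
  have E1 (h : 'rV[R]_m -> R) : (fun y => 1 * h y) = h by apply/funext => y; rewrite mul1r.
  have E0 (h : 'rV[R]_m -> R) : (fun y => 0 * h y) = fun=> 0 by apply/funext => y; rewrite mul0r.
  by rewrite !E1 !E0 (Lam0 psRp mkap) H2 addr0 subr0.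
have [_ [Q1 q1] [Q2 q2]] := herm_ipoly rsRt psRp mkap (herm_hz n).
have [_ [P1 p1] [P2 p2]] := herm_ipoly rsRt psRp mkap H.
have [I1 I2] := IH _ _ _ (herm_dk rsRt psRp mkap z H).
have LN f : egrowth f -> Lam (fun y => - f y) = - Lam f.
  move=> ef; rewrite -mulN1r -(LamZ psRp mkap)//.
  by congr Lam; apply/funext => y; rewrite mulN1r.
have eD P f : ipoly P f -> egrowth (dk z f).
  by move=> pf; exact: (ipoly_egrowth (ipoly_dk rsRt psRp mkap z pf)).
have adj2 P f : ipoly P f -> Lam (fun y => (hz n.+1).1 y * f y) = Lam (fun y => (hz n).2 y * dk z f y).
  by move=> pf; exact: Lam_adjoint q2 pf.
have adj1 P f : ipoly P f -> Lam (fun y => (hz n.+1).2 y * f y) = - Lam (fun y => (hz n).1 y * dk z f y).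
  move=> pf; rewrite -(Lam_adjoint z q1 pf) -LN.
    by congr Lam; apply/funext => y /=; ring.
  apply: egrowthM; last exact: (ipoly_egrowth pf).
  apply: egrowthB; last exact: (eD _ _ q1).
  by apply: egrowthM; [exact: egrowth_dotv|exact: (ipoly_egrowth q1)].
rewrite (adj2 _ _ p1) (adj2 _ _ p2) (adj1 _ _ p1) (adj1 _ _ p2) opprK iterSr.
have N (l f : 'rV[R]_m -> R) : egrowth l -> egrowth f -> Lam (fun y => l y * - f y) = - Lam (fun y => l y * f y).
  move=> el ef; rewrite -LN; last exact: egrowthM.
  by congr Lam; apply/funext => y; rewrite mulrN.
rewrite !N in I1 I2; [|exact: (ipoly_egrowth q2)|exact: (eD _ _ p2)|exact: (ipoly_egrowth q1)|exact: (eD _ _ p2)].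
split; last by rewrite -[RHS]oppr0 -I2 opprB.
by rewrite exprS -mulrA -I1 mulN1r opprB opprK.
Qed.

(** Common majorant of both components: the recursion of [hz] with all signs positive and T_z
    replaced by its action on majorants. *)
Fixpoint hzP n : {poly R} :=
  if n is n'.+1 then enorm z *: ('X * hzP n') + (dkC * enorm z) *: (hzP n')^`() else 1.

Lemma ipoly_hz n : ipoly (hzP n) (hz n).1 /\ ipoly (hzP n) (hz n).2.
Proof.
elim: n => [|n [IH1 IH2]].
  rewrite /= (_ : 1 = 1 *: 'X^0 :> {poly R}); last by rewrite scale1r.
  split; apply: ipoly_h; last exact: hpoly0.
  by rewrite -[X in hpoly _ X](normr1 R); exact: hpoly_cst.
split.
  by apply: (ipolyD (ipoly_mul z IH2)); apply: ipolyN; exact: (ipoly_dk rsRt psRp mkap).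
rewrite /= addrC; apply: (ipolyD (ipoly_dk rsRt psRp mkap z IH1)).
by apply: ipolyN; exact: ipoly_mul.
Qed.

End PowerHermite.

End HermiteTransform.

(** * Growth of the Hermite polynomials in the degree *)

Lemma exp_coeff_le (R : realType) (c : R) n : 0 <= c -> c ^+ n / n`!%:R <= expR c.
Proof.
move=> c0; apply: le_trans (sum_exp_coeff_le n.+1 c0); rewrite big_ord_recr/= lerDr.
by apply: sumr_ge0 => i _; rewrite divr_ge0// exprn_ge0.
Qed.

(* While n <= c the terms grow at most like c^n / n!, afterwards they no
   longer grow. *)
Lemma hermite_rec_bound (R : realType) (a b : R) (r : nat -> R) : 0 <= a -> 0 <= b ->
  r 0%N = 1 -> r 1%N = a -> (forall n, n.+2%:R * r n.+2 = a * r n.+1 + b * r n) ->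
  forall n, 0 <= r n <= expR (a + b).
Proof.
move=> a0 b0 r0 r1 rec; set c := a + b.
have c0 : 0 <= c by rewrite addr_ge0.
have ac : a <= c by rewrite lerDl.
suff H n : [/\ 0 <= r n <= expR c, 0 <= r n.+1 <= expR c &
    n.+1%:R <= c -> r n <= c ^+ n.+1 / n.+1`!%:R /\ r n.+1 <= c ^+ n.+1 / n.+1`!%:R].
  by move=> n; case: (H n).
elim: n => [|n [/andP[p1 l1] /andP[p2 l2] IH]].
  rewrite r0 r1 ler01 a0/= expr1 -[1`!]/1%N divr1; split => //.
  - by apply: le_trans (expR_ge1Dx c); rewrite lerDl.
  - by apply: le_trans (expR_ge1Dx c); apply: le_trans ac _; rewrite lerDr.
have n2 : 0 < n.+2%:R :> R by rewrite ltr0n.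
have E : r n.+2 = (a * r n.+1 + b * r n) / n.+2%:R.
  by rewrite -rec mulrC mulKf// gt_eqF.
have p3 : 0 <= r n.+2 by rewrite E divr_ge0// addr_ge0// mulr_ge0.
have step M : r n <= M -> r n.+1 <= M -> r n.+2 <= c * M / n.+2%:R.
  move=> h1 h2; rewrite E ler_pM2r ?invr_gt0// /c mulrDl.
  by apply: lerD; exact: ler_wpM2l.
have [nc|cn] := leP (n.+2%:R) c.
  have [IH1 IH2] : r n <= c ^+ n.+1 / n.+1`!%:R /\ r n.+1 <= c ^+ n.+1 / n.+1`!%:R.
    by apply: IH; apply: le_trans nc; rewrite ler_nat.
  have EM : c * (c ^+ n.+1 / n.+1`!%:R) / n.+2%:R = c ^+ n.+2 / n.+2`!%:R.
    by rewrite [n.+2`!]factS natrM invfM [c ^+ n.+2]exprS; ring.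
  have h3 : r n.+2 <= c ^+ n.+2 / n.+2`!%:R by rewrite -EM; exact: step.
  have h2 : r n.+1 <= c ^+ n.+2 / n.+2`!%:R.
    apply: le_trans IH2 _; rewrite -EM mulrAC ler_peMl//.
      by rewrite divr_ge0// exprn_ge0.
    by rewrite ler_pdivlMr// mul1r.
  split; [by rewrite p2 l2| |by []].
  by rewrite p3 (le_trans h3)// exp_coeff_le.
split; [by rewrite p2 l2| |by []].
rewrite p3/=; apply: le_trans (step _ l1 l2) _.
by rewrite ler_pdivrMr// mulrC ler_wpM2l ?expR_ge0// ltW.
Qed.

Section HermiteBound.
Variables (R : realType) (m : nat) (Rt Rp : seq 'rV[R]_m) (kap : 'rV[R]_m -> R).
Hypothesis rsRt : root_system Rt.
Hypothesis psRp : positive_subsystem Rt Rp.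
Hypothesis mkap : multiplicity Rt kap.
Variable z : 'rV[R]_m.
Notation dkC := (dkC Rp kap).
Notation hzP := (hzP Rp kap z).
Notation hz := (hz Rp kap z).

(** The Appell property of Hermite polynomials; it makes the recursion of [hzP] a three-term
    recursion for values at a fixed point. *)
Lemma deriv_hzP n : deriv (hzP n.+1) = (n.+1%:R * enorm z) *: hzP n.
Proof.
elim: n => [|n IH].
  by rewrite /= mulr1 derivC scaler0 addr0 derivZ derivX mul1r.
have hzPS k : hzP k.+1 = enorm z *: ('X * hzP k) + (dkC * enorm z) *: deriv (hzP k) by [].
rewrite [in LHS]hzPS derivD !derivZ derivM derivX mul1r IH derivZ -scalerAr.
have -> : n.+2%:R * enorm z = enorm z + n.+1%:R * enorm z by rewrite -[n.+2%:R]natr1; ring.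
rewrite [RHS]scalerDl [in X in _ = _ + X]hzPS scalerDr [X in _ = _ + X]scalerDr -addrA !scalerA.
by congr (_ + (_ *: _ + _ *: _)); ring.
Qed.

(** The geometric factor makes the terms summable in n within a bound of exponential growth in y, as
    dominated convergence in [Wop_cvg] requires. *)
Lemma hz_bound : exists A B : R, forall n y,
  `|(hz n).1 y| / n`!%:R <= 2 ^- n * (A * expR (B * enorm y)) /\
  `|(hz n).2 y| / n`!%:R <= 2 ^- n * (A * expR (B * enorm y)).
Proof.
set al := enorm z; set be := dkC * enorm z.
have al0 : 0 <= al by exact: enorm_ge0.
have be0 : 0 <= be by rewrite mulr_ge0// (dkC_ge0 psRp mkap).
exists (expR (4 * al * be)), (2 * al) => n y.
pose s := enorm y; have s0 : 0 <= s by exact: enorm_ge0.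
(* In this scaling the three-term recursion is that of [hermite_rec_bound], with coefficients 2 al s
   and 4 al be; the power of 2 becomes the geometric factor. *)
pose r k := 2 ^+ k * (hzP k).[s] / k`!%:R.
have rb : forall k, 0 <= r k <= expR (2 * al * s + 4 * al * be).
  apply: hermite_rec_bound.
  - by rewrite mulr_ge0// mulr_ge0.
  - by rewrite mulr_ge0// mulr_ge0.
  - by rewrite /r (_ : hzP 0 = 1%:P)// hornerC expr0 fact0 divr1 mulr1.
  - rewrite /r (_ : hzP 1 = al *: 'X); last by rewrite /= derivC scaler0 addr0 mulr1.
    by rewrite hornerZ hornerX expr1 -[1`!]/1%N divr1 mulrA.
  - move=> k; rewrite /r [hzP k.+2]/(al *: ('X * hzP k.+1) + be *: deriv (hzP k.+1)).
    rewrite deriv_hzP hornerD !hornerZ hornerM hornerX -/al !factS !natrM !exprS.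
    by field; rewrite nat1r -natrD !pnatr_eq0 -lt0n fact_gt0.
have key : (hzP n).[s] / n`!%:R <= 2 ^- n * (expR (4 * al * be) * expR (2 * al * s)).
  have /andP[_] := rb n; rewrite /r -mulrA expRD [expR _ * _]mulrC => h.
  by rewrite ler_pdivlMl ?exprn_gt0.
have [i1 i2] := ipoly_hz rsRt psRp mkap z n.
split; apply: le_trans key; rewrite ler_wpM2r ?invr_ge0//; exact: ipoly_bound.
Qed.

End HermiteBound.

(** * W(p)(z) as a series in T_z *)

Section WopFormula.
Variables (R : realType) (m : nat) (Rt Rp : seq 'rV[R]_m) (kap : 'rV[R]_m -> R).
Hypothesis rsRt : root_system Rt.
Hypothesis psRp : positive_subsystem Rt Rp.
Hypothesis mkap : multiplicity Rt kap.
Variable E : 'rV[R[i]]_m -> 'rV[R[i]]_m -> R[i].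
Hypothesis HE : dunkl_kernel Rp kap E.
Hypothesis c0 : c_kappa Rp kap != 0.
Implicit Types (a b u v x y z : 'rV[R]_m) (f g p h : 'rV[R]_m -> R).
Notation Lam := (Lam Rp kap).
Notation dk := (dk Rp kap).
Notation herm := (herm Rp kap).
Notation hz := (hz Rp kap).
Notation c := (c_kappa Rp kap).

Lemma Lam1 : Lam (fun=> 1) = c.
Proof. by congr intRm; apply/funext => x; rewrite mul1r. Qed.

Lemma Re_cintRm (f : 'rV[R]_m -> R[i]) :
  complex.Re (cintRm f) = intRm (fun x => complex.Re (f x)) /\
  complex.Im (cintRm f) = intRm (fun x => complex.Im (f x)).
Proof. by rewrite /cintRm -complexiE; split; simpc. Qed.

Lemma ReM_real (w : R[i]) (r : R) :
  complex.Re (w * r%:C) = complex.Re w * r /\ complex.Im (w * r%:C) = complex.Im w * r.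
Proof. by rewrite mulrC ReZ ImZ; split; rewrite mulrC. Qed.

Lemma herm_dunkl_transform d p h1 h2 y : herm d p h1 h2 ->
  complex.Re (dunkl_transform Rp kap E (fun x => p x * gauss x) y) = h1 y * gauss y /\
  complex.Im (dunkl_transform Rp kap E (fun x => p x * gauss x) y) = h2 y * gauss y.
Proof.
move=> H; have [H1 H2] := herm_transform rsRt psRp mkap HE y H.
rewrite /dunkl_transform ReZ ImZ !(Re_cintRm _).1 !(Re_cintRm _).2.
rewrite Lam1 in H1 H2.
split; [rewrite -[RHS](mulKf c0) -H1|rewrite -[RHS](mulKf c0) -H2];
  congr (_ * intRm _); apply/funext => x; rewrite ?(ReM_real _ _).1 ?(ReM_real _ _).2.
  by rewrite -/(kre E y x) -!mulrA.
by rewrite -/(kim E y x) -!mulrA.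
Qed.

Section FixedZ.
Variable z : 'rV[R]_m.

Let t n : R := (-1) ^+ n / n`!%:R.

Lemma expR_dotv_cvg x :
  \sum_(n < K) t n * dotv z x ^+ n @[K --> \oo] --> expR (- dotv x z).
Proof.
apply: (@cvg_trans _ (series (exp_coeff (- dotv z x)) K @[K --> \oo])); last first.
  by rewrite dotvC; exact: is_cvg_series_exp_coeff.
apply: near_eq_cvg; apply: nearW => K; rewrite /series/= big_mkord.
apply: eq_bigr => n _; by rewrite /exp_coeff/= /t (exprNn (dotv z x)); ring.
Qed.

(** The transform of <z, .>^n gauss is a polynomial times gauss(y), and the factor exp(|y|^2/2) of
    the kernel cancels this Gaussian exactly. *)
Lemma Lker_cvg y :
  \sum_(n < K) t n * (hz z n).1 y @[K --> \oo] --> complex.Re (Lker Rp kap E y z) /\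
  \sum_(n < K) t n * (hz z n).2 y @[K --> \oo] --> complex.Im (Lker Rp kap E y z).
Proof.
have [ekr eki] := kernel_egrowth rsRt psRp mkap HE y.
pose q K x := \sum_(n < K) t n * dotv z x ^+ n.
have ed n : egrowth (fun x => dotv z x ^+ n).
  have [[P ip] _ _] := herm_ipoly rsRt psRp mkap (herm_hz Rp kap z n).
  exact: (ipoly_egrowth ip).
have cq K : continuous (q K).
  by apply: continuous_sumr => n _; apply: continuous_funZ; case: (ed n).
have bq K : ebounded 1 (enorm z) (q K).
  move=> x; rewrite mul1r; apply: le_trans (ler_norm_sum _ _ _) _.
  apply: le_trans (sum_exp_coeff_le K _); last by rewrite mulr_ge0 ?enorm_ge0.
  apply: ler_sum => n _; rewrite /t !normrM normfV normrX normrN1 expr1n mul1r normr_nat normrX mulrC.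
  rewrite ler_wpM2r ?invr_ge0// lerXn2r ?nnegrE ?mulr_ge0 ?enorm_ge0//.
  exact: dotv_le.
have gy : gauss y * expR (sqnorm y / 2) = 1 by rewrite /gauss -expRD addNr expR0.
have lim (k : 'rV[R]_m -> R) (h : nat -> R) : egrowth k ->
    (forall n, Lam (fun x => k x * dotv z x ^+ n) = c * (h n * gauss y)) ->
    \sum_(n < K) t n * h n @[K --> \oo] -->
      c^-1 * intRm (fun x => k x * (expR (- dotv x z) * gauss x * expR (sqnorm y / 2) * weight Rp kap x)).
  move=> ek kh.
  have -> : intRm (fun x => k x * (expR (- dotv x z) * gauss x * expR (sqnorm y / 2) * weight Rp kap x)) =
     Lam (fun x => expR (sqnorm y / 2) * k x * expR (- dotv x z)).
    by congr intRm; apply/funext => x; ring.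
  have eK : egrowth (fun x => expR (sqnorm y / 2) * k x) by exact: egrowthZ.
  have [cK [A [B bK]]] := eK.
  apply: (@cvg_trans _ (c^-1 * Lam (fun x => expR (sqnorm y / 2) * k x * q K x) @[K --> \oo])).
    apply: near_eq_cvg; apply: nearW => K.
    have -> : (fun x => expR (sqnorm y / 2) * k x * q K x) =
       (fun x => \sum_(n < K) (t n * expR (sqnorm y / 2)) * (k x * dotv z x ^+ n)).
      by apply/funext => x; rewrite /q mulr_sumr; apply: eq_bigr => n _; ring.
    rewrite (Lam_sum psRp mkap); last by move=> n _; apply: egrowthZ; exact: egrowthM.
    rewrite mulr_sumr; apply: eq_bigr => n _.
    rewrite (LamZ psRp mkap); last exact: egrowthM.
    rewrite kh; transitivity (t n * h n * (gauss y * expR (sqnorm y / 2))).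
      by field; exact: c0.
    by rewrite gy mulr1.
  apply: cvgM; first exact: cvg_cst.
  apply: (@Lam_dct _ _ _ _ _ psRp mkap (A * 1) (B + enorm z)
     (fun K x => expR (sqnorm y / 2) * k x * q K x)).
  - by move=> K; apply: continuous_funM.
  - by move=> K; apply: eboundedM.
  - by move=> x; apply: cvgM; [exact: cvg_cst|exact: expR_dotv_cvg].
have E1 := fun n => herm_transform rsRt psRp mkap HE y (herm_hz Rp kap z n).
rewrite /Lker ReZ ImZ (Re_cintRm _).1 (Re_cintRm _).2.
split.
  have -> : (fun x => complex.Re (E (minus_i x) (cvec y) *
     (expR (- dotv x z) * gauss x * expR (sqnorm y / 2) * weight Rp kap x)%:C)) =
     (fun x => kre E y x * (expR (- dotv x z) * gauss x * expR (sqnorm y / 2) * weight Rp kap x)).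
    by apply/funext => x; exact: (ReM_real _ _).1.
  by apply: (lim _ (fun n => (hz z n).1 y)) => // n; rewrite -Lam1; exact: (E1 n).1.
have -> : (fun x => complex.Im (E (minus_i x) (cvec y) *
   (expR (- dotv x z) * gauss x * expR (sqnorm y / 2) * weight Rp kap x)%:C)) =
   (fun x => kim E y x * (expR (- dotv x z) * gauss x * expR (sqnorm y / 2) * weight Rp kap x)).
  by apply/funext => x; exact: (ReM_real _ _).2.
by apply: (lim _ (fun n => (hz z n).2 y)) => // n; rewrite -Lam1; exact: (E1 n).2.
Qed.

(** The partial sums of L(iy, z) stay below 2A exp(B |y|), so summation commutes with the integral
    over y; [Lam_hz] then evaluates each term, and its imaginary part is 0. *)
Lemma Wop_cvg d p h1 h2 : herm d p h1 h2 ->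
  \sum_(n < K) iter n (dk z) p 0 / n`!%:R @[K --> \oo] --> complex.Re (Wop Rp kap E p z) /\
  complex.Im (Wop Rp kap E p z) = 0.
Proof.
move=> H; have [A [B hb]] := hz_bound rsRt psRp mkap z.
pose l1 K y := \sum_(n < K) t n * (hz z n).1 y.
pose l2 K y := \sum_(n < K) t n * (hz z n).2 y.
have [_ [P1 i1] [P2 i2]] := herm_ipoly rsRt psRp mkap H.
have e1 := ipoly_egrowth i1; have e2 := ipoly_egrowth i2.
have eh n : egrowth (hz z n).1 /\ egrowth (hz z n).2.
  have [_ [Q1 q1] [Q2 q2]] := herm_ipoly rsRt psRp mkap (herm_hz Rp kap z n).
  by split; [exact: (ipoly_egrowth q1)|exact: (ipoly_egrowth q2)].
have A0 : 0 <= A.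
  have [h _] := hb 0%N 0; have {h} := le_trans (divr_ge0 (normr_ge0 _) (ler0n _ _)) h.
  by rewrite expr0 invr1 mul1r pmulr_lge0// expR_gt0.
have geo K : \sum_(n < K) (2 : R) ^- n <= 2.
  have -> : \sum_(n < K) (2 : R) ^- n = 2 - 2 * 2 ^- K.
    elim: K => [|K IH]; first by rewrite big_ord0 expr0 invr1 mulr1 subrr.
    by rewrite big_ord_recr/= IH exprS invfM; field; rewrite expf_neq0.
  by rewrite lerBlDr lerDl mulr_ge0// invr_ge0 exprn_ge0.
have bnd (g : nat -> 'rV[R]_m -> R) : (forall n y, `|g n y| / n`!%:R <= 2 ^- n * (A * expR (B * enorm y))) ->
    forall K, ebounded (2 * A) B (fun y => \sum_(n < K) t n * g n y).
  move=> hg K y; apply: le_trans (ler_norm_sum _ _ _) _.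
  apply: (@le_trans _ _ (\sum_(n < K) 2 ^- n * (A * expR (B * enorm y)))).
    apply: ler_sum => n _; rewrite /t !normrM normfV normrX normrN1 expr1n mul1r normr_nat mulrC.
    exact: hg.
  by rewrite -mulr_suml -mulrA ler_wpM2r ?mulr_ge0 ?expR_ge0.
have b1 K : ebounded (2 * A) B (l1 K).
  by apply: (bnd (fun n => (hz z n).1)) => n y; exact: (hb n y).1.
have b2 K : ebounded (2 * A) B (l2 K).
  by apply: (bnd (fun n => (hz z n).2)) => n y; exact: (hb n y).2.
have cl1 K : continuous (l1 K).
  by apply: continuous_sumr => n _; apply: continuous_funZ; case: (eh n).1.
have cl2 K : continuous (l2 K).
  by apply: continuous_sumr => n _; apply: continuous_funZ; case: (eh n).2.
have el1 K : egrowth (l1 K) by split => //; exists (2 * A), B.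
have el2 K : egrowth (l2 K) by split => //; exists (2 * A), B.
pose L1 y := complex.Re (Lker Rp kap E y z).
pose L2 y := complex.Im (Lker Rp kap E y z).
have LL y : l1 K y @[K --> \oo] --> L1 y /\ l2 K y @[K --> \oo] --> L2 y by exact: Lker_cvg.
have WE : complex.Re (Wop Rp kap E p z) = c^-1 * Lam (fun y => L1 y * h1 y - L2 y * h2 y) /\
    complex.Im (Wop Rp kap E p z) = c^-1 * Lam (fun y => L1 y * h2 y + L2 y * h1 y).
  rewrite /Wop ReZ ImZ (Re_cintRm _).1 (Re_cintRm _).2.
  split; congr (_ * intRm _); apply/funext => y; have [T1 T2] := herm_dunkl_transform y H.
    rewrite (ReM_real _ _).1 /L1 /L2; move: T1 T2.
    case: (Lker _ _ _ _ _) => a b; case: (dunkl_transform _ _ _ _ _) => a' b' /= -> ->.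
    by ring.
  rewrite (ReM_real _ _).2 /L1 /L2; move: T1 T2.
  case: (Lker _ _ _ _ _) => a b; case: (dunkl_transform _ _ _ _ _) => a' b' /= -> ->.
  by ring.
have lin (l : nat -> 'rV[R]_m -> R) h K : (forall n, egrowth (l n)) -> egrowth h ->
    Lam (fun y => (\sum_(n < K) t n * l n y) * h y) = \sum_(n < K) t n * Lam (fun y => l n y * h y).
  move=> el ehh; transitivity (Lam (fun y => \sum_(n < K) t n * (l n y * h y))).
    by congr Lam; apply/funext => y; rewrite mulr_suml; apply: eq_bigr => n _; rewrite mulrA.
  rewrite (Lam_sum psRp mkap); last by move=> n _; apply: egrowthZ; exact: egrowthM.
  by apply: eq_bigr => n _; rewrite (LamZ psRp mkap)//; exact: egrowthM.
have dct h h' s : egrowth h -> egrowth h' ->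
   Lam (fun y => l1 K y * h y + s * (l2 K y * h' y)) @[K --> \oo]
     --> Lam (fun y => L1 y * h y + s * (L2 y * h' y)).
  move=> [ch [A1 [B1 bh]]] [ch' [A2 [B2 bh']]].
  apply: (@Lam_dct _ _ _ _ _ psRp mkap (2 * A * A1 + `|s| * (2 * A * A2)) (B + Num.max B1 B2)
    (fun K y => l1 K y * h y + s * (l2 K y * h' y))).
  - move=> K; apply: continuous_funD; first exact: continuous_funM.
    by apply: continuous_funZ; exact: continuous_funM.
  - move=> K y; apply: le_trans (ler_normD _ _) _; rewrite mulrDl lerD//.
      apply: (ebounded_le (eboundedM (b1 K) bh)) => //.
      by rewrite lerD2l le_max lexx.
    rewrite normrM -[leRHS]mulrA; apply: ler_wpM2l => //.
    apply: (ebounded_le (eboundedM (b2 K) bh')) => //.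
    by rewrite lerD2l le_max lexx orbT.
  - move=> y; have [LL1 LL2] := LL y.
    apply: cvgD; first by apply: cvgM; [exact: LL1|exact: cvg_cst].
    apply: cvgM; first exact: cvg_cst.
    by apply: cvgM; [exact: LL2|exact: cvg_cst].
have linK h h' s K : egrowth h -> egrowth h' ->
    Lam (fun y => l1 K y * h y + s * (l2 K y * h' y)) =
    \sum_(n < K) t n * (Lam (fun y => (hz z n).1 y * h y) + s * Lam (fun y => (hz z n).2 y * h' y)).
  move=> eh1 eh2; rewrite (LamD psRp mkap); [|exact: egrowthM|by apply: egrowthZ; exact: egrowthM].
  rewrite (LamZ psRp mkap); last exact: egrowthM.
  rewrite (lin (fun n => (hz z n).1) h K (fun n => (eh n).1) eh1).
  rewrite (lin (fun n => (hz z n).2) h' K (fun n => (eh n).2) eh2).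
  by rewrite mulr_sumr -big_split/=; apply: eq_bigr => n _; ring.
have [-> ->] := WE; split.
  have -> : (fun y => L1 y * h1 y - L2 y * h2 y) = (fun y => L1 y * h1 y + -1 * (L2 y * h2 y)).
    by apply/funext => y; rewrite mulN1r.
  apply: (@cvg_trans _ (c^-1 * Lam (fun y => l1 K y * h1 y + -1 * (l2 K y * h2 y)) @[K --> \oo])).
    apply: near_eq_cvg; apply: nearW => K; rewrite linK// mulr_sumr; apply: eq_bigr => n _.
    rewrite mulN1r (Lam_hz rsRt psRp mkap z n H).1 Lam1 /t.
    (* One sign comes from the expansion of exp(-<x, z>), the other from the pairing. *)
    transitivity ((-1) ^+ n * (-1) ^+ n * (iter n (dk z) p 0 / n`!%:R)).
      by field; rewrite c0 pnatr_eq0 -lt0n fact_gt0.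
    by rewrite -expr2 sqrr_sign mul1r.
  by apply: cvgM; [exact: cvg_cst|exact: dct].
have -> : (fun y => L1 y * h2 y + L2 y * h1 y) = (fun y => L1 y * h2 y + 1 * (L2 y * h1 y)).
  by apply/funext => y; rewrite mul1r.
have L0 : (fun _ : nat => (0 : R)) @ \oo --> Lam (fun y => L1 y * h2 y + 1 * (L2 y * h1 y)).
  apply: (@cvg_trans _ (Lam (fun y => l1 K y * h2 y + 1 * (l2 K y * h1 y)) @[K --> \oo])); last exact: dct.
  apply: near_eq_cvg; apply: nearW => K; rewrite linK// big1// => n _.
  by rewrite mul1r (Lam_hz rsRt psRp mkap z n H).2 mulr0.
by rewrite (@cvg_unique _ _ _ _ _ _ L0 (cvg_cst 0)) ?mulr0.
Qed.

End FixedZ.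
End WopFormula.

(** * Iterates of T_z as functions of z *)

Section IteratedDunkl.
Variables (R : realType) (m : nat) (Rt Rp : seq 'rV[R]_m) (kap : 'rV[R]_m -> R).
Hypothesis rsRt : root_system Rt.
Hypothesis psRp : positive_subsystem Rt Rp.
Hypothesis mkap : multiplicity Rt kap.
Implicit Types (e u v x y z : 'rV[R]_m) (f g p : 'rV[R]_m -> R).
Notation dk := (dk Rp kap).

Lemma iter_dk_ipoly n z P p : ipoly P p -> exists Q, ipoly Q (iter n (dk z) p).
Proof.
move=> ip; elim: n => [|n [Q IH]]; first by exists P.
by eexists; exact: (ipoly_dk rsRt psRp mkap z IH).
Qed.

Lemma iter_dkD n z P p Q q : ipoly P p -> ipoly Q q ->
  iter n (dk z) (fun x => p x + q x) = fun x => iter n (dk z) p x + iter n (dk z) q x.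
Proof.
move=> ip iq; elim: n => // n IH; rewrite iterS IH; apply/funext => x.
have [P' /ipoly_smooth sp] := iter_dk_ipoly n z ip.
have [Q' /ipoly_smooth sq] := iter_dk_ipoly n z iq.
by rewrite (dkD _ _ _ _ sp sq).
Qed.

Lemma iter_dk_comm n z e P p : ipoly P p ->
  dk e (iter n (dk z) p) = iter n (dk z) (dk e p).
Proof.
move=> ip; elim: n => // n IH; rewrite iterS [in RHS]iterS -IH; apply/funext => x.
by have [Q iq] := iter_dk_ipoly n z ip; exact: (dk_comm rsRt psRp mkap _ _ _ iq).
Qed.

Lemma iter_dk_hpoly0 n k M p z : hpoly k M p -> (k < n)%N -> iter n (dk z) p = fun=> 0.
Proof.
have i0 j : iter j (dk z) (fun=> 0) = fun=> 0.
  by elim: j => // j IH; rewrite iterS IH; apply/funext => x; rewrite dk_cst.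
elim: k M p n => [|k IH] M p [|n]// hp; rewrite iterSr.
  move=> _; rewrite (_ : dk z p = fun=> 0)//.
  by apply/funext => x; exact: dk_hpoly0 hp.
by rewrite ltnS; exact: IH (dk_hpoly rsRt psRp mkap z hp).
Qed.

Lemma iter_dk_eventually0 P p : ipoly P p ->
  exists N, forall z n, (N <= n)%N -> iter n (dk z) p = fun=> 0.
Proof.
elim=> {P p}[k M p hp|P Q p q ip [N HN] iq [N' HN']].
  by exists k.+1 => z n kn; exact: iter_dk_hpoly0 hp kn.
exists (maxn N N') => z n; rewrite geq_max => /andP[Nn N'n].
by rewrite (iter_dkD _ _ ip iq) HN// HN'//; apply/funext => x; rewrite addr0.
Qed.

(** Polynomials in a step t with polynomials in x as coefficients: stable under every T_u and
    continuous in t, so that (T_z + t T_e)^n need not be expanded explicitly. *)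
Inductive tpoly : (R -> 'rV[R]_m -> R) -> Prop :=
| tpoly_cst P f : ipoly P f -> tpoly (fun=> f)
| tpoly_mul Q : tpoly Q -> tpoly (fun t x => t * Q t x)
| tpolyD Q Q' : tpoly Q -> tpoly Q' -> tpoly (fun t x => Q t x + Q' t x).

Lemma tpoly_ipoly Q t : tpoly Q -> exists P, ipoly P (Q t).
Proof.
elim=> {Q}[P f H|Q _ [P H]|Q Q' _ [P H] _ [P' H']]; first by exists P.
- by eexists; exact: (ipolyZ t H).
- by eexists; exact: (ipolyD H H').
Qed.

Lemma tpoly_dk Q u : tpoly Q -> tpoly (fun t => dk u (Q t)).
Proof.
elim=> {Q}[P f H|Q H IH|Q Q' H IH H' IH'].
- exact: (tpoly_cst (ipoly_dk rsRt psRp mkap u H)).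
- rewrite (_ : (fun t => _) = (fun t x => t * dk u (Q t) x)); first exact: tpoly_mul.
  apply/funext => t; apply/funext => x.
  by have [P /ipoly_smooth s] := tpoly_ipoly t H; rewrite (@dkZ _ _ _ _ _ _ (Q t) _ s).
- rewrite (_ : (fun t => _) = (fun t x => dk u (Q t) x + dk u (Q' t) x)); first exact: tpolyD.
  apply/funext => t; apply/funext => x.
  have [P /ipoly_smooth s] := tpoly_ipoly t H; have [P' /ipoly_smooth s'] := tpoly_ipoly t H'.
  by rewrite (dkD _ _ _ _ s s').
Qed.

Lemma tpoly_continuous Q x : tpoly Q -> continuous (fun t : R => Q t x).
Proof.
elim=> {Q}[P f H|Q H IH|Q Q' H IH H' IH'].
- exact: continuous_cst.
- by apply: continuous_funM => // t A.
- exact: continuous_funD.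
Qed.

(** Linearity in the direction gives T_(z + te) = T_z + t T_e, and at t = 0 the n products with a
    single T_e coincide by commutativity. For n = 0 the meaningless exponent n - 1 is harmless
    because of the factor n. *)
Lemma iter_dk_expand n z e P p : ipoly P p -> exists2 Q, tpoly Q &
  (forall t x, iter n (dk (z + t *: e)) p x = iter n (dk z) p x + t * Q t x) /\
  Q 0 = fun x => n%:R * iter n.-1 (dk z) (dk e p) x.
Proof.
move=> ip; elim: n => [|n [Q tQ [IH Q0]]].
  exists (fun=> fun=> 0); first exact: (tpoly_cst (ipoly_cst m 0)).
  by split => [t x|]; [rewrite mulr0 addr0|apply/funext => x; rewrite mul0r].
have [A iA] := iter_dk_ipoly n z ip.
exists (fun t x => (dk z (Q t) x + dk e (iter n (dk z) p) x) + t * dk e (Q t) x).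
  apply: tpolyD; last by apply: tpoly_mul; exact: tpoly_dk.
  by apply: tpolyD; [exact: tpoly_dk|exact: (tpoly_cst (ipoly_dk rsRt psRp mkap e iA))].
split => [t x|].
  have [B iB] := tpoly_ipoly t tQ.
  have sA := ipoly_smooth iA; have sB := ipoly_smooth iB.
  have iS := ipolyD iA (ipolyZ t iB).
  rewrite iterS (_ : iter n _ p = fun x => iter n (dk z) p x + t * Q t x); last exact/funext/IH.
  rewrite (ipoly_dk_dirD _ _ _ _ _ iS) (ipoly_dk_dirZ _ _ _ _ _ iS).
  rewrite !(dkD _ _ _ _ sA (smoothZ sB)) !(@dkZ _ _ _ _ _ _ (Q t) _ sB).
  by rewrite iterS; ring.
apply/funext => x; rewrite mul0r addr0 (iter_dk_comm _ _ _ ip) Q0.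
have [C iC] := iter_dk_ipoly n.-1 z (ipoly_dk rsRt psRp mkap e ip).
rewrite (@dkZ _ _ _ _ _ _ _ _ (ipoly_smooth iC)) -natr1 mulrDl mul1r; congr (_ + _).
by case: n {tQ IH Q0 iA iC} => [|n]; rewrite ?mul0r.
Qed.

End IteratedDunkl.

Lemma is_polynomial_ipoly (R : realType) m (p : 'rV[R]_m -> R) :
  is_polynomial p -> exists P, ipoly P p.
Proof.
case=> s; elim: s p => [|c s IH] p ps.
  exists (`|0 : R|%:P); apply: ipoly_ext (ipoly_cst m 0) => x.
  by rewrite ps big_nil.
have [P iP] := IH (fun x => \sum_(c <- s) c.1 * \prod_(i < m) x 0 i ^+ tnth c.2 i) (fun=> erefl).
have [n [M hp]] : exists n M, hpoly n M (fun x : 'rV[R]_m => \prod_(i < m) x 0 i ^+ tnth c.2 i).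
  elim: (index_enum 'I_m) => [|i r [n [M hr]]].
    exists 0%N, `|1 : R|; apply: hpoly_ext (hpoly_cst m 1) => x.
    by rewrite big_nil.
  have [k [N hk]] : exists k N, hpoly k N (fun x : 'rV[R]_m => x 0 i ^+ tnth c.2 i).
    elim: (tnth c.2 i) => [|k [k' [N hk]]].
      by exists 0%N, `|1 : R|; apply: hpoly_ext (hpoly_cst m 1) => x.
    exists k'.+1, (enorm (evec R i) * N); apply: hpoly_ext (hpoly_mul (evec R i) hk) => x.
    by rewrite exprS dotvC dotv_evec.
  exists (k + n)%N, (N * M); apply: hpoly_ext (hpolyM hk hr) => x.
  by rewrite big_cons.
eexists; apply: ipoly_ext (ipolyD (ipoly_h (hpolyZ c.1 hp)) iP) => x.
by rewrite ps big_cons.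
Qed.

(** * Differentiating the finite sum for W *)

Section Intertwining.
Variables (R : realType) (m : nat) (Rt Rp : seq 'rV[R]_m) (kap : 'rV[R]_m -> R).
Hypothesis rsRt : root_system Rt.
Hypothesis psRp : positive_subsystem Rt Rp.
Hypothesis mkap : multiplicity Rt kap.
Variable E : 'rV[R[i]]_m -> 'rV[R[i]]_m -> R[i].
Hypothesis HE : dunkl_kernel Rp kap E.
Notation dk := (dk Rp kap).
Notation W := (Wop Rp kap E).

Lemma Wop_sum P p N (z : 'rV[R]_m) : c_kappa Rp kap != 0 -> ipoly P p ->
  (forall n, (N <= n)%N -> iter n (dk z) p = fun=> 0) ->
  W p z = (\sum_(n < N) iter n (dk z) p 0 / n`!%:R)%:C.
Proof.
move=> c0 ip HN.
have [d [h1 [h2 H]]] := ipoly_herm Rp kap ip.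
have [H1 H2] := Wop_cvg rsRt psRp mkap HE c0 z H.
apply: complex_ext; last by rewrite H2.
apply: (@cvg_unique _ _ _ _ _ _ H1) => //.
apply: (@cvg_trans _ ((fun _ : nat => \sum_(n < N) iter n (dk z) p 0 / n`!%:R) @ \oo)); last exact: cvg_cst.
apply: near_eq_cvg; exists N => // K /= NK.
rewrite -!(big_mkord xpredT (fun n => iter n (dk z) p 0 / n`!%:R)).
rewrite [RHS](big_cat_nat (n := N))//= [X in _ = _ + X]big_nat [X in _ = _ + X]big1 ?addr0// => n /andP[Nn _].
by rewrite HN// mul0r.
Qed.

Lemma Wop_derive P p (e z : 'rV[R]_m) : ipoly P p ->
  ((t%:C)^-1 * (W p (z + t *: e) - W p z)) @[t --> (0 : R)^'] --> W (dk e p) z.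
Proof.
move=> ip; have [c0|c0] := eqVneq (c_kappa Rp kap) 0.
  (* Here the inverse of 0 is 0, so W vanishes identically; this spares a proof that [c_kappa] is
     positive. *)
  have W0 q y : W q y = 0 by rewrite /Wop c0 invr0 rmorph0 mul0r.
  under eq_fun do rewrite !W0 subrr mulr0.
  by rewrite W0; exact: (cvg_cst (0 : R[i])).
have ie := ipoly_dk rsRt psRp mkap e ip.
have [N1 HN1] := iter_dk_eventually0 rsRt psRp mkap ip.
have [N2 HN2] := iter_dk_eventually0 rsRt psRp mkap ie.
pose N := maxn N1 N2.
(* One more term for p than for T_e p: differentiating the term of index n + 1 gives (n + 1)/(n +
   1)! = 1/n! times the n-th iterate on T_e p. *)
have HNp y n : (N.+1 <= n)%N -> iter n (dk y) p = fun=> 0.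
  by move=> /ltnW Nn; apply: HN1; apply: leq_trans Nn; exact: leq_maxl.
have HNe y n : (N <= n)%N -> iter n (dk y) (dk e p) = fun=> 0.
  by move=> Nn; apply: HN2; apply: leq_trans Nn; exact: leq_maxr.
have /choice[Q HQ] n : exists Q, [/\ tpoly Q,
   forall t x, iter n (dk (z + t *: e)) p x = iter n (dk z) p x + t * Q t x &
   Q 0 = fun x => n%:R * iter n.-1 (dk z) (dk e p) x].
  by have [Q tQ [H1 H2]] := iter_dk_expand rsRt psRp mkap n z e ip; exists Q.
have lim : \sum_(n < N.+1) Q n t 0 / n`!%:R @[t --> (0 : R)^'] -->
    \sum_(n < N) iter n (dk z) (dk e p) 0 / n`!%:R.
  have -> : \sum_(n < N) iter n (dk z) (dk e p) 0 / n`!%:R = \sum_(n < N.+1) Q n 0 0 / n`!%:R.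
    rewrite big_ord_recl/= (_ : Q 0%N 0 0 = 0); last by case: (HQ 0%N) => _ _ ->; rewrite mul0r.
    rewrite mul0r add0r; apply: eq_bigr => n _; rewrite /bump/= add1n.
    case: (HQ n.+1) => _ _ ->; rewrite factS natrM /=.
    by field; rewrite nat1r !pnatr_eq0 -lt0n fact_gt0.
  apply: cvg_sumr => n _; apply: cvgM; last exact: cvg_cst.
  apply: cvg_within_filter; case: (HQ n) => tQ _ _.
  exact: (@tpoly_continuous _ _ (Q n) 0 tQ 0).
rewrite (Wop_sum c0 ie (HNe z)).
apply: (@cvg_trans _ ((\sum_(n < N.+1) Q n t 0 / n`!%:R)%:C @[t --> (0 : R)^'])); last first.
  apply: (@continuous_cvg _ _ _ _ _ _ (fun r : R => r%:C : R[i])) lim.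
  exact: continuous_real_complex.
apply: near_eq_cvg; near=> t.
have t0 : t != 0 by near: t; exact: nbhs_dnbhs_neq.
rewrite (Wop_sum c0 ip (HNp z)) (Wop_sum c0 ip (HNp (z + t *: e))).
rewrite -rmorphB -fmorphV -rmorphM; congr (_%:C).
rewrite -sumrB mulr_sumr; apply: eq_bigr => n _.
by case: (HQ n) => _ -> _; field; rewrite t0 pnatr_eq0 -lt0n fact_gt0.
Unshelve. all: by end_near. Qed.

End Intertwining.

Theorem mainTheorem6 (R : realType) (m : nat)
  (Rt Rp : seq 'rV[R]_m) (kap : 'rV[R]_m -> R)
  (E : 'rV[R[i]]_m -> 'rV[R[i]]_m -> R[i]) :
  root_system Rt ->
  positive_subsystem Rt Rp ->
  multiplicity Rt kap ->
  dunkl_kernel Rp kap E ->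
  forall (p : 'rV[R]_m -> R), is_polynomial p ->
  forall (j : 'I_m) (z : 'rV[R]_m),
    ((t%:C)^-1 * (Wop Rp kap E p (z + t *: evec R j) - Wop Rp kap E p z))
      @[t --> (0 : R)^'] -->
    Wop Rp kap E (dunkl id Rp kap j p) z.
Proof.
move=> rs ps mk HE p /is_polynomial_ipoly[P ip] j z.
rewrite (_ : dunkl id Rp kap j p = dk Rp kap (evec R j) p).
  exact: (Wop_derive rs ps mk HE ip).
by apply/funext => x; rewrite dunkl_dk.
Qed.
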